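(* Let $L(s)=\sum_{n\ge1}a_L(n)n^{-s}$ be an element of the Selberg class with polynomial Euler product $\mathcal{S}'$, with Euler product $L(s)=\prod_p\prod_{j=1}^m(1-\alpha_j(p)p^{-s})^{-1}$ for $\Re s>1$. Assume that $L$ satisfies the Selberg normality conjecture in the form \[ \sum_{p\le x}|a_L(p)|^2=(\kappa+o(1))\frac{x}{\log x}\qquad(x\to\infty) \] for some constant $\kappa>0$ (the sum is over primes). Then for every fixed $\sigma\in[1/2,1)$ and all sufficiently large $T$, \[ \max_{t\in[T,2T]}|L(\sigma+it)|\ge \exp\left((C_L(\sigma)+o(1))\frac{(\log T)^{1-\sigma}}{(\log\log T)^{\vartheta(\sigma)}}\right), \] where $\vartheta(1/2)=1/2$ and $\vartheta(\sigma)=1$ for $\sigma\in(1/2,1)$, and \[ C_L(\sigma)=\begin{cases}\kappa^\sigma m^{1-2\sigma}\dfrac{(3-2\sigma)^{3/2-\sigma}}{2(2\sigma-1)^{1/2}} & \text{if } \tfrac12<\sigma<1,\\[2mm] \sqrt{\kappa} & \text{if } \sigma=\tfrac12.\end{cases} \] Here $o(1)$ denotes a quantity tending to $0$ as $T\to\infty$.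
   Context: The Selberg class $\mathcal{S}$ consists of functions $L(s)$ given for $\Re s>1$ by a Dirichlet series $\sum_{n\ge1}a_L(n)n^{-s}$ such that: (i) (Ramanujan hypothesis) $a_L(n)\ll_\varepsilon n^\varepsilon$ for every $\varepsilon>0$; (ii) there is a nonnegative integer $k_0$ such that $(s-1)^{k_0}L(s)$ is entire of finite order; (iii) (functional equation) $\Lambda(s)=\omega\overline{\Lambda(1-\bar s)}$ where $\Lambda(s)=L(s)Q^s\prod_{j=1}^k\Gamma(\lambda_js+\mu_j)$, $|\omega|=1$, $Q\in\mathbb{R}$, $\lambda_j>0$, $\mu_j\in\mathbb{C}$ with $\Re\mu_j\ge0$; (iv) (Euler product) $L(s)=\prod_p\exp\left(\sum_{j\ge1}b(p^j)p^{-js}\right)$ for $\Re s>1$, with $b(p^j)\ll p^{j\delta}$ for some $\delta<1/2$. The class $\mathcal{S}'$ (Selberg class with polynomial Euler product) consists of functions satisfying (i)–(iii) and, instead of (iv), (iv') $L(s)=\prod_p\prod_{j=1}^m(1-\alpha_j(p)p^{-s})^{-1}$ for $\Re s>1$, with complex numbers $\alpha_j(p)$; the integer $m$ is the one appearing in this Euler product. *)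

(* Defs.v *)
From Stdlib Require Import Reals ZArith Znumtheory.
From Coquelicot Require Import Coquelicot.
Open Scope R_scope.

Definition Cexp (z : C) : C := (exp (Re z) * cos (Im z), exp (Re z) * sin (Im z)).

(* x ^ s for real x > 0, principal branch; not meaningful for x <= 0. *)
Definition Rcpow (x : R) (s : C) : C := Cexp (s * RtoC (ln x)).

(* f 0 * ... * f (n - 1) *)
Fixpoint Cprod (f : nat -> C) (n : nat) : C :=
  match n with
  | O => RtoC 1
  | S n' => (Cprod f n' * f n')%C
  end.

Definition C_Lim_seq (u : nat -> C) : C :=
  (real (Lim_seq (fun n => Re (u n))), real (Lim_seq (fun n => Im (u n)))).

(* Gauss's limit  Gamma(z) = lim n! n^z / (z (z + 1) ... (z + n)),  valid on the
   whole complex plane except at the poles 0, -1, -2, ... *)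
Definition CGamma (z : C) : C :=
  C_Lim_seq (fun n =>
    (RtoC (INR (fact n)) * Rcpow (INR n) z
       / Cprod (fun i => z + RtoC (INR i)) (S n))%C).

Definition Gamma_pole (z : C) : Prop := exists n : nat, z = RtoC (- INR n).

Definition is_prime (p : nat) : Prop := prime (Z.of_nat p).

Definition is_prime_dec (p : nat) : {is_prime p} + {~ is_prime p} :=
  prime_dec (Z.of_nat p).

(* The coefficient of n^(-s) is a n; the value a 0 is never used. *)
Definition dirichlet_series (a : nat -> C) (L : C -> C) : Prop :=
  forall s : C, 1 < Re s ->
    is_series (V := C_NormedModule)
      (fun n => (a (S n) * Rcpow (INR (S n)) (- s))%C) (L s).

Definition ramanujan (a : nat -> C) : Prop :=
  forall eps : R, 0 < eps ->
    exists K : R, forall n : nat, (1 <= n)%nat ->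
      Cmod (a n) <= K * Rpower (INR n) eps.

Definition entire (F : C -> C) : Prop :=
  forall s : C, ex_derive (K := C_AbsRing) (V := C_NormedModule) F s.

Definition finite_order (F : C -> C) : Prop :=
  exists rho r : R, forall s : C, r < Cmod s ->
    Cmod (F s) <= exp (Rpower (Cmod s) rho).

(* L may have a pole at 1, so its value there carries no information: the
   entire function (s - 1)^k0 L(s) is only compared with L away from 1. *)
Definition continuation (L : C -> C) : Prop :=
  exists (k0 : nat) (F : C -> C),
    entire F /\ finite_order F /\
    forall s : C, s <> RtoC 1 -> F s = ((s - RtoC 1) ^ k0 * L s)%C.

Definition completed (L : C -> C) (Q : R) (k : nat)
    (lambda : nat -> R) (mu : nat -> C) (s : C) : C :=
  (L s * Rcpow Q s
     * Cprod (fun j => CGamma (RtoC (lambda j) * s + mu j)) k)%C.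

(* Points at which every factor of the completed function is finite. *)
Definition regular_point (k : nat) (lambda : nat -> R) (mu : nat -> C)
    (s : C) : Prop :=
  s <> RtoC 1 /\
  forall j : nat, (j < k)%nat -> ~ Gamma_pole (RtoC (lambda j) * s + mu j)%C.

(* The functional equation is an identity of meromorphic functions; it is
   stated at the points where both sides are finite, a set whose complement is
   discrete. *)
Definition functional_equation (L : C -> C) : Prop :=
  exists (omega : C) (Q : R) (k : nat) (lambda : nat -> R) (mu : nat -> C),
    Cmod omega = 1 /\ 0 < Q /\
    (forall j : nat, (j < k)%nat -> 0 < lambda j /\ 0 <= Re (mu j)) /\
    forall s : C,
      regular_point k lambda mu s ->
      regular_point k lambda mu (RtoC 1 - Cconj s)%C ->
      completed L Q k lambda mu s =
        (omega * Cconj (completed L Q k lambda mu (RtoC 1 - Cconj s)))%C.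

(* alpha j p, for j < m, are the m local parameters at the prime p. *)
Definition local_factor (m : nat) (alpha : nat -> nat -> C) (p : nat) (s : C) : C :=
  Cprod (fun j => / (RtoC 1 - alpha j p * Rcpow (INR p) (- s)))%C m.

(* Cinv is total, so the first clause says that the inverses make sense; the
   product over all primes is the limit of the products over p < N. *)
Definition polynomial_euler_product (m : nat) (alpha : nat -> nat -> C)
    (L : C -> C) : Prop :=
  forall s : C, 1 < Re s ->
    (forall p j : nat, is_prime p -> (j < m)%nat ->
       (RtoC 1 - alpha j p * Rcpow (INR p) (- s))%C <> RtoC 0) /\
    filterlim
      (Cprod (fun p => if is_prime_dec p then local_factor m alpha p s else RtoC 1))
      eventually (locally (L s)).

(* L, with Dirichlet coefficients a, lies in the Selberg class with polynomial
   Euler product, the Euler product being the one given by m and alpha. *)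
Record selberg_class_poly (L : C -> C) (a : nat -> C) (m : nat)
    (alpha : nat -> nat -> C) : Prop := {
  scp_dirichlet : dirichlet_series a L;
  scp_ramanujan : ramanujan a;
  scp_continuation : continuation L;
  scp_functional : functional_equation L;
  scp_euler : polynomial_euler_product m alpha L
}.

Definition prime_square_sum (a : nat -> C) (x : R) : R :=
  sum_f_R0 (fun p => if is_prime_dec p then Cmod (a p) ^ 2 else 0)
    (Z.to_nat (Int_part x)).

Definition selberg_normality (a : nat -> C) (kappa : R) : Prop :=
  exists eps : R -> R, is_lim eps p_infty 0 /\
    Rbar_locally p_infty (fun x =>
      prime_square_sum a x = (kappa + eps x) * (x / ln x)).

Definition is_max_on (f : R -> R) (a b M : R) : Prop :=
  (exists t : R, a <= t <= b /\ f t = M) /\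
  (forall t : R, a <= t <= b -> f t <= M).

Definition vartheta (sigma : R) : R :=
  if Req_EM_T sigma (1 / 2) then 1 / 2 else 1.

Definition C_L (kappa : R) (m : nat) (sigma : R) : R :=
  if Req_EM_T sigma (1 / 2) then sqrt kappa
  else Rpower kappa sigma * Rpower (INR m) (1 - 2 * sigma)
       * (Rpower (3 - 2 * sigma) (3 / 2 - sigma)
          / (2 * Rpower (2 * sigma - 1) (1 / 2))).

(* Main.v *)
Require Import Defs.
From Stdlib Require Import Reals Lra Lia Psatz ZArith Znumtheory List Classical FunctionalExtensionality.
From Stdlib Require FinFun.
From Coquelicot Require Import Coquelicot.
Open Scope R_scope.

(** The resonance method.  Let [R(t)] be a Dirichlet polynomial of length [N = T^(1-o(1))] and
    [K] an entire weight concentrated on [[T, 2T]].  Moving the integral of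
    [L(s) |R|^2 K] from [Re s = sigma] to [Re s = 3], where the Dirichlet series converges
    absolutely, leaves only the diagonal [k n = n'], so
    [max |L(sigma + it)|] is bounded below by a constant times
    [|sum a(k) k^(-sigma) r(n) conj (r(k n))| / sum |r(n)|^2].  The weight is
    [exp (- ((t - 3T/2) / W)^(4h))] with [W = T^(1-1/q)] and [h] large: on the horizontal edges it
    beats any growth of finite order.

    The resonator [r] is multiplicative on squarefree products of primes, with
    [r(p) = a(p) rho(p)]; Rankin's trick removes the condition [n <= N], and the ratio becomes
    [exp (sum |a(p)|^2 rho(p) p^(-sigma) / (1 + |a(p)|^2 rho(p)^2))] under the constraint
    [sum |a(p)|^2 rho(p)^2 log p <= log N].  For [sigma > 1/2] take
    [rho(p) = c (lambda/p)^sigma] for [lambda < p <= b lambda], with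
    [m^2 c^2 = (2 sigma - 1) / (3 - 2 sigma)], and for [sigma = 1/2] take
    [rho(p) = sqrt (lambda/p) / log p] for [lambda < p <= lambda^b].
    The bound [|a(p)| <= m] comes from [|alpha_j(p)| <= 1], which follows from the Ramanujan
    hypothesis at the powers of [p]. *)

(** The kernel limits the length of the polynomial. An off-diagonal term carries a ratio y with |log
    y| >= 1/(2N), and moving the contour by a distance of order W gains exp (- c W / N). With N <=
    T^(1-2/q) this beats every power of T, and the loss in log N is a proportion of order 1/q.

    The value of c solves an extremal problem. The constraint makes lambda about (2 sigma - 1) log T
    / (kappa c^2), and the exponent is then proportional to c^(2 sigma - 1) / (1 + m^2 c^2), which
    is largest at the stated c. The integer m enters through the bound m^2 c^2 for |a(p)|^2 rho(p)^2
    in the denominators. At sigma = 1/2 the factor 1 / log p makes this quantity tend to 0, so m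
    disappears from the constant.

    The coefficients a and the parameters alpha are linked only through the values of L.
    Multiplicativity and the formula for a(p) are recovered by clearing the Euler factors of the
    primes below a bound and comparing Dirichlet coefficients, which the values at large integers
    determine. *)

Lemma Cmod_le_abs (z : C) : Cmod z <= Rabs (Re z) + Rabs (Im z).
Proof.
  destruct z as [x y]; simpl.
  replace (x, y) with (RtoC x + Ci * RtoC y)%C by (apply injective_projections; simpl; ring).
  eapply Rle_trans; [apply Cmod_triangle|].
  rewrite Cmod_mult, Cmod_Ci, !Cmod_R; lra.
Qed.

Lemma im_le_Cmod (z : C) : Rabs (Im z) <= Cmod z.
Proof. apply Rle_trans with (2 := Rmax_Cmod z); apply Rmax_r. Qed.

Lemma Cmod_minus_sym (x y : C) : Cmod (x - y) = Cmod (y - x).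
Proof. rewrite <- Cmod_opp; f_equal; ring. Qed.

Lemma Cmod_triangle_minus (x y : C) : Cmod (x - y) <= Cmod x + Cmod y.
Proof. unfold Cminus; eapply Rle_trans; [apply Cmod_triangle|]; rewrite Cmod_opp; lra. Qed.

Lemma Cmod_triangle_inv (x y : C) : Cmod x - Cmod y <= Cmod (x - y).
Proof.
  assert (Cmod (x - y + y) <= Cmod (x - y) + Cmod y) by apply Cmod_triangle.
  replace (x - y + y)%C with x in H by ring; lra.
Qed.

(** * Continuity and complex differentiability *)

Definition ccont (f : C -> C) (z : C) : Prop :=
  forall eps, 0 < eps -> exists del, 0 < del /\
    forall w, Cmod (w - z) < del -> Cmod (f w - f z) < eps.

(* Caratheodory's form of differentiability. *)
Definition cdiff (f : C -> C) (z : C) : Prop :=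
  exists phi : C -> C, ccont phi z /\
    forall w, (f w - f z = phi w * (w - z))%C.

Lemma ccont_const (c z : C) : ccont (fun _ => c) z.
Proof.
  intros e He; exists 1; split; [lra|]; intros.
  replace (c - c)%C with (RtoC 0) by ring; rewrite Cmod_0; lra.
Qed.

Lemma ccont_id (z : C) : ccont (fun w => w) z.
Proof. intros e He; exists e; auto. Qed.

Lemma ccont_plus (f g : C -> C) (z : C) :
  ccont f z -> ccont g z -> ccont (fun w => f w + g w)%C z.
Proof.
  intros Hf Hg e He.
  destruct (Hf (e/2)) as (d1 & Hd1 & H1); [lra|].
  destruct (Hg (e/2)) as (d2 & Hd2 & H2); [lra|].
  exists (Rmin d1 d2); split; [now apply Rmin_pos|]; intros w Hw.
  specialize (H1 w (Rlt_le_trans _ _ _ Hw (Rmin_l _ _))).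
  specialize (H2 w (Rlt_le_trans _ _ _ Hw (Rmin_r _ _))).
  replace (f w + g w - (f z + g z))%C with ((f w - f z) + (g w - g z))%C by ring.
  eapply Rle_lt_trans; [apply Cmod_triangle|]; lra.
Qed.

Lemma ccont_mult (f g : C -> C) (z : C) :
  ccont f z -> ccont g z -> ccont (fun w => f w * g w)%C z.
Proof.
  intros Hf Hg e He.
  pose proof (Cmod_ge_0 (f z)) as Pf; pose proof (Cmod_ge_0 (g z)) as Pg.
  set (B := Cmod (f z) + Cmod (g z) + 1).
  assert (HB : 1 <= B) by (unfold B; lra).
  set (e' := Rmin 1 (e / (2 * B))).
  assert (He' : 0 < e') by (apply Rmin_pos; [lra|apply Rdiv_lt_0_compat; lra]).
  assert (E1 : e' <= 1) by apply Rmin_l.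
  assert (E2 : e' * (2 * B) <= e).
  { apply Rle_trans with (e / (2 * B) * (2 * B)); [|right; field; lra].
    apply Rmult_le_compat_r; [lra|apply Rmin_r]. }
  destruct (Hf e' He') as (d1 & Hd1 & H1).
  destruct (Hg e' He') as (d2 & Hd2 & H2).
  exists (Rmin d1 d2); split; [now apply Rmin_pos|]; intros w Hw.
  specialize (H1 w (Rlt_le_trans _ _ _ Hw (Rmin_l _ _))).
  specialize (H2 w (Rlt_le_trans _ _ _ Hw (Rmin_r _ _))).
  replace (f w * g w - f z * g z)%C
    with ((f w - f z) * (g w - g z) + ((f w - f z) * g z + f z * (g w - g z)))%C by ring.
  eapply Rle_lt_trans; [apply Cmod_triangle|].
  eapply Rle_lt_trans; [apply Rplus_le_compat_l, Cmod_triangle|].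
  rewrite !Cmod_mult.
  pose proof (Cmod_ge_0 (f w - f z)); pose proof (Cmod_ge_0 (g w - g z)).
  unfold B in *; nra.
Qed.

Lemma ccont_comp (f g : C -> C) (z : C) :
  ccont g z -> ccont f (g z) -> ccont (fun w => f (g w)) z.
Proof.
  intros Hg Hf e He; destruct (Hf e He) as (d & Hd & H).
  destruct (Hg d Hd) as (d' & Hd' & H'); exists d'; split; auto.
Qed.

Lemma ccont_inv (z : C) : z <> RtoC 0 -> ccont Cinv z.
Proof.
  intros Hz e He.
  assert (Pz : 0 < Cmod z) by now apply Cmod_gt_0.
  exists (Rmin (Cmod z / 2) (e * (Cmod z * Cmod z / 2))); split.
  { apply Rmin_pos; [lra|apply Rmult_lt_0_compat; nra]. }
  intros w Hw.
  assert (H1 := Rlt_le_trans _ _ _ Hw (Rmin_l _ _)).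
  assert (H2 := Rlt_le_trans _ _ _ Hw (Rmin_r _ _)).
  assert (Pw : Cmod z / 2 < Cmod w).
  { assert (Cmod z - Cmod w <= Cmod (w - z)).
    { rewrite Cmod_minus_sym; apply Cmod_triangle_inv. }
    lra. }
  assert (Hw0 : w <> RtoC 0) by (apply Cmod_gt_0; lra).
  replace (/ w - / z)%C with (- (w - z) * (/ w * / z))%C by (field; auto).
  rewrite !Cmod_mult, Cmod_opp, !Cmod_inv; auto.
  apply Rle_lt_trans with (Cmod (w - z) * (/ (Cmod z / 2) * / Cmod z)).
  { apply Rmult_le_compat_l; [apply Cmod_ge_0|].
    apply Rmult_le_compat_r; [left; now apply Rinv_0_lt_compat|].
    apply Rinv_le_contravar; lra. }
  apply Rlt_le_trans with (e * (Cmod z * Cmod z / 2) * (/ (Cmod z / 2) * / Cmod z)).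
  { apply Rmult_lt_compat_r; auto.
    apply Rmult_lt_0_compat; apply Rinv_0_lt_compat; lra. }
  right; field; lra.
Qed.

Lemma cdiff_ccont (f : C -> C) (z : C) : cdiff f z -> ccont f z.
Proof.
  intros (phi & Hphi & H) e He.
  assert (K : ccont (fun w => phi w * (w + - z) + f z)%C z).
  { apply ccont_plus; [|apply ccont_const].
    apply ccont_mult; auto; apply ccont_plus; [apply ccont_id|apply ccont_const]. }
  destruct (K e He) as (d & Hd & H1); exists d; split; auto; intros w Hw.
  replace (f w - f z)%C with (phi w * (w + - z) + f z - (phi z * (z + - z) + f z))%C; auto.
  rewrite H; ring.
Qed.

Lemma cdiff_const (c z : C) : cdiff (fun _ => c) z.
Proof. exists (fun _ => RtoC 0); split; [apply ccont_const|intros; ring]. Qed.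

Lemma cdiff_id (z : C) : cdiff (fun w => w) z.
Proof. exists (fun _ => RtoC 1); split; [apply ccont_const|intros; ring]. Qed.

Lemma cdiff_plus (f g : C -> C) (z : C) :
  cdiff f z -> cdiff g z -> cdiff (fun w => f w + g w)%C z.
Proof.
  intros (p & Hp & H) (q & Hq & H'); exists (fun w => p w + q w)%C; split.
  - now apply ccont_plus.
  - intros w; rewrite Cmult_plus_distr_r, <- H, <- H'; ring.
Qed.

Lemma cdiff_mult (f g : C -> C) (z : C) :
  cdiff f z -> cdiff g z -> cdiff (fun w => f w * g w)%C z.
Proof.
  intros Hf (q & Hq & H'); pose proof (cdiff_ccont _ _ Hf) as Cf.
  destruct Hf as (p & Hp & H).
  exists (fun w => p w * g z + f w * q w)%C; split.
  - apply ccont_plus; apply ccont_mult; auto; apply ccont_const.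
  - intros w.
    replace ((p w * g z + f w * q w) * (w - z))%C
      with ((p w * (w - z)) * g z + f w * (q w * (w - z)))%C by ring.
    rewrite <- H, <- H'; ring.
Qed.

Lemma cdiff_comp (f g : C -> C) (z : C) :
  cdiff g z -> cdiff f (g z) -> cdiff (fun w => f (g w)) z.
Proof.
  intros Hg (p & Hp & H); pose proof (cdiff_ccont _ _ Hg) as Cg.
  destruct Hg as (q & Hq & H').
  exists (fun w => p (g w) * q w)%C; split.
  - apply ccont_mult; auto; now apply (ccont_comp p g).
  - intros w; rewrite H, H'; ring.
Qed.

(** The factorisation in [cdiff] is asked for every [w], so the slope of [f] is kept inside the ball
    and the difference quotient of [g] is used outside, where [w - z] is not zero. *)
Lemma cdiff_ext_loc (f g : C -> C) (z : C) (r : R) :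
  0 < r -> (forall w, Cmod (w - z) < r -> f w = g w) -> cdiff f z -> cdiff g z.
Proof.
  intros Hr E (p & Hp & H).
  assert (E0 : f z = g z).
  { apply E; replace (z - z)%C with (RtoC 0) by ring; rewrite Cmod_0; lra. }
  exists (fun w => if Rlt_dec (Cmod (w - z)) r then p w else (g w - g z) / (w - z))%C; split.
  - intros e He; destruct (Hp e He) as (d & Hd & K).
    exists (Rmin d r); split; [now apply Rmin_pos|]; intros w Hw.
    destruct (Rlt_dec (Cmod (w - z)) r) as [_|n].
    2: elim n; apply Rlt_le_trans with (1 := Hw), Rmin_r.
    destruct (Rlt_dec (Cmod (z - z)) r) as [_|n].
    + apply K; apply Rlt_le_trans with (1 := Hw), Rmin_l.
    + elim n; replace (z - z)%C with (RtoC 0) by ring; rewrite Cmod_0; lra.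
  - intros w; destruct (Rlt_dec (Cmod (w - z)) r) as [l|n].
    + rewrite <- H, E0, E; auto.
    + field; intros K; rewrite K, Cmod_0 in n; lra.
Qed.

Lemma cdiff_inv (z : C) : z <> RtoC 0 -> cdiff Cinv z.
Proof.
  intros Hz.
  (* The value at 0 is fixed to be 0, so that the slope at [w = 0] is the explicit number
     [/ (z * z)]. *)
  apply cdiff_ext_loc with (f := fun w => if Ceq_dec w (RtoC 0) then RtoC 0 else Cinv w)
    (r := Cmod z); [now apply Cmod_gt_0| |].
  { intros w Hw; destruct (Ceq_dec w (RtoC 0)) as [->|]; auto.
    exfalso; revert Hw; replace (RtoC 0 - z)%C with (- z)%C by ring; rewrite Cmod_opp; lra. }
  exists (fun w => if Ceq_dec w (RtoC 0) then / (z * z) else - (/ w * / z))%C; split.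
  - intros e He.
    destruct (ccont_mult (fun w => / w) (fun _ => - / z) z (ccont_inv z Hz) (ccont_const _ _) e He)%C
      as (d & Hd & K).
    exists (Rmin d (Cmod z)); split.
    { apply Rmin_pos; auto; now apply Cmod_gt_0. }
    intros w Hw.
    destruct (Ceq_dec w (RtoC 0)) as [->|].
    { exfalso; assert (Hw' := Rlt_le_trans _ _ _ Hw (Rmin_r _ _)); revert Hw'.
      replace (RtoC 0 - z)%C with (- z)%C by ring; rewrite Cmod_opp; lra. }
    destruct (Ceq_dec z (RtoC 0)); [easy|].
    replace (- (/ w * / z) - - (/ z * / z))%C with (/ w * - / z - / z * - / z)%C by ring.
    apply K; apply Rlt_le_trans with (1 := Hw), Rmin_l.
  - intros w; destruct (Ceq_dec z (RtoC 0)); [easy|].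
    destruct (Ceq_dec w (RtoC 0)) as [->|]; field; auto.
Qed.

Lemma cdiff_pow (n : nat) (z : C) : cdiff (fun w => w ^ n)%C z.
Proof.
  induction n as [|n IH].
  - exact (cdiff_const (RtoC 1) z).
  - apply (cdiff_mult (fun w => w) (fun w => w ^ n)%C); auto; apply cdiff_id.
Qed.

Lemma ex_derive_cdiff (f : C -> C) (z : C) :
  ex_derive (K := C_AbsRing) (V := C_NormedModule) f z -> cdiff f z.
Proof.
  intros (l & _ & Hl).
  exists (fun w => if Ceq_dec w z then l else (f w - f z) / (w - z))%C; split.
  2: { intros w; destruct (Ceq_dec w z) as [->|n]; [ring|].
       field; intros E; apply n.
       replace w with (w - z + z)%C by ring; rewrite E; ring. }
  intros e He.
  assert (Hlim : is_filter_lim (locally (T := AbsRing_UniformSpace C_AbsRing) z) z) by (intros P HP; exact HP).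
  destruct (Hl z Hlim (mkposreal (e/2) ltac:(lra))) as (d & Hd).
  exists d; split; [apply cond_pos|]; intros w Hw.
  destruct (Ceq_dec z z) as [_|]; [|easy].
  destruct (Ceq_dec w z) as [->|n].
  { replace (l - l)%C with (RtoC 0) by ring; rewrite Cmod_0; lra. }
  assert (n' : (w - z)%C <> RtoC 0).
  { intros E; apply n; replace w with (w - z + z)%C by ring; rewrite E; ring. }
  assert (P : 0 < Cmod (w - z)) by now apply Cmod_gt_0.
  assert (Hb : Cmod (f w - f z - (w - z) * l) <= e / 2 * Cmod (w - z)).
  { refine (Hd w _); exact Hw. }
  replace ((f w - f z) / (w - z) - l)%C with ((f w - f z - (w - z) * l) / (w - z))%C by now field.
  rewrite Cmod_div; auto.
  apply Rle_lt_trans with (e / 2 * Cmod (w - z) / Cmod (w - z)).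
  - apply Rmult_le_compat_r; auto; left; now apply Rinv_0_lt_compat.
  - apply Rle_lt_trans with (e / 2); [right; field; lra|lra].
Qed.

(** * The complex exponential *)

Lemma Cexp_plus (z w : C) : Cexp (z + w) = (Cexp z * Cexp w)%C.
Proof.
  destruct z as [a b], w as [c d]; unfold Cexp; simpl.
  rewrite exp_plus, cos_plus, sin_plus.
  apply injective_projections; simpl; ring.
Qed.

Lemma Cmod_Cexp (z : C) : Cmod (Cexp z) = exp (Re z).
Proof.
  unfold Cexp.
  replace (exp (Re z) * cos (Im z), exp (Re z) * sin (Im z))
    with (RtoC (exp (Re z)) * (cos (Im z), sin (Im z)))%C
    by (apply injective_projections; simpl; ring).
  rewrite Cmod_mult, Cmod_R, Rabs_pos_eq by (left; apply exp_pos).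
  replace (Cmod (cos (Im z), sin (Im z))) with 1; [ring|].
  pose proof (sin2_cos2 (Im z)) as H; unfold Rsqr in H.
  unfold Cmod, fst, snd; replace (cos (Im z) ^ 2 + sin (Im z) ^ 2) with 1 by lra.
  now rewrite sqrt_1.
Qed.

Lemma Cexp_R (x : R) : Cexp (RtoC x) = RtoC (exp x).
Proof.
  unfold Cexp; simpl; rewrite cos_0, sin_0; apply injective_projections; simpl; ring.
Qed.

Lemma Cexp_0 : Cexp (RtoC 0) = RtoC 1.
Proof. rewrite Cexp_R, exp_0; auto. Qed.

(** Only [1 + x <= exp x] is used: at [- a] it gives [exp a <= 1 / (1 - a)], which is at most
    [1 + a + 2 a^2] on this range. *)
Lemma exp_taylor1 (a : R) : Rabs a <= 1/2 -> 0 <= exp a - 1 - a <= 2 * a ^ 2 /\ exp a <= 2.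
Proof.
  intros H; apply Rabs_le_between in H.
  pose proof (exp_ineq1_le a) as H1; pose proof (exp_ineq1_le (- a)) as H2.
  assert (H3 : exp a * exp (- a) = 1) by (rewrite <- exp_plus, Rplus_opp_r, exp_0; auto).
  pose proof (exp_pos a).
  assert (exp a * (1 - a) <= 1) by nra.
  split; [split; [lra|]|]; nra.
Qed.

Lemma abs_sin_le (x : R) : Rabs (sin x) <= Rabs x.
Proof.
  destruct (MVT_gen sin 0 x cos) as (c & _ & Hc).
  - intros; auto_derive; auto; ring.
  - intros; apply continuity_sin.
  - rewrite sin_0, !Rminus_0_r in Hc; rewrite Hc, Rabs_mult.
    rewrite <- (Rmult_1_l (Rabs x)) at 2; apply Rmult_le_compat_r; [apply Rabs_pos|].
    apply Rabs_le, COS_bound.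
Qed.

Lemma one_minus_cos_le (x : R) : 0 <= 1 - cos x <= x ^ 2 / 2.
Proof.
  pose proof (COS_bound x); split; [lra|].
  replace x with (2 * (x / 2)) at 1 by field; rewrite cos_2a_sin.
  pose proof (abs_sin_le (x / 2)) as Hs.
  apply Rsqr_le_abs_1 in Hs; unfold Rsqr in Hs; nra.
Qed.

Lemma abs_sin_minus_le (x : R) : Rabs x <= 1/2 -> Rabs (sin x - x) <= x ^ 2.
Proof.
  intros Hx; destruct (MVT_gen (fun x => sin x - x) 0 x (fun x => cos x - 1)) as (c & Hc & E).
  - intros; auto_derive; auto; ring.
  - intros y _; apply continuity_pt_minus; [apply continuity_sin|apply continuity_pt_id].
  - rewrite sin_0, !Rminus_0_r in E; rewrite E, Rabs_mult.
    assert (Hc' : Rabs c <= Rabs x).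
    { unfold Rmin, Rmax in Hc; destruct (Rle_dec 0 x).
      - rewrite !Rabs_pos_eq; lra.
      - rewrite !Rabs_left1; lra. }
    assert (Hcc : c ^ 2 <= x ^ 2) by (apply Rsqr_le_abs_1 in Hc'; unfold Rsqr in Hc'; lra).
    pose proof (one_minus_cos_le c).
    rewrite <- (pow2_abs x) in *.
    rewrite Rabs_left1 by lra.
    pose proof (Rabs_pos x); nra.
Qed.

Lemma Cexp_taylor1 (h : C) : Cmod h <= 1/2 -> Cmod (Cexp h - RtoC 1 - h) <= 7 * Cmod h ^ 2.
Proof.
  intros Hh; pose proof (re_le_Cmod h) as Ha; pose proof (im_le_Cmod h) as Hb.
  eapply Rle_trans; [apply Cmod_le_abs|].
  destruct h as [a b]; simpl Re in *; simpl Im in *; set (H := Cmod (a, b)) in *.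
  simpl Re; simpl Im; simpl fst; simpl snd.
  destruct (exp_taylor1 a) as [Ea Ea']; [lra|].
  pose proof (one_minus_cos_le b) as Eb; pose proof (abs_sin_le b) as Sb.
  pose proof (abs_sin_minus_le b ltac:(lra)) as Sb'; pose proof (exp_pos a) as Pa.
  pose proof (Rabs_pos a); pose proof (Rabs_pos b); pose proof (Rabs_pos (sin b)).
  rewrite <- (pow2_abs a) in Ea; rewrite <- (pow2_abs b) in Eb, Sb'.
  assert (R1 : Rabs (exp a * cos b + - (1) + - a) <= 2 * Rabs a ^ 2 + Rabs b ^ 2).
  { replace (exp a * cos b + - (1) + - a) with ((exp a - 1 - a) + - (exp a * (1 - cos b))) by ring.
    eapply Rle_trans; [apply Rabs_triang|].
    rewrite Rabs_Ropp, (Rabs_pos_eq (exp a - 1 - a)), (Rabs_pos_eq (exp a * (1 - cos b))) by nra.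
    nra. }
  assert (R3 : Rabs (exp a - 1) <= 2 * Rabs a).
  { replace (exp a - 1) with ((exp a - 1 - a) + a) by ring.
    eapply Rle_trans; [apply Rabs_triang|]; rewrite (Rabs_pos_eq (exp a - 1 - a)); nra. }
  assert (R2 : Rabs (exp a * sin b + - 0 + - b) <= 2 * Rabs a * Rabs b + Rabs b ^ 2).
  { replace (exp a * sin b + - 0 + - b) with ((exp a - 1) * sin b + (sin b - b)) by ring.
    eapply Rle_trans; [apply Rabs_triang|]; rewrite Rabs_mult.
    apply Rplus_le_compat; auto; apply Rmult_le_compat; auto using Rabs_pos. }
  assert (Rabs a ^ 2 <= H ^ 2) by nra; assert (Rabs b ^ 2 <= H ^ 2) by nra.
  assert (Rabs a * Rabs b <= H ^ 2) by nra.
  lra.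
Qed.

(** The addition formula reduces the slope at [z] to the slope at 0, which is within [7 * Cmod h] of
    1. *)
Lemma cdiff_Cexp (z : C) : cdiff Cexp z.
Proof.
  exists (fun w => if Ceq_dec w z then Cexp z else (Cexp w - Cexp z) / (w - z))%C; split.
  2: { intros w; destruct (Ceq_dec w z) as [->|n]; [ring|].
       field; intros E; apply n.
       replace w with (w - z + z)%C by ring; rewrite E; ring. }
  intros e He; pose proof (exp_pos (Re z)) as Pz.
  exists (Rmin (1/2) (e / (7 * exp (Re z)))); split.
  { apply Rmin_pos; [lra|apply Rdiv_lt_0_compat; lra]. }
  intros w Hw; destruct (Ceq_dec z z) as [_|]; [|easy].
  destruct (Ceq_dec w z) as [->|n].
  { replace (Cexp z - Cexp z)%C with (RtoC 0) by ring; rewrite Cmod_0; lra. }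
  assert (n' : (w - z)%C <> RtoC 0).
  { intros E; apply n; replace w with (w - z + z)%C by ring; rewrite E; ring. }
  assert (P : 0 < Cmod (w - z)) by now apply Cmod_gt_0.
  set (h := (w - z)%C) in *.
  assert (Ew : Cexp w = (Cexp z * Cexp h)%C).
  { rewrite <- Cexp_plus; f_equal; unfold h; ring. }
  replace ((Cexp w - Cexp z) / h - Cexp z)%C
    with (Cexp z * ((Cexp h - RtoC 1 - h) / h))%C by (rewrite Ew; field; auto).
  rewrite Cmod_mult, Cmod_div, Cmod_Cexp; auto.
  assert (H1 := Rlt_le_trans _ _ _ Hw (Rmin_l _ _)).
  assert (H2 := Rlt_le_trans _ _ _ Hw (Rmin_r _ _)).
  apply Rle_lt_trans with (exp (Re z) * (7 * Cmod h ^ 2 / Cmod h)).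
  { apply Rmult_le_compat_l; [lra|]; apply Rmult_le_compat_r.
    - left; now apply Rinv_0_lt_compat.
    - apply Cexp_taylor1; lra. }
  apply Rlt_le_trans with (exp (Re z) * (7 * (e / (7 * exp (Re z))))).
  - apply Rmult_lt_compat_l; auto.
    replace (7 * Cmod h ^ 2 / Cmod h) with (7 * Cmod h) by (field; lra); lra.
  - right; field; lra.
Qed.

(** * Integrals of complex-valued functions and Goursat's theorem *)

Definition rcont (f : R -> C) (t : R) : Prop :=
  continuous (fun t => Re (f t)) t /\ continuous (fun t => Im (f t)) t.

(** Componentwise, so that only real Riemann integrals occur. The price is the factor 2 in
    [Cmod_CI_le], a bounded loss that the error term of the theorem absorbs. *)
Definition CI (f : R -> C) (a b : R) : C :=
  (RInt (fun t => Re (f t)) a b, RInt (fun t => Im (f t)) a b).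

Definition rcont_on (f : R -> C) (a b : R) : Prop :=
  forall t, a <= t <= b -> rcont f t.

Lemma continuous_eps (f : R -> R) (t : R) :
  (forall eps, 0 < eps -> exists del, 0 < del /\
     forall s, Rabs (s - t) < del -> Rabs (f s - f t) < eps) -> continuous f t.
Proof.
  intros H; apply filterlim_locally; intros eps.
  destruct (H eps (cond_pos eps)) as (d & Hd & K).
  exists (mkposreal d Hd); intros s Hs; apply K; exact Hs.
Qed.

Lemma rcont_path (f : C -> C) (g : R -> C) (t : R) :
  (forall s, Cmod (g s - g t) <= Rabs (s - t)) -> ccont f (g t) -> rcont (fun s => f (g s)) t.
Proof.
  intros Hg Hf; split; apply continuous_eps; intros e He;
    destruct (Hf e He) as (d & Hd & K); exists d; split; auto; intros s Hs;
    assert (K' := K (g s) (Rle_lt_trans _ _ _ (Hg s) Hs)).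
  - replace (Re (f (g s)) - Re (f (g t))) with (Re (f (g s) - f (g t))) by reflexivity.
    eapply Rle_lt_trans; [apply re_le_Cmod|auto].
  - replace (Im (f (g s)) - Im (f (g t))) with (Im (f (g s) - f (g t))) by reflexivity.
    eapply Rle_lt_trans; [apply im_le_Cmod|auto].
Qed.

Lemma rcont_vert (f : C -> C) (u t : R) : ccont f (u, t) -> rcont (fun s => f (u, s)) t.
Proof.
  apply (rcont_path f (fun s => (u, s))); intros s.
  eapply Rle_trans; [apply Cmod_le_abs|]; simpl.
  replace (u + - u) with 0 by ring; rewrite Rabs_R0; unfold Rminus; lra.
Qed.

Lemma rcont_horiz (f : C -> C) (u t : R) : ccont f (t, u) -> rcont (fun s => f (s, u)) t.
Proof.
  apply (rcont_path f (fun s => (s, u))); intros s.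
  eapply Rle_trans; [apply Cmod_le_abs|]; simpl.
  replace (u + - u) with 0 by ring; rewrite Rabs_R0; unfold Rminus; lra.
Qed.

Lemma rcont_on_ex_RInt (f : R -> C) (a b : R) : a <= b -> rcont_on f a b ->
  ex_RInt (fun t => Re (f t)) a b /\ ex_RInt (fun t => Im (f t)) a b.
Proof.
  intros Hab H; split; apply (ex_RInt_continuous (V := R_CompleteNormedModule)); intros z Hz;
    rewrite Rmin_left, Rmax_right in Hz by auto; apply H; auto.
Qed.

Lemma rcont_plus (f g : R -> C) (t : R) :
  rcont f t -> rcont g t -> rcont (fun s => f s + g s)%C t.
Proof.
  intros [] []; split; simpl;
    [apply (continuous_plus (fun s => Re (f s)) (fun s => Re (g s)))
    |apply (continuous_plus (fun s => Im (f s)) (fun s => Im (g s)))]; auto.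
Qed.

Lemma rcont_mult (f g : R -> C) (t : R) :
  rcont f t -> rcont g t -> rcont (fun s => f s * g s)%C t.
Proof.
  intros [H1 H2] [H3 H4]; split; simpl.
  - apply (continuous_minus (fun s => Re (f s) * Re (g s)) (fun s => Im (f s) * Im (g s)));
      apply (continuous_mult (K := R_AbsRing)); auto.
  - apply (continuous_plus (fun s => Re (f s) * Im (g s)) (fun s => Im (f s) * Re (g s)));
      apply (continuous_mult (K := R_AbsRing)); auto.
Qed.

Lemma rcont_const (c : C) (t : R) : rcont (fun _ => c) t.
Proof. split; apply continuous_const. Qed.

Lemma CI_ext (f g : R -> C) (a b : R) : a <= b ->
  (forall t, a <= t <= b -> f t = g t) -> CI f a b = CI g a b.
Proof.
  intros Hab H; unfold CI; f_equal; apply RInt_ext; intros t Ht;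
    rewrite Rmin_left, Rmax_right in Ht by auto; rewrite H; auto; lra.
Qed.

Lemma CI_plus (f g : R -> C) (a b : R) : a <= b -> rcont_on f a b -> rcont_on g a b ->
  CI (fun t => f t + g t)%C a b = (CI f a b + CI g a b)%C.
Proof.
  intros Hab Hf Hg.
  destruct (rcont_on_ex_RInt f a b) as [f1 f2]; auto.
  destruct (rcont_on_ex_RInt g a b) as [g1 g2]; auto.
  apply injective_projections.
  - apply (RInt_plus (V := R_CompleteNormedModule) (fun t => Re (f t)) (fun t => Re (g t))); auto.
  - apply (RInt_plus (V := R_CompleteNormedModule) (fun t => Im (f t)) (fun t => Im (g t))); auto.
Qed.

Lemma CI_scal (c : C) (f : R -> C) (a b : R) : a <= b -> rcont_on f a b ->
  CI (fun t => c * f t)%C a b = (c * CI f a b)%C.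
Proof.
  intros Hab Hf.
  destruct (rcont_on_ex_RInt f a b) as [f1 f2]; auto.
  assert (S : forall k g, ex_RInt g a b -> ex_RInt (fun t => k * g t) a b /\
     RInt (fun t => k * g t) a b = k * RInt g a b).
  { intros k g Hg; split; [exact (ex_RInt_scal (V := R_NormedModule) g a b k Hg)
      |exact (RInt_scal (V := R_CompleteNormedModule) g a b k Hg)]. }
  apply injective_projections; simpl.
  - destruct (S (Re c) _ f1) as [S1 E1]; destruct (S (Im c) _ f2) as [S2 E2].
    unfold Re, Im in *; rewrite <- E1, <- E2.
    exact (RInt_minus (V := R_CompleteNormedModule) _ _ a b S1 S2).
  - destruct (S (Re c) _ f2) as [S1 E1]; destruct (S (Im c) _ f1) as [S2 E2].
    unfold Re, Im in *; rewrite <- E1, <- E2.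
    exact (RInt_plus (V := R_CompleteNormedModule) _ _ a b S1 S2).
Qed.

Lemma CI_Chasles (f : R -> C) (a b c : R) : a <= b -> b <= c -> rcont_on f a c ->
  (CI f a b + CI f b c = CI f a c)%C.
Proof.
  intros Hab Hbc Hf.
  destruct (rcont_on_ex_RInt f a b) as [f1 f2]; auto.
  { intros t Ht; apply Hf; lra. }
  destruct (rcont_on_ex_RInt f b c) as [g1 g2]; auto.
  { intros t Ht; apply Hf; lra. }
  apply injective_projections;
    [exact (RInt_Chasles (V := R_CompleteNormedModule) _ a b c f1 g1)
    |exact (RInt_Chasles (V := R_CompleteNormedModule) _ a b c f2 g2)].
Qed.

Lemma Cmod_CI_le (f : R -> C) (g : R -> R) (a b : R) : a <= b ->
  rcont_on f a b -> ex_RInt g a b -> (forall t, a <= t <= b -> Cmod (f t) <= g t) ->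
  Cmod (CI f a b) <= 2 * RInt g a b.
Proof.
  intros Hab Hf Hg H.
  destruct (rcont_on_ex_RInt f a b) as [f1 f2]; auto.
  eapply Rle_trans; [apply Cmod_le_abs|].
  assert (forall h, ex_RInt h a b -> (forall t, a <= t <= b -> Rabs (h t) <= g t) ->
            Rabs (RInt h a b) <= RInt g a b) as K.
  { intros h Hh Hb; eapply Rle_trans; [apply abs_RInt_le; auto|].
    apply RInt_le; auto; [apply (ex_RInt_norm h); auto|].
    intros; apply Hb; lra. }
  assert (K1 := K _ f1 (fun t Ht => Rle_trans _ _ _ (re_le_Cmod _) (H t Ht))).
  assert (K2 := K _ f2 (fun t Ht => Rle_trans _ _ _ (im_le_Cmod _) (H t Ht))).
  simpl; lra.
Qed.

Lemma Cmod_CI_le_const (f : R -> C) (a b M : R) : a <= b ->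
  rcont_on f a b -> (forall t, a <= t <= b -> Cmod (f t) <= M) ->
  Cmod (CI f a b) <= 2 * (b - a) * M.
Proof.
  intros Hab Hf H.
  eapply Rle_trans; [apply (Cmod_CI_le f (fun _ => M)); auto; apply ex_RInt_const|].
  rewrite RInt_const; unfold scal; simpl; unfold mult; simpl; lra.
Qed.

(** The contour integral over the boundary, counterclockwise: dz is dx on the horizontal sides and i
    dy on the vertical ones. *)
Definition rect_int (f : C -> C) (x1 x2 y1 y2 : R) : C :=
  (CI (fun x => f (x, y1)) x1 x2 - CI (fun x => f (x, y2)) x1 x2
   + Ci * (CI (fun y => f (x2, y)) y1 y2 - CI (fun y => f (x1, y)) y1 y2))%C.

Definition ccont_rect (f : C -> C) (x1 x2 y1 y2 : R) : Prop :=
  forall x y, x1 <= x <= x2 -> y1 <= y <= y2 -> ccont f (x, y).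

Lemma rect_int_plus (f g : C -> C) (x1 x2 y1 y2 : R) : x1 <= x2 -> y1 <= y2 ->
  ccont_rect f x1 x2 y1 y2 -> ccont_rect g x1 x2 y1 y2 ->
  rect_int (fun z => f z + g z)%C x1 x2 y1 y2
  = (rect_int f x1 x2 y1 y2 + rect_int g x1 x2 y1 y2)%C.
Proof.
  intros Hx Hy Hf Hg; unfold rect_int.
  rewrite (CI_plus (fun x => f (x, y1)) (fun x => g (x, y1)));
    try rewrite (CI_plus (fun x => f (x, y2)) (fun x => g (x, y2)));
    try rewrite (CI_plus (fun y => f (x1, y)) (fun y => g (x1, y)));
    try rewrite (CI_plus (fun y => f (x2, y)) (fun y => g (x2, y))); try assumption;
    try (intros t Ht; apply rcont_horiz; first [apply Hf|apply Hg]; lra);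
    try (intros t Ht; apply rcont_vert; first [apply Hf|apply Hg]; lra).
  ring.
Qed.

Lemma rect_int_split (f : C -> C) (x1 x2 x3 y1 y2 y3 : R) :
  x1 <= x2 -> x2 <= x3 -> y1 <= y2 -> y2 <= y3 -> ccont_rect f x1 x3 y1 y3 ->
  rect_int f x1 x3 y1 y3
  = (rect_int f x1 x2 y1 y2 + rect_int f x2 x3 y1 y2
     + (rect_int f x1 x2 y2 y3 + rect_int f x2 x3 y2 y3))%C.
Proof.
  intros H1 H2 H3 H4 Hf; unfold rect_int.
  assert (X : forall y, y1 <= y <= y3 ->
    CI (fun x => f (x, y)) x1 x3 = (CI (fun x => f (x, y)) x1 x2 + CI (fun x => f (x, y)) x2 x3)%C).
  { intros y Hy; rewrite CI_Chasles; auto; intros t Ht; apply rcont_horiz, Hf; lra. }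
  assert (Y : forall x, x1 <= x <= x3 ->
    CI (fun y => f (x, y)) y1 y3 = (CI (fun y => f (x, y)) y1 y2 + CI (fun y => f (x, y)) y2 y3)%C).
  { intros x Hx; rewrite CI_Chasles; auto; intros t Ht; apply rcont_vert, Hf; lra. }
  rewrite !X, !Y by lra; ring.
Qed.

Lemma RInt_affine (c d a b : R) :
  RInt (fun t => c + d * t) a b = c * (b - a) + d * (b * b - a * a) / 2.
Proof.
  apply is_RInt_unique.
  replace (c * (b - a) + d * (b * b - a * a) / 2)
    with (minus (c * b + d * (b * b) / 2) (c * a + d * (a * a) / 2))
    by (unfold minus, plus, opp; simpl; field).
  apply (is_RInt_derive (fun t => c * t + d * (t * t) / 2)).
  - intros; auto_derive; auto; field.
  - intros x _; apply (ex_derive_continuous (fun t => c + d * t)); auto_derive; auto.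
Qed.

Lemma rect_int_affine (c d : C) (x1 x2 y1 y2 : R) :
  rect_int (fun z => c + d * z)%C x1 x2 y1 y2 = RtoC 0.
Proof.
  destruct c as [c1 c2], d as [d1 d2].
  assert (HR : forall y a b, RInt (fun t => Re ((c1, c2) + (d1, d2) * (t, y))%C) a b
     = RInt (fun t => (c1 - d2 * y) + d1 * t) a b).
  { intros; apply RInt_ext; intros; simpl; ring. }
  assert (HI : forall y a b, RInt (fun t => Im ((c1, c2) + (d1, d2) * (t, y))%C) a b
     = RInt (fun t => (c2 + d1 * y) + d2 * t) a b).
  { intros; apply RInt_ext; intros; simpl; ring. }
  assert (VR : forall x a b, RInt (fun t => Re ((c1, c2) + (d1, d2) * (x, t))%C) a b
     = RInt (fun t => (c1 + d1 * x) + (- d2) * t) a b).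
  { intros; apply RInt_ext; intros; simpl; ring. }
  assert (VI : forall x a b, RInt (fun t => Im ((c1, c2) + (d1, d2) * (x, t))%C) a b
     = RInt (fun t => (c2 + d2 * x) + d1 * t) a b).
  { intros; apply RInt_ext; intros; simpl; ring. }
  unfold rect_int, CI; rewrite !HR, !HI, !VR, !VI, !RInt_affine.
  apply injective_projections; simpl; field.
Qed.

Lemma Cmod_rect_int_le (f : C -> C) (x1 x2 y1 y2 M : R) : x1 <= x2 -> y1 <= y2 ->
  ccont_rect f x1 x2 y1 y2 ->
  (forall x y, x1 <= x <= x2 -> y1 <= y <= y2 -> Cmod (f (x, y)) <= M) ->
  Cmod (rect_int f x1 x2 y1 y2) <= 4 * (x2 - x1 + (y2 - y1)) * M.
Proof.
  intros Hx Hy Hf HM; unfold rect_int.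
  assert (X : forall y, y1 <= y <= y2 -> Cmod (CI (fun x => f (x, y)) x1 x2) <= 2 * (x2 - x1) * M).
  { intros y Hy'; apply Cmod_CI_le_const; auto; intros t Ht.
    apply rcont_horiz, Hf; lra. }
  assert (Y : forall x, x1 <= x <= x2 -> Cmod (CI (fun y => f (x, y)) y1 y2) <= 2 * (y2 - y1) * M).
  { intros y Hy'; apply Cmod_CI_le_const; auto; intros t Ht.
    apply rcont_vert, Hf; lra. }
  eapply Rle_trans; [apply Cmod_triangle|].
  eapply Rle_trans; [apply Rplus_le_compat; [apply Cmod_triangle_minus|]|].
  { rewrite Cmod_mult, Cmod_Ci, Rmult_1_l; apply Cmod_triangle_minus. }
  pose proof (X y1 ltac:(lra)); pose proof (X y2 ltac:(lra)).
  pose proof (Y x1 ltac:(lra)); pose proof (Y x2 ltac:(lra)); lra.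
Qed.

(** The affine part of [f] at [z] has zero boundary integral. The remainder is
    [(phi w - phi z) * (w - z)], at most [eps / 4] times the half-perimeter, and [Cmod_rect_int_le]
    brings in four more half-perimeters. *)
Lemma goursat_local (f : C -> C) (z : C) (eps : R) : 0 < eps -> cdiff f z ->
  exists del, 0 < del /\ forall x1 x2 y1 y2,
    x1 <= Re z <= x2 -> y1 <= Im z <= y2 -> x2 - x1 + (y2 - y1) < del ->
    ccont_rect f x1 x2 y1 y2 ->
    Cmod (rect_int f x1 x2 y1 y2) <= eps * (x2 - x1 + (y2 - y1)) ^ 2.
Proof.
  intros He (phi & Hphi & E).
  destruct (Hphi (eps / 4)) as (d & Hd & K); [lra|].
  exists d; split; auto; intros x1 x2 y1 y2 Hx Hy Hs Hf.
  set (lin := fun w => (f z - phi z * z + phi z * w)%C).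
  set (rem := fun w => (f w + (- (f z - phi z * z) + - phi z * w))%C).
  assert (Hlin : forall x y, ccont (fun w => - (f z - phi z * z) + - phi z * w)%C (x, y)).
  { intros; apply ccont_plus; [apply ccont_const|].
    apply ccont_mult; [apply ccont_const|apply ccont_id]. }
  assert (Hrem : ccont_rect rem x1 x2 y1 y2).
  { intros x y ? ?; apply ccont_plus; auto. }
  assert (R : rect_int rem x1 x2 y1 y2 = rect_int f x1 x2 y1 y2).
  { unfold rem; rewrite rect_int_plus; try lra; auto.
    - rewrite rect_int_affine; ring.
    - intros x y ? ?; apply Hlin. }
  rewrite <- R; eapply Rle_trans.
  - apply (Cmod_rect_int_le _ _ _ _ _ (eps / 4 * (x2 - x1 + (y2 - y1)))); try lra; auto.
    intros x y Hx' Hy'; unfold rem.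
    assert (B : Cmod ((x, y) - z) <= x2 - x1 + (y2 - y1)).
    { eapply Rle_trans; [apply Cmod_le_abs|]; destruct z as [u v]; simpl in *.
      apply Rplus_le_compat; apply Rabs_le; lra. }
    replace (f (x, y) + (- (f z - phi z * z) + - phi z * (x, y)))%C
      with ((phi (x, y) - phi z) * ((x, y) - z))%C.
    2: { replace ((phi (x, y) - phi z) * ((x, y) - z))%C
           with (phi (x, y) * ((x, y) - z) - phi z * ((x, y) - z))%C by ring.
         rewrite <- E; ring. }
    rewrite Cmod_mult; apply Rmult_le_compat; try apply Cmod_ge_0; auto.
    left; apply K; lra.
  - right; field.
Qed.

Section Goursat.

Variables (f : C -> C) (x0 y0 w h eps : R).
Hypotheses (Hw : 0 <= w) (Hh : 0 <= h) (He : 0 < eps).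
Hypothesis Hf : forall x y, x0 <= x <= x0 + w -> y0 <= y <= y0 + h -> cdiff f (x, y).

(** The bound is quadratic in the half-perimeter, so the bounds of the four quarters add up to the
    bound of the whole, and a rectangle that violates it has a quarter that does. *)
Let small (n : nat) (q : R * R) : Prop :=
  Cmod (rect_int f (fst q) (fst q + w / 2 ^ n) (snd q) (snd q + h / 2 ^ n))
  <= eps * ((w + h) / 2 ^ n) ^ 2.

Let child (n : nat) (q : R * R) (a b : R) : R * R :=
  (fst q + a * (w / 2 ^ S n), snd q + b * (h / 2 ^ S n)).

Let small_dec (n : nat) (q : R * R) : {small n q} + {~ small n q}.
Proof. apply Rle_dec. Defined.

(** The first quarter on which the bound fails. The fourth one needs no test: if the other three are
    small and the whole is not, [small_join] shows that it fails. *)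
Let next (n : nat) (q : R * R) : R * R :=
  if small_dec (S n) (child n q 0 0) then
    if small_dec (S n) (child n q 1 0) then
      if small_dec (S n) (child n q 0 1) then child n q 1 1
      else child n q 0 1
    else child n q 1 0
  else child n q 0 0.

Fixpoint bisect (n : nat) : R * R :=
  match n with O => (x0, y0) | S n' => next n' (bisect n') end.

Let inside (n : nat) (q : R * R) : Prop :=
  x0 <= fst q /\ fst q + w / 2 ^ n <= x0 + w /\ y0 <= snd q /\ snd q + h / 2 ^ n <= y0 + h.

Let half (u : R) (n : nat) : u / 2 ^ n = 2 * (u / 2 ^ S n).
Proof. simpl; field; apply pow_nonzero; lra. Qed.

Let pos (u : R) (n : nat) : 0 <= u -> 0 <= u / 2 ^ n.
Proof.
  intros; apply Rmult_le_pos; auto; left; apply Rinv_0_lt_compat, pow_lt; lra.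
Qed.

Let small_join (n : nat) (q : R * R) : inside n q ->
  small (S n) (child n q 0 0) -> small (S n) (child n q 1 0) ->
  small (S n) (child n q 0 1) -> small (S n) (child n q 1 1) -> small n q.
Proof.
  intros (I1 & I2 & I3 & I4) S1 S2 S3 S4.
  unfold small, child in *; cbn [fst snd] in *.
  pose proof (pos w (S n) Hw); pose proof (pos h (S n) Hh).
  rewrite !(half _ n) in *; set (w' := w / 2 ^ S n) in *; set (h' := h / 2 ^ S n) in *.
  set (s' := (w + h) / 2 ^ S n) in *.
  destruct q as [x y]; cbn [fst snd] in *.
  replace (x + 0 * w') with x in * by ring; replace (y + 0 * h') with y in * by ring.
  replace (x + 1 * w') with (x + w') in * by ring; replace (y + 1 * h') with (y + h') in * by ring.
  replace (x + w' + w') with (x + 2 * w') in * by ring.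
  replace (y + h' + h') with (y + 2 * h') in * by ring.
  rewrite (rect_int_split f x (x + w') (x + 2 * w') y (y + h') (y + 2 * h')); try lra.
  2: { intros u v ? ?; apply cdiff_ccont, Hf; lra. }
  eapply Rle_trans; [apply Cmod_triangle|].
  eapply Rle_trans; [apply Rplus_le_compat; apply Cmod_triangle|]; lra.
Qed.

Let next_spec (n : nat) (q : R * R) : inside n q -> ~ small n q ->
  ~ small (S n) (next n q) /\ inside (S n) (next n q) /\
  fst q <= fst (next n q) /\ fst (next n q) + w / 2 ^ S n <= fst q + w / 2 ^ n /\
  snd q <= snd (next n q) /\ snd (next n q) + h / 2 ^ S n <= snd q + h / 2 ^ n.
Proof.
  intros I N; pose proof (small_join n q I) as J.
  pose proof (pos w (S n) Hw); pose proof (pos h (S n) Hh).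
  split.
  - unfold next; destruct (small_dec (S n) (child n q 0 0)); auto.
    destruct (small_dec (S n) (child n q 1 0)); auto.
    destruct (small_dec (S n) (child n q 0 1)); auto.
  - unfold inside in *; rewrite !(half _ n) in *.
    unfold next; destruct (small_dec (S n) (child n q 0 0));
    [destruct (small_dec (S n) (child n q 1 0));
     [destruct (small_dec (S n) (child n q 0 1))|]|]; unfold child; cbn [fst snd];
    repeat split; lra.
Qed.

Let bisect_spec (n : nat) : ~ small 0 (x0, y0) -> inside n (bisect n) /\ ~ small n (bisect n).
Proof.
  intros N; induction n as [|n [I1 I2]].
  - split; auto; unfold inside; simpl; repeat split; lra.
  - simpl bisect; destruct (next_spec n _ I1 I2) as (? & ? & _); auto.
Qed.

Let bisect_nested (n k : nat) : ~ small 0 (x0, y0) ->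
  fst (bisect n) <= fst (bisect (n + k)) /\
  fst (bisect (n + k)) + w / 2 ^ (n + k) <= fst (bisect n) + w / 2 ^ n /\
  snd (bisect n) <= snd (bisect (n + k)) /\
  snd (bisect (n + k)) + h / 2 ^ (n + k) <= snd (bisect n) + h / 2 ^ n.
Proof.
  intros N; induction k as [|k IH].
  - rewrite Nat.add_0_r; lra.
  - rewrite Nat.add_succ_r; destruct (bisect_spec (n + k) N) as [I1 I2].
    destruct (next_spec _ _ I1 I2) as (_ & _ & ?); simpl bisect; lra.
Qed.

Let nested_limit (u : nat -> R) (d : R) : 0 <= d ->
  (forall n k, u n <= u (n + k)%nat /\ u (n + k)%nat + d / 2 ^ (n + k) <= u n + d / 2 ^ n) ->
  exists x, forall n, u n <= x <= u n + d / 2 ^ n.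
Proof.
  intros Hd H.
  assert (B : forall n m, u m <= u n + d / 2 ^ n).
  { intros n m; pose proof (pos d n Hd); pose proof (pos d m Hd).
    destruct (Nat.le_gt_cases n m) as [L|L].
    - destruct (H n (m - n)%nat) as [_ K]; replace (n + (m - n))%nat with m in K by lia; lra.
    - destruct (H m (n - m)%nat) as [K _]; replace (m + (n - m))%nat with n in K by lia; lra. }
  destruct (completeness (fun x => exists n, x = u n)) as [x [X1 X2]].
  - exists (u O + d / 2 ^ 0); intros x (n & ->); apply B.
  - exists (u O), O; auto.
  - exists x; intros n; split.
    + apply X1; exists n; auto.
    + apply X2; intros y (m & ->); apply B.
Qed.

(** Otherwise the nested rectangles on which the bound fails shrink to a point of the closed
    rectangle, and [goursat_local] at that point contradicts the failure. *)
Lemma goursat_eps : Cmod (rect_int f x0 (x0 + w) y0 (y0 + h)) <= eps * (w + h) ^ 2.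
Proof.
  destruct (small_dec 0 (x0, y0)) as [S|N].
  { unfold small in S; simpl fst in S; simpl snd in S; simpl pow in S at 1 2 3.
    rewrite !Rdiv_1_r in S; auto. }
  exfalso.
  destruct (nested_limit (fun n => fst (bisect n)) w Hw) as (x & Hx).
  { intros n k; destruct (bisect_nested n k N) as (? & ? & ? & ?); auto. }
  destruct (nested_limit (fun n => snd (bisect n)) h Hh) as (y & Hy).
  { intros n k; destruct (bisect_nested n k N) as (? & ? & ? & ?); auto. }
  destruct (goursat_local f (x, y) eps He) as (d & Hd & K).
  { pose proof (Hx O); pose proof (Hy O); simpl in *; apply Hf; lra. }
  destruct (pow_lt_1_zero (/ 2)) with (y := d / (w + h + 1)) as (n & Hn).
  { rewrite Rabs_pos_eq; lra. }
  { apply Rdiv_lt_0_compat; lra. }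
  specialize (Hn n (Nat.le_refl n)).
  destruct (bisect_spec n N) as [I1 I2]; apply I2; unfold small.
  destruct I1 as (J1 & J2 & J3 & J4).
  rewrite Rabs_pos_eq in Hn by (apply pow_le; lra).
  rewrite pow_inv in Hn.
  assert (P : 0 < 2 ^ n) by (apply pow_lt; lra).
  assert (S : (w + h) / 2 ^ n < d).
  { apply Rle_lt_trans with ((w + h + 1) * / 2 ^ n).
    - apply Rmult_le_compat_r; [left; now apply Rinv_0_lt_compat|lra].
    - apply Rlt_le_trans with ((w + h + 1) * (d / (w + h + 1))).
      + apply Rmult_lt_compat_l; lra.
      + right; field; lra. }
  set (q := bisect n) in *.
  replace ((w + h) / 2 ^ n) with (fst q + w / 2 ^ n - fst q + (snd q + h / 2 ^ n - snd q)) in *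
    by (field; lra).
  apply K; simpl; auto.
  - apply Hx.
  - apply Hy.
  - intros u v ? ?; apply cdiff_ccont, Hf; lra.
Qed.

End Goursat.

Theorem goursat (f : C -> C) (x1 x2 y1 y2 : R) : x1 <= x2 -> y1 <= y2 ->
  (forall x y, x1 <= x <= x2 -> y1 <= y <= y2 -> cdiff f (x, y)) ->
  rect_int f x1 x2 y1 y2 = RtoC 0.
Proof.
  intros Hx Hy Hf; apply Cmod_eq_0.
  apply Rle_antisym; [|apply Cmod_ge_0]; apply le_epsilon; intros e He; rewrite Rplus_0_l.
  set (s := x2 - x1 + (y2 - y1)).
  assert (Hs : 0 <= s) by (unfold s; lra).
  assert (P : 0 < s ^ 2 + 1) by nra.
  pose proof (goursat_eps f x1 y1 (x2 - x1) (y2 - y1) (e / (s ^ 2 + 1))) as G.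
  replace (x1 + (x2 - x1)) with x2 in G by ring; replace (y1 + (y2 - y1)) with y2 in G by ring.
  eapply Rle_trans; [apply G; try lra; auto; now apply Rdiv_lt_0_compat|]; fold s.
  replace e with (e / (s ^ 2 + 1) * (s ^ 2 + 1)) at 2 by (field; lra).
  apply Rmult_le_compat_l; [left; now apply Rdiv_lt_0_compat|lra].
Qed.

(** * Coefficients of the Euler product *)

Lemma is_prime_ge_2 (p : nat) : is_prime p -> (2 <= p)%nat.
Proof. intros H; apply prime_ge_2 in H; lia. Qed.

Lemma divide_of_nat (a b : nat) : Z.divide (Z.of_nat a) (Z.of_nat b) <-> Nat.divide a b.
Proof.
  split; intros (k & Hk).
  - exists (Z.to_nat k); destruct a as [|a]; [lia|]; nia.
  - exists (Z.of_nat k); lia.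
Qed.

Lemma is_prime_mult (p a b : nat) : is_prime p ->
  Nat.divide p (a * b) -> Nat.divide p a \/ Nat.divide p b.
Proof.
  intros H D; rewrite <- !divide_of_nat in *; rewrite Nat2Z.inj_mul in D.
  now apply prime_mult.
Qed.

Lemma is_prime_divide_eq (p q : nat) : is_prime p -> is_prime q -> Nat.divide p q -> p = q.
Proof.
  intros Hp Hq D; rewrite <- divide_of_nat in D.
  apply prime_div_prime in D; auto; lia.
Qed.

Lemma mod_eqb_divide (n q : nat) : q <> O -> (n mod q =? 0)%nat = true <-> Nat.divide q n.
Proof. intros Hq; rewrite Nat.eqb_eq; apply Nat.Lcm0.mod_divide. Qed.

(* Coefficients of (1 - al q^(-s)) times the Dirichlet series of c. *)
Definition euler_mul (q : nat) (al : C) (c : nat -> C) (n : nat) : C :=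
  (c n - (if (n mod q =? 0)%nat then al * c (n / q)%nat else RtoC 0))%C.

Lemma euler_mul_divide (q : nat) (al : C) (c : nat -> C) (n : nat) : q <> O ->
  euler_mul q al c (q * n) = (c (q * n)%nat - al * c n)%C.
Proof.
  intros Hq; unfold euler_mul.
  replace (q * n)%nat with (n * q)%nat by lia.
  rewrite Nat.Div0.mod_mul, Nat.div_mul by auto; reflexivity.
Qed.

Lemma euler_mul_ndivide (q : nat) (al : C) (c : nat -> C) (n : nat) : q <> O ->
  ~ Nat.divide q n -> euler_mul q al c n = c n.
Proof.
  intros Hq H; unfold euler_mul.
  destruct (n mod q =? 0)%nat eqn:E; [|ring].
  apply mod_eqb_divide in E; easy.
Qed.

(** Partial sums of a Dirichlet series at the integer points s = j only: letting j grow along the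
    integers is enough to isolate coefficients. *)
Fixpoint csum (c : nat -> C) (j N : nat) : C :=
  match N with
  | O => RtoC 0
  | S N' => (csum c j N' + c N * RtoC ((/ INR N) ^ j))%C
  end.

Definition ds_lim (c : nat -> C) (j : nat) (l : C) : Prop :=
  forall eps, 0 < eps -> exists N0, forall N, (N0 <= N)%nat -> Cmod (csum c j N - l) < eps.

Lemma csum_euler_mul (q : nat) (al : C) (c : nat -> C) (j N : nat) : (2 <= q)%nat ->
  csum (euler_mul q al c) j N
  = (csum c j N - al * RtoC ((/ INR q) ^ j) * csum c j (N / q))%C.
Proof.
  intros Hq; induction N as [|N IH].
  - rewrite Nat.Div0.div_0_l; simpl; ring.
  - cbn [csum]; rewrite IH; unfold euler_mul at 1.
    pose proof (Nat.div_mod_eq N q) as E1; pose proof (Nat.mod_upper_bound N q ltac:(lia)) as E2.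
    pose proof (Nat.div_mod_eq (S N) q) as F1; pose proof (Nat.mod_upper_bound (S N) q ltac:(lia)) as F2.
    destruct (S N mod q =? 0)%nat eqn:E.
    + apply Nat.eqb_eq in E.
      assert (K : (S N / q = S (N / q))%nat) by nia.
      rewrite K; cbn [csum].
      replace (INR (S N)) with (INR q * INR (S (N / q))).
      2: { rewrite <- mult_INR; f_equal; nia. }
      rewrite Rinv_mult, Rpow_mult_distr, RtoC_mult; ring.
    + apply Nat.eqb_neq in E.
      assert (K : (S N / q = N / q)%nat) by nia.
      rewrite K; ring.
Qed.

Lemma ds_lim_euler_mul (q : nat) (al : C) (c : nat -> C) (j : nat) (l : C) : (2 <= q)%nat ->
  ds_lim c j l -> ds_lim (euler_mul q al c) j ((RtoC 1 - al * RtoC ((/ INR q) ^ j)) * l)%C.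
Proof.
  intros Hq H e He; set (b := (al * RtoC ((/ INR q) ^ j))%C).
  pose proof (Cmod_ge_0 b) as Pb.
  destruct (H (e / (2 * (1 + Cmod b)))) as (N0 & HN).
  { apply Rdiv_lt_0_compat; lra. }
  exists (q * N0)%nat; intros N HN'.
  rewrite csum_euler_mul by auto; fold b.
  replace (csum c j N - b * csum c j (N / q) - (RtoC 1 - b) * l)%C
    with ((csum c j N - l) - b * (csum c j (N / q) - l))%C by ring.
  eapply Rle_lt_trans; [apply Cmod_triangle_minus|]; rewrite Cmod_mult.
  assert (K1 := HN N ltac:(nia)).
  assert (K2 := HN (N / q)%nat ltac:(apply Nat.div_le_lower_bound; lia)).
  apply Rle_lt_trans with (e / (2 * (1 + Cmod b)) * (1 + Cmod b)); [nra|].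
  replace (e / (2 * (1 + Cmod b)) * (1 + Cmod b)) with (e / 2) by (field; lra); lra.
Qed.

Definition poly_bounded (c : nat -> C) : Prop :=
  exists K (d : nat), 0 <= K /\ forall n, (1 <= n)%nat -> Cmod (c n) <= K * INR n ^ d.

Lemma poly_bounded_euler_mul (q : nat) (al : C) (c : nat -> C) : (2 <= q)%nat ->
  poly_bounded c -> poly_bounded (euler_mul q al c).
Proof.
  intros Hq (K & d & HK & H); pose proof (Cmod_ge_0 al) as Pa.
  exists (K + Cmod al * K), d; split; [nra|]; intros n Hn.
  assert (Pn : 0 <= INR n ^ d) by apply pow_le, pos_INR.
  unfold euler_mul; eapply Rle_trans; [apply Cmod_triangle_minus|].
  rewrite Rmult_plus_distr_r; apply Rplus_le_compat; auto.
  destruct (n mod q =? 0)%nat eqn:E.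
  - apply mod_eqb_divide in E; [|lia]; destruct E as (k & ->).
    rewrite Nat.div_mul by lia; rewrite Cmod_mult, Rmult_assoc.
    apply Rmult_le_compat_l; auto.
    eapply Rle_trans; [apply H; nia|]; apply Rmult_le_compat_l; auto.
    apply pow_incr; split; [apply pos_INR|apply le_INR; nia].
  - rewrite Cmod_0; apply Rmult_le_pos; auto; nra.
Qed.

(** The term of index k > n is at most [K * k^(d-j)]. Two of the powers are compared with the
    telescoping 1/(k-1) - 1/k, and the other j - d - 2 are frozen at their value for k = n + 1. *)
Lemma csum_tail_le (c : nat -> C) (K : R) (d j n M : nat) : 0 <= K ->
  (forall n, (1 <= n)%nat -> Cmod (c n) <= K * INR n ^ d) -> (1 <= n)%nat -> (d + 2 <= j)%nat ->
  Cmod (csum c j (n + M) - csum c j n)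
  <= K * (/ INR (S n)) ^ (j - d - 2) * (/ INR n - / INR (n + M)).
Proof.
  intros HK H Hn Hj.
  assert (P1 : 0 < INR (S n)) by (apply lt_0_INR; lia).
  assert (P2 : 0 <= (/ INR (S n)) ^ (j - d - 2)).
  { apply pow_le; left; now apply Rinv_0_lt_compat. }
  induction M as [|M IH].
  - rewrite Nat.add_0_r, Rminus_diag, Rmult_0_r.
    replace (csum c j n - csum c j n)%C with (RtoC 0) by ring; rewrite Cmod_0; lra.
  - rewrite Nat.add_succ_r; cbn [csum]; set (k := (n + M)%nat) in *.
    assert (Pk : 0 < INR k) by (apply lt_0_INR; lia).
    assert (PS : INR (S k) = INR k + 1) by apply S_INR.
    replace (csum c j k + c (S k) * RtoC ((/ INR (S k)) ^ j) - csum c j n)%C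
      with (csum c j k - csum c j n + c (S k) * RtoC ((/ INR (S k)) ^ j))%C by ring.
    eapply Rle_trans; [apply Cmod_triangle|].
    assert (T : Cmod (c (S k) * RtoC ((/ INR (S k)) ^ j))
       <= K * (/ INR (S n)) ^ (j - d - 2) * (/ INR k - / INR (S k))).
    { assert (Q : 0 < / INR (S k)) by (apply Rinv_0_lt_compat; lra).
      rewrite Cmod_mult, Cmod_R, Rabs_pos_eq by (apply pow_le; lra).
      apply Rle_trans with (K * INR (S k) ^ d * (/ INR (S k)) ^ j).
      { apply Rmult_le_compat_r; [apply pow_le; lra|apply H; lia]. }
      rewrite !Rmult_assoc; apply Rmult_le_compat_l; auto.
      replace j with (d + (2 + (j - d - 2)))%nat at 1 by lia.
      rewrite !pow_add, <- Rmult_assoc, <- Rpow_mult_distr, Rinv_r, pow1, Rmult_1_l by lra.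
      rewrite Rmult_comm; apply Rmult_le_compat.
      - apply pow_le; lra.
      - apply pow_le; lra.
      - apply pow_incr; split; [lra|]; apply Rinv_le_contravar; auto; apply le_INR; lia.
      - replace (/ INR k - / INR (S k)) with (/ INR k * / INR (S k)).
        + replace ((/ INR (S k)) ^ 2) with (/ INR (S k) * / INR (S k)) by ring.
          apply Rmult_le_compat_r; [lra|].
          apply Rinv_le_contravar; lra.
        + rewrite PS; field; lra. }
    lra.
Qed.

Lemma csum_0 (c : nat -> C) (j n : nat) :
  (forall k, (1 <= k <= n)%nat -> c k = RtoC 0) -> csum c j n = RtoC 0.
Proof.
  induction n as [|n IH]; intros H; auto; cbn [csum].
  rewrite IH, (H (S n)); [ring|lia|]; intros; apply H; lia.
Qed.

Lemma pow_small (x e : R) : 0 <= x < 1 -> 0 < e ->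
  exists N, forall n, (N <= n)%nat -> x ^ n < e.
Proof.
  intros Hx He; destruct (pow_lt_1_zero x) with (y := e) as (N & HN); auto.
  - rewrite Rabs_pos_eq; lra.
  - exists N; intros n Hn; specialize (HN n Hn).
    rewrite Rabs_pos_eq in HN; auto; apply pow_le; lra.
Qed.

(** Strong induction. If [c] vanishes below [n], then [c n * n^(-j)] is the limit minus a tail of
    order [(n+1)^(-j)]. The limit is of that order too, since [n + 1 <= N]. Dividing by [n^(-j)] and
    letting j grow forces [c n = 0]. *)
Lemma ds_coef_unique (c : nat -> C) (l : nat -> C) (B : R) (N j0 : nat) :
  poly_bounded c ->
  (forall j, (j0 <= j)%nat -> ds_lim c j (l j)) ->
  (forall j, (j0 <= j)%nat -> Cmod (l j) <= B * (/ INR N) ^ j) ->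
  forall n, (1 <= n < N)%nat -> c n = RtoC 0.
Proof.
  intros (K & d & HK & Hc) Hl HB.
  intros n; induction n as [n IH] using lt_wf_ind; intros Hn.
  assert (HB0 : 0 <= B).
  { specialize (HB j0 (Nat.le_refl _)); pose proof (Cmod_ge_0 (l j0)).
    assert (0 < (/ INR N) ^ j0) by (apply pow_lt, Rinv_0_lt_compat, lt_0_INR; lia); nra. }
  apply Cmod_eq_0, Rle_antisym; [|apply Cmod_ge_0].
  apply Rnot_lt_le; intros Pos.
  set (q := INR n / INR (S n)).
  assert (Pn : 0 < INR n) by (apply lt_0_INR; lia).
  assert (PS : INR (S n) = INR n + 1) by apply S_INR.
  assert (Hq : 0 <= q < 1).
  { unfold q; rewrite PS; split; [apply Rmult_le_pos; [lra|left; apply Rinv_0_lt_compat; lra]|].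
    apply Rmult_lt_reg_r with (INR n + 1); [lra|]; field_simplify; lra. }
  set (D := K * INR (S n) ^ (d + 2) + B + 1).
  assert (PD : 0 < D).
  { unfold D; assert (0 <= INR (S n) ^ (d + 2)) by apply pow_le, pos_INR; nra. }
  destruct (pow_small q (Cmod (c n) / D) Hq) as (J & HJ).
  { now apply Rdiv_lt_0_compat. }
  set (j := (J + j0 + d + 2)%nat).
  assert (HJ' := HJ j ltac:(lia)).
  assert (Pnj : 0 < (/ INR n) ^ j) by (apply pow_lt, Rinv_0_lt_compat; auto).
  assert (PSj : 0 < (/ INR (S n)) ^ j) by (apply pow_lt, Rinv_0_lt_compat; lra).
  destruct (Hl j ltac:(lia) ((/ INR (S n)) ^ j)) as (N0 & HN0); auto.
  specialize (HN0 (n + N0)%nat ltac:(lia)).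
  assert (Tl := csum_tail_le c K d j n N0 HK Hc ltac:(lia) ltac:(lia)).
  assert (Cn : csum c j n = (c n * RtoC ((/ INR n) ^ j))%C).
  { destruct n as [|n']; [lia|]; cbn [csum].
    rewrite csum_0; [ring|]; intros; apply IH; lia. }
  assert (Up : Cmod (c n) * (/ INR n) ^ j <= D * (/ INR (S n)) ^ j).
  { replace (Cmod (c n) * (/ INR n) ^ j) with (Cmod (csum c j n)).
    2: { rewrite Cn, Cmod_mult, Cmod_R, Rabs_pos_eq; lra. }
    replace (csum c j n) with (l j + ((csum c j (n + N0) - l j) - (csum c j (n + N0) - csum c j n)))%C by ring.
    eapply Rle_trans; [apply Cmod_triangle|].
    eapply Rle_trans; [apply Rplus_le_compat_l, Cmod_triangle_minus|].
    assert (B1 : Cmod (l j) <= B * (/ INR (S n)) ^ j).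
    { eapply Rle_trans; [apply HB; lia|]; apply Rmult_le_compat_l; auto.
      apply pow_incr; split; [left; apply Rinv_0_lt_compat, lt_0_INR; lia|].
      apply Rinv_le_contravar; [lra|apply le_INR; lia]. }
    assert (B2 : K * (/ INR (S n)) ^ (j - d - 2) * (/ INR n - / INR (n + N0))
              <= K * INR (S n) ^ (d + 2) * (/ INR (S n)) ^ j).
    { replace j with ((d + 2) + (j - d - 2))%nat at 2 by lia.
      rewrite (pow_add (/ INR (S n))); replace (K * INR (S n) ^ (d + 2) * ((/ INR (S n)) ^ (d + 2) * (/ INR (S n)) ^ (j - d - 2)))
        with (K * ((INR (S n) * / INR (S n)) ^ (d + 2)) * (/ INR (S n)) ^ (j - d - 2))
        by (rewrite Rpow_mult_distr; ring).
      rewrite Rinv_r, pow1, Rmult_1_r by lra.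
      rewrite <- (Rmult_1_r (K * (/ INR (S n)) ^ (j - d - 2))) at 2.
      apply Rmult_le_compat_l.
      - apply Rmult_le_pos; auto; apply pow_le; left; apply Rinv_0_lt_compat; lra.
      - assert (0 < / INR (n + N0)) by (apply Rinv_0_lt_compat, lt_0_INR; lia).
        assert (/ INR n <= 1); [|lra].
        rewrite <- Rinv_1; apply Rinv_le_contravar; [lra|]; apply (le_INR 1); lia. }
    unfold D; lra. }
  assert (Eq : (/ INR (S n)) ^ j = q ^ j * (/ INR n) ^ j).
  { rewrite <- Rpow_mult_distr; f_equal; unfold q; rewrite PS; field; lra. }
  rewrite Eq, <- Rmult_assoc in Up; apply Rmult_le_reg_r in Up; auto.
  apply (Rmult_lt_compat_l D) in HJ'; auto.
  replace (D * (Cmod (c n) / D)) with (Cmod (c n)) in HJ' by (field; lra).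
  lra.
Qed.

(** * Dirichlet series and Euler products at integer points *)

Lemma INR_ge_1 (n : nat) : (1 <= n)%nat -> 1 <= INR n.
Proof. intros H; apply (le_INR 1); auto. Qed.

Lemma Rcpow_nat_neg (n j : nat) : (1 <= n)%nat ->
  Rcpow (INR n) (- RtoC (INR j)) = RtoC ((/ INR n) ^ j).
Proof.
  intros Hn; pose proof (INR_ge_1 n Hn) as H1; unfold Rcpow.
  replace (- RtoC (INR j) * RtoC (ln (INR n)))%C with (RtoC (INR j * ln (/ INR n))).
  2: { rewrite ln_Rinv by lra; apply injective_projections; simpl; ring. }
  rewrite Cexp_R; f_equal.
  rewrite <- Rpower_pow by (apply Rinv_0_lt_compat; lra); reflexivity.
Qed.

Lemma filterlim_Cmod (u : nat -> C) (l : C) :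
  filterlim u eventually (locally (T := C_NormedModule) l) ->
  forall eps, 0 < eps -> exists N, forall n, (N <= n)%nat -> Cmod (u n - l) < eps.
Proof.
  intros H e He.
  apply filterlim_locally_ball_norm with (eps := mkposreal e He) in H.
  destruct H as (N & HN); exists N; intros n Hn; exact (HN n Hn).
Qed.

Lemma dirichlet_ds_lim (a : nat -> C) (L : C -> C) (j : nat) : dirichlet_series a L ->
  (2 <= j)%nat -> ds_lim a j (L (RtoC (INR j))).
Proof.
  intros H Hj.
  assert (Hr : 1 < Re (RtoC (INR j))).
  { simpl; apply (lt_INR 1); lia. }
  specialize (H _ Hr); intros e He.
  destruct (filterlim_Cmod _ _ H e He) as (N & HN); exists (S N); intros n Hn.
  destruct n as [|n]; [lia|].
  replace (csum a j (S n)) with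
    (sum_n (G := C_NormedModule) (fun n => (a (S n) * Rcpow (INR (S n)) (- RtoC (INR j)))%C) n).
  { apply HN; lia. }
  clear Hn; induction n as [|n IH].
  - rewrite sum_O; cbn [csum]; rewrite Rcpow_nat_neg by lia; symmetry; apply Cplus_0_l.
  - rewrite sum_Sn, IH; rewrite Rcpow_nat_neg by lia; reflexivity.
Qed.

Lemma Cexp_surj (z : C) : z <> RtoC 0 -> exists th, z = Cexp (ln (Cmod z), th).
Proof.
  intros Hz; assert (P : 0 < Cmod z) by now apply Cmod_gt_0.
  destruct z as [x y]; set (r := Cmod (x, y)) in *.
  assert (E : x * x + y * y = r * r).
  { pose proof (Cmod2_alt (x, y)) as E; fold r in E; simpl in E; lra. }
  set (c := x / r); set (s := y / r).
  assert (CS : c * c + s * s = 1).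
  { unfold c, s; replace (x / r * (x / r) + y / r * (y / r)) with ((x * x + y * y) / (r * r))
      by (field; lra); rewrite E; field; lra. }
  assert (Hc : -1 <= c <= 1) by nra.
  assert (K : exists th, cos th = c /\ sin th = s).
  { destruct (Rle_dec 0 s).
    - exists (acos c); rewrite cos_acos, sin_acos by auto; split; auto.
      replace (1 - c²) with (s * s) by (unfold Rsqr; lra).
      apply sqrt_square; auto.
    - exists (- acos c); rewrite cos_neg, sin_neg, cos_acos, sin_acos by auto; split; auto.
      replace (1 - c²) with ((- s) * (- s)) by (unfold Rsqr; lra).
      rewrite sqrt_square; lra. }
  destruct K as (th & K1 & K2); exists th.
  unfold Cexp; simpl; rewrite K1, K2, exp_ln by auto.
  unfold c, s; apply injective_projections; simpl; field; lra.
Qed.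

(** If [|alpha| > p], the equation [alpha * p^(-s) = 1] has a solution with Re s > 1, where the
    Euler factor would be singular. This crude bound only serves to bring the factors close to 1 at
    large integers; [selberg_alpha_le_1] improves it. *)
Lemma euler_alpha_le (m : nat) (alpha : nat -> nat -> C) (L : C -> C) (p j : nat) :
  polynomial_euler_product m alpha L -> is_prime p -> (j < m)%nat ->
  Cmod (alpha j p) <= INR p.
Proof.
  intros H Hp Hj; apply Rnot_lt_le; intros K; set (al := alpha j p) in *.
  assert (Pp : 1 < INR p) by (apply (lt_INR 1); apply is_prime_ge_2 in Hp; lia).
  assert (Lp : 0 < ln (INR p)) by (rewrite <- ln_1; apply ln_increasing; lra).
  assert (Hal : al <> RtoC 0) by (apply Cmod_gt_0; lra).
  destruct (Cexp_surj al Hal) as (th & E).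
  destruct (H (ln (Cmod al) / ln (INR p), th / ln (INR p))) as [N _].
  { simpl; apply Rmult_lt_reg_r with (ln (INR p)); auto.
    unfold Rdiv; rewrite Rmult_assoc, Rinv_l by lra.
    rewrite Rmult_1_l, Rmult_1_r; apply ln_increasing; lra. }
  apply (N p j Hp Hj); fold al; unfold Rcpow.
  rewrite E at 1; rewrite <- Cexp_plus.
  match goal with |- (_ - Cexp ?z)%C = _ => replace z with (RtoC 0) end.
  - rewrite Cexp_0; ring.
  - apply injective_projections; simpl; field; lra.
Qed.

(** Bounds of the shape [exp e - 1] are stable under products, because [x y - 1 = (x - 1)(y - 1) +
    (x - 1) + (y - 1)]. The sum is shifted by one because [sum_f_R0] includes its last index while
    [Cprod] stops before it. *)
Lemma Cprod_near_1 (g : nat -> C) (e : nat -> R) (M : nat) :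
  (forall p, (p < M)%nat -> Cmod (g p - RtoC 1) <= exp (e p) - 1) ->
  Cmod (Cprod g M - RtoC 1) <= exp (sum_f_R0 (fun p => match p with O => 0 | S p' => e p' end) M) - 1.
Proof.
  induction M as [|M IH]; intros H.
  - simpl; replace (RtoC 1 - RtoC 1)%C with (RtoC 0) by ring; rewrite Cmod_0, exp_0; lra.
  - cbn [Cprod sum_f_R0]; rewrite exp_plus.
    set (x := Cprod g M) in *; set (y := g M); set (E := exp (sum_f_R0 _ M)) in *.
    assert (I1 : Cmod (x - RtoC 1) <= E - 1) by (apply IH; auto).
    assert (I2 : Cmod (y - RtoC 1) <= exp (e M) - 1) by (apply H; auto).
    replace (x * y - RtoC 1)%C
      with ((x - RtoC 1) * (y - RtoC 1) + ((x - RtoC 1) + (y - RtoC 1)))%C by ring.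
    eapply Rle_trans; [apply Cmod_triangle|].
    eapply Rle_trans; [apply Rplus_le_compat_l, Cmod_triangle|]; rewrite Cmod_mult.
    pose proof (Cmod_ge_0 (x - RtoC 1)); pose proof (Cmod_ge_0 (y - RtoC 1)); nra.
Qed.

Lemma Cprod_mult (f g : nat -> C) (M : nat) :
  Cprod (fun p => f p * g p)%C M = (Cprod f M * Cprod g M)%C.
Proof. induction M as [|M IH]; cbn [Cprod]; [ring|rewrite IH; ring]. Qed.

Lemma Cprod_ext (f g : nat -> C) (M : nat) :
  (forall p, (p < M)%nat -> f p = g p) -> Cprod f M = Cprod g M.
Proof.
  induction M as [|M IH]; intros H; auto; cbn [Cprod].
  rewrite IH, H; auto.
Qed.

Lemma Cprod_split (f : nat -> C) (N M : nat) : (N <= M)%nat ->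
  Cprod f M = (Cprod f N * Cprod (fun p => if (p <? N)%nat then RtoC 1 else f p) M)%C.
Proof.
  intros H; induction M as [|M IH].
  - replace N with O by lia; simpl; ring.
  - destruct (Nat.eq_dec N (S M)) as [->|n].
    + rewrite (Cprod_ext (fun p => if (p <? S M)%nat then RtoC 1 else f p) (fun _ => RtoC 1)).
      * assert (E : forall k, Cprod (fun _ => RtoC 1) k = RtoC 1).
        { induction k as [|k IHk]; cbn [Cprod]; auto; rewrite IHk; ring. }
        rewrite E; ring.
      * intros p Hp; apply Nat.ltb_lt in Hp; now rewrite Hp.
    + cbn [Cprod]; rewrite IH by lia.
      replace (M <? N)%nat with false by (symmetry; apply Nat.ltb_ge; lia); ring.
Qed.

Lemma sum_inv_sq_tail (N M : nat) : (2 <= N)%nat ->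
  sum_f_R0 (fun p => match p with O => 0 | S p' =>
     if (p' <? N)%nat then 0 else (/ INR p') ^ 2 end) M <= 1.
Proof.
  intros HN.
  assert (K : forall M, sum_f_R0 (fun p => match p with O => 0 | S p' =>
     if (p' <? N)%nat then 0 else (/ INR p') ^ 2 end) M
     <= if (M <=? N)%nat then 0 else 1 - / (INR M - 1)).
  { induction M0 as [|k IH].
    - cbn [sum_f_R0]; destruct (0 <=? N)%nat eqn:E; [lra|apply Nat.leb_gt in E; lia].
    - cbn [sum_f_R0]; rewrite S_INR; replace (INR k + 1 - 1) with (INR k) by ring.
      revert IH; destruct (Nat.leb_spec (S k) N); destruct (Nat.ltb_spec k N);
        destruct (Nat.leb_spec k N); intros IH; try (exfalso; lia); try lra.
      + assert (Pk : 2 <= INR k) by (apply (le_INR 2); lia).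
        assert (Q : 0 < / INR k <= / 2).
        { split; [apply Rinv_0_lt_compat; lra|apply Rinv_le_contravar; lra]. }
        nra.
      + assert (Pk : 2 <= INR k) by (apply (le_INR 2); lia).
        assert ((/ INR k) ^ 2 <= / INR k * / (INR k - 1)).
        { simpl; rewrite Rmult_1_r; apply Rmult_le_compat_l.
          - left; apply Rinv_0_lt_compat; lra.
          - apply Rinv_le_contravar; lra. }
        assert (/ INR k * / (INR k - 1) = / (INR k - 1) - / INR k) by (field; lra).
        lra. }
  eapply Rle_trans; [apply K|]; destruct (M <=? N)%nat eqn:E; [lra|].
  apply Nat.leb_gt in E.
  assert (0 < / (INR M - 1)); [|lra].
  apply Rinv_0_lt_compat; assert (2 <= INR M) by (apply (le_INR 2); lia); lra.
Qed.

Lemma sum_f_R0_pred_le (e e' : nat -> R) (M : nat) (c : R) : 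
  (forall p, (p < M)%nat -> e p <= c * e' p) ->
  sum_f_R0 (fun p => match p with O => 0 | S p' => e p' end) M
  <= c * sum_f_R0 (fun p => match p with O => 0 | S p' => e' p' end) M.
Proof.
  intros H; induction M as [|M IH]; cbn [sum_f_R0]; [lra|].
  rewrite Rmult_plus_distr_l; apply Rplus_le_compat; auto.
Qed.

Definition local_inv (m : nat) (alpha : nat -> nat -> C) (p j : nat) : C :=
  Cprod (fun i => RtoC 1 - alpha i p * RtoC ((/ INR p) ^ j))%C m.

(** Each [alpha i p * p^(-j)] has modulus at most [p^(1-j) <= 1/2], so the inverse of its factor
    differs from 1 by at most twice that. *)
Lemma local_factor_near_1 (m : nat) (alpha : nat -> nat -> C) (p j : nat) :
  (2 <= p)%nat -> (2 <= j)%nat -> (forall i, (i < m)%nat -> Cmod (alpha i p) <= INR p) ->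
  Cmod (local_factor m alpha p (RtoC (INR j)) - RtoC 1)
    <= exp (2 * INR m * (INR p * (/ INR p) ^ j)) - 1
  /\ (local_inv m alpha p j * local_factor m alpha p (RtoC (INR j)) = RtoC 1)%C.
Proof.
  intros Hp Hj Ha; set (d := INR p * (/ INR p) ^ j).
  assert (Pp : 2 <= INR p) by (apply (le_INR 2); auto).
  assert (Q : 0 < / INR p <= / 2).
  { split; [apply Rinv_0_lt_compat; lra|apply Rinv_le_contravar; lra]. }
  assert (Hd : 0 < d <= / 2).
  { unfold d; replace j with (S (S (j - 2))) by lia.
    replace (INR p * (/ INR p) ^ S (S (j - 2))) with (/ INR p * (/ INR p) ^ (j - 2))
      by (simpl; field; lra).
    assert (0 < (/ INR p) ^ (j - 2) <= 1).
    { split; [apply pow_lt; lra|].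
      rewrite <- (pow1 (j - 2)); apply pow_incr; lra. }
    nra. }
  assert (Z : forall i, (i < m)%nat -> Cmod (alpha i p * RtoC ((/ INR p) ^ j)) <= d).
  { intros i Hi; rewrite Cmod_mult, Cmod_R, Rabs_pos_eq by (apply pow_le; lra).
    unfold d; apply Rmult_le_compat_r; auto; apply pow_le; lra. }
  assert (NZ : forall i, (i < m)%nat -> / 2 <= Cmod (RtoC 1 - alpha i p * RtoC ((/ INR p) ^ j))).
  { intros i Hi; pose proof (Cmod_triangle_inv (RtoC 1) (alpha i p * RtoC ((/ INR p) ^ j))).
    rewrite Cmod_1 in H; specialize (Z i Hi); lra. }
  assert (NZ' : forall i, (i < m)%nat -> (RtoC 1 - alpha i p * RtoC ((/ INR p) ^ j))%C <> RtoC 0).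
  { intros i Hi; apply Cmod_gt_0; specialize (NZ i Hi); lra. }
  unfold local_factor; rewrite Rcpow_nat_neg by lia; split.
  - eapply Rle_trans.
    { apply (Cprod_near_1 _ (fun _ => 2 * d)); intros i Hi.
      specialize (Z i Hi); specialize (NZ i Hi); specialize (NZ' i Hi).
      set (z := (alpha i p * RtoC ((/ INR p) ^ j))%C) in *.
      replace (/ (RtoC 1 - z) - RtoC 1)%C with (z / (RtoC 1 - z))%C by (field; auto).
      rewrite Cmod_div by auto.
      apply Rle_trans with (2 * d); [|pose proof (exp_ineq1_le (2 * d)); lra].
      apply Rle_trans with (d * / / 2); [|rewrite Rinv_inv; lra].
      apply Rmult_le_compat; try apply Cmod_ge_0; auto.
      - left; apply Rinv_0_lt_compat; lra.
      - apply Rinv_le_contravar; lra. }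
    apply Rplus_le_compat_r; right; f_equal.
    clear; induction m as [|m IH]; [simpl; ring|].
    cbn [sum_f_R0]; rewrite IH, S_INR; ring.
  - unfold local_inv; rewrite <- Cprod_mult.
    rewrite (Cprod_ext _ (fun _ => RtoC 1)).
    + clear; induction m as [|m IH]; cbn [Cprod]; auto; rewrite IH; ring.
    + intros i Hi; apply Cinv_r; auto.
Qed.

Fixpoint euler_iter (al : nat -> C) (q m : nat) (c : nat -> C) : nat -> C :=
  match m with
  | O => c
  | S m' => euler_mul q (al m') (euler_iter al q m' c)
  end.

(** Clears the Euler factors of all primes below [N]. Applied to the coefficients of L, it leaves
    the product over the primes from [N] on, whose coefficients below [N] are those of the constant
    1. *)
Fixpoint euler_all (m : nat) (alpha : nat -> nat -> C) (N : nat) (c : nat -> C) : nat -> C :=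
  match N with
  | O => c
  | S N' => if is_prime_dec N'
            then euler_iter (fun i => alpha i N') N' m (euler_all m alpha N' c)
            else euler_all m alpha N' c
  end.

Lemma ds_lim_ext (c : nat -> C) (j : nat) (l l' : C) : l = l' -> ds_lim c j l -> ds_lim c j l'.
Proof. intros ->; auto. Qed.

Lemma ds_lim_euler_all (m : nat) (alpha : nat -> nat -> C) (N : nat) (c : nat -> C) (j : nat) (l : C) :
  ds_lim c j l ->
  ds_lim (euler_all m alpha N c) j
    (Cprod (fun p => if is_prime_dec p then local_inv m alpha p j else RtoC 1) N * l)%C.
Proof.
  intros H; induction N as [|N IH]; cbn [euler_all Cprod].
  - apply (ds_lim_ext _ _ l); [ring|auto].
  - destruct (is_prime_dec N) as [Hp|_].
    + apply is_prime_ge_2 in Hp; set (P := Cprod _ N) in *.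
      assert (K : forall k, ds_lim (euler_iter (fun i => alpha i N) N k (euler_all m alpha N c)) j
         (local_inv k alpha N j * (P * l))%C).
      { induction k as [|k IHk]; cbn [euler_iter].
        - apply (ds_lim_ext _ _ (P * l)%C); [unfold local_inv; simpl; ring|auto].
        - eapply ds_lim_ext; [|apply ds_lim_euler_mul; [auto|apply IHk]].
          unfold local_inv; cbn [Cprod]; ring. }
      eapply ds_lim_ext; [|apply K]; ring.
    + apply (ds_lim_ext _ _ (Cprod (fun p => if is_prime_dec p then local_inv m alpha p j else RtoC 1) N * l)%C);
        [ring|auto].
Qed.

Lemma poly_bounded_euler_all (m : nat) (alpha : nat -> nat -> C) (N : nat) (c : nat -> C) :
  poly_bounded c -> poly_bounded (euler_all m alpha N c).
Proof.
  intros H; induction N as [|N IH]; cbn [euler_all]; auto.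
  destruct (is_prime_dec N) as [Hp|_]; auto; apply is_prime_ge_2 in Hp.
  generalize m at 1; intros k; induction k as [|k IHk]; cbn [euler_iter]; auto.
  now apply poly_bounded_euler_mul.
Qed.

(** The left side compares with 1 the product over the primes p >= N, whose factors are 1 +
    O(p^(1-j)). Two powers of p are spent on the convergence of the sum of 1/p^2, and the remaining
    j - 3 give the decay in N. *)
Lemma euler_tail_bound (m : nat) (alpha : nat -> nat -> C) (L : C -> C) (N j : nat) :
  polynomial_euler_product m alpha L -> (2 <= N)%nat -> (3 <= j)%nat ->
  2 * INR m * (/ INR N) ^ (j - 3) <= 1/2 ->
  Cmod (Cprod (fun p => if is_prime_dec p then local_inv m alpha p j else RtoC 1) N
        * L (RtoC (INR j)) - RtoC 1) <= 4 * INR m * (/ INR N) ^ (j - 3).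
Proof.
  intros HE HN Hj Hc; set (Q := Cprod _ N); set (s := RtoC (INR j)).
  set (c := 2 * INR m * (/ INR N) ^ (j - 3)) in *.
  assert (Hs : 1 < Re s) by (simpl; apply (lt_INR 1); lia).
  destruct (HE s Hs) as [_ Lim].
  set (f := fun p => if is_prime_dec p then local_factor m alpha p s else RtoC 1) in *.
  assert (PN : 2 <= INR N) by (apply (le_INR 2); auto).
  assert (QN : 0 < / INR N) by (apply Rinv_0_lt_compat; lra).
  assert (Pc : 0 <= c).
  { unfold c; apply Rmult_le_pos; [|apply pow_le; lra]; pose proof (pos_INR m); lra. }
  assert (G : forall M, Cmod (Cprod (fun p => if (p <? N)%nat then RtoC 1 else f p) M - RtoC 1) <= 2 * c).
  { intros M.
    eapply Rle_trans.
    { apply (Cprod_near_1 _ (fun p => if (p <? N)%nat then 0 else 2 * INR m * (INR p * (/ INR p) ^ j))).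
      intros p _; destruct (Nat.ltb_spec p N) as [l|l].
      - replace (RtoC 1 - RtoC 1)%C with (RtoC 0) by ring; rewrite Cmod_0, exp_0; lra.
      - unfold f; destruct (is_prime_dec p) as [Hp|_].
        + apply local_factor_near_1; try lia.
          intros i Hi; now apply (euler_alpha_le m alpha L).
        + replace (RtoC 1 - RtoC 1)%C with (RtoC 0) by ring; rewrite Cmod_0.
          match goal with |- 0 <= exp ?x - 1 => pose proof (exp_ineq1_le x) as K end.
          assert (0 <= 2 * INR m * (INR p * (/ INR p) ^ j)); [|lra].
          apply Rmult_le_pos; [pose proof (pos_INR m); lra|].
          apply Rmult_le_pos; [apply pos_INR|apply pow_le; left; apply Rinv_0_lt_compat, lt_0_INR; lia]. }
    assert (S : sum_f_R0 (fun p => match p with O => 0 | S p' =>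
        if (p' <? N)%nat then 0 else 2 * INR m * (INR p' * (/ INR p') ^ j) end) M <= c).
    { eapply Rle_trans.
      - apply (sum_f_R0_pred_le (fun p' => if (p' <? N)%nat then 0 else 2 * INR m * (INR p' * (/ INR p') ^ j))
           (fun p' => if (p' <? N)%nat then 0 else (/ INR p') ^ 2) M c).
        intros p _; destruct (Nat.ltb_spec p N) as [l|l]; [lra|].
        assert (Pp : INR N <= INR p) by now apply le_INR.
        assert (Qp : 0 < / INR p) by (apply Rinv_0_lt_compat; lra).
        replace (INR p * (/ INR p) ^ j) with ((/ INR p) ^ 2 * (/ INR p) ^ (j - 3)).
        + unfold c.
          replace (2 * INR m * (/ INR N) ^ (j - 3) * (/ INR p) ^ 2)
            with (2 * INR m * ((/ INR p) ^ 2 * (/ INR N) ^ (j - 3))) by ring.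
          apply Rmult_le_compat_l; [pose proof (pos_INR m); lra|].
          apply Rmult_le_compat_l; [apply pow_le; lra|].
          apply pow_incr; split; [lra|apply Rinv_le_contravar; lra].
        + replace j with (3 + (j - 3))%nat at 2 by lia; rewrite pow_add; field; lra.
      - rewrite <- (Rmult_1_r c) at 2; apply Rmult_le_compat_l; auto.
        apply sum_inv_sq_tail; auto. }
    apply Rle_trans with (exp c - 1).
    - apply Rplus_le_compat_r; destruct S as [S|S]; [left; now apply exp_increasing|rewrite S; lra].
    - destruct (exp_taylor1 c) as [E _]; [rewrite Rabs_pos_eq; lra|]; nra. }
  assert (QF : forall M, (N <= M)%nat ->
     (Q * Cprod f M = Cprod (fun p => if (p <? N)%nat then RtoC 1 else f p) M)%C).
  { intros M HM; rewrite (Cprod_split f N M HM), Cmult_assoc.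
    unfold Q; rewrite <- Cprod_mult, (Cprod_ext _ (fun _ => RtoC 1)).
    - replace (Cprod (fun _ => RtoC 1) N) with (RtoC 1); [ring|].
      clear; induction N as [|N IH]; cbn [Cprod]; auto; rewrite <- IH; ring.
    - intros p _; unfold f; destruct (is_prime_dec p) as [Hp|_]; [|ring].
      apply local_factor_near_1; try lia.
      + now apply is_prime_ge_2.
      + intros i Hi; now apply (euler_alpha_le m alpha L). }
  apply le_epsilon; intros e He.
  pose proof (Cmod_ge_0 Q) as PQ.
  destruct (filterlim_Cmod _ _ Lim (e / (Cmod Q + 1))) as (M0 & HM).
  { apply Rdiv_lt_0_compat; lra. }
  set (M := (M0 + N)%nat); specialize (HM M ltac:(lia)); specialize (G M).
  rewrite <- QF in G by lia.
  replace (Q * L s - RtoC 1)%C with ((Q * Cprod f M - RtoC 1) - Q * (Cprod f M - L s))%C by ring.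
  eapply Rle_trans; [apply Cmod_triangle_minus|]; rewrite Cmod_mult.
  assert (Cmod Q * Cmod (Cprod f M - L s) <= e).
  { apply Rle_trans with ((Cmod Q + 1) * (e / (Cmod Q + 1))).
    - apply Rmult_le_compat; auto; try apply Cmod_ge_0; lra.
    - right; field; lra. }
  replace (4 * INR m * (/ INR N) ^ (j - 3)) with (2 * c) by (unfold c; ring).
  lra.
Qed.

Lemma ramanujan_poly_bounded (a : nat -> C) : ramanujan a -> poly_bounded a.
Proof.
  intros H; destruct (H 1 ltac:(lra)) as (K & HK); exists (Rabs K), 1%nat; split.
  - apply Rabs_pos.
  - intros n Hn; eapply Rle_trans; [apply HK; auto|].
    rewrite Rpower_1, pow_1 by (apply lt_0_INR; lia).
    apply Rmult_le_compat_r; [apply pos_INR|apply Rle_abs].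
Qed.

Definition unit_at_1 (n : nat) : C := if (n =? 1)%nat then RtoC 1 else RtoC 0.

Lemma euler_all_coef (L : C -> C) (a : nat -> C) (m : nat) (alpha : nat -> nat -> C) (N n : nat) :
  selberg_class_poly L a m alpha -> (1 <= n < N)%nat -> euler_all m alpha N a n = unit_at_1 n.
Proof.
  intros HL Hn; set (c := fun n => (euler_all m alpha N a n - unit_at_1 n)%C).
  enough (E : c n = RtoC 0).
  { unfold c in E; replace (euler_all m alpha N a n)
      with (euler_all m alpha N a n - unit_at_1 n + unit_at_1 n)%C by ring; rewrite E; ring. }
  assert (PN : 2 <= INR N) by (apply (le_INR 2); lia).
  assert (QN : 0 < / INR N <= / 2).
  { split; [apply Rinv_0_lt_compat; lra|apply Rinv_le_contravar; lra]. }
  pose proof (pos_INR m) as Pm.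
  destruct (pow_small (/ INR N) (/ (4 * INR m + 1))) as (J & HJ); [lra|apply Rinv_0_lt_compat; lra|].
  (* The factor [N ^ 3] turns the exponent [j - 3] of [euler_tail_bound] into the exponent [j] of
     the uniqueness lemma. *)
  apply (ds_coef_unique c (fun j => Cprod (fun p => if is_prime_dec p then local_inv m alpha p j else RtoC 1) N
        * L (RtoC (INR j)) - RtoC 1)%C (4 * INR m * INR N ^ 3) N (J + 3)); auto.
  - destruct (poly_bounded_euler_all m alpha N a (ramanujan_poly_bounded a (scp_ramanujan _ _ _ _ HL)))
      as (K & d & HK & Hb).
    exists (K + 1), d; split; [lra|]; intros k Hk; unfold c.
    eapply Rle_trans; [apply Cmod_triangle_minus|].
    rewrite Rmult_plus_distr_r; apply Rplus_le_compat; auto.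
    apply Rle_trans with 1.
    + unfold unit_at_1; destruct (k =? 1)%nat; [rewrite Cmod_1|rewrite Cmod_0]; lra.
    + rewrite Rmult_1_l; apply pow_R1_Rle, INR_ge_1; auto.
  - intros j Hj.
    pose proof (ds_lim_euler_all m alpha N a j _
      (dirichlet_ds_lim a L j (scp_dirichlet _ _ _ _ HL) ltac:(lia))) as D.
    intros e He; destruct (D e He) as (N0 & H0); exists (S N0); intros M HM.
    specialize (H0 M ltac:(lia)).
    assert (E : csum c j M = (csum (euler_all m alpha N a) j M - RtoC 1)%C).
    { clear H0; destruct M as [|M]; [lia|]; clear HM; induction M as [|M IH].
      - cbn [csum]; unfold c, unit_at_1; cbn [Nat.eqb].
        replace (/ INR 1) with 1 by (simpl; lra); rewrite pow1; ring.
      - cbn [csum] in *; rewrite IH; unfold c, unit_at_1; cbn [Nat.eqb]; ring. }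
    rewrite E; eapply Rle_lt_trans; [|apply H0]; right; f_equal; ring.
  - intros j Hj; eapply Rle_trans.
    + apply (euler_tail_bound m alpha L); try lia; [apply HL|].
      specialize (HJ (j - 3)%nat ltac:(lia)).
      assert (K : (4 * INR m + 1) * (/ INR N) ^ (j - 3) <= 1).
      { apply Rle_trans with ((4 * INR m + 1) * / (4 * INR m + 1)).
        - apply Rmult_le_compat_l; lra.
        - right; field; lra. }
      assert (0 < (/ INR N) ^ (j - 3)) by (apply pow_lt; lra); lra.
    + right; replace j with (3 + (j - 3))%nat at 2 by lia; rewrite pow_add; field; lra.
Qed.

(** Only one prime is split off at a time, which is what the resonator needs; the range stops at [N]
    because [euler_all_coef] identifies the coefficients below [N] only. *)
Definition mult_upto (N : nat) (c : nat -> C) : Prop :=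
  c 1%nat = RtoC 1 /\ forall p n, is_prime p -> ~ Nat.divide p n -> (1 <= n)%nat -> (p * n < N)%nat ->
    c (p * n)%nat = (c p * c n)%C.

Lemma is_prime_ndivide_1 (q : nat) : is_prime q -> ~ Nat.divide q 1.
Proof. intros H D; apply is_prime_ge_2 in H; apply Nat.divide_1_r in D; lia. Qed.

(** Multiplicativity passes back from [(1 - al q^(-s)) F] to F. The induction is for the case
    [p <> q] with [q] dividing [n]: there [euler_mul] differs from [c] by a term at the smaller
    index [p * (n / q)]. *)
Lemma mult_upto_euler_mul (N q : nat) (al : C) (c : nat -> C) : is_prime q ->
  mult_upto N (euler_mul q al c) -> mult_upto N c.
Proof.
  intros Hq [H1 H2]; pose proof (is_prime_ge_2 q Hq) as Q2.
  pose proof (is_prime_ndivide_1 q Hq) as ND1.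
  assert (C1 : c 1%nat = RtoC 1) by (rewrite <- H1; symmetry; apply euler_mul_ndivide; auto; lia).
  split; auto; intros p n Hp; pose proof (is_prime_ge_2 p Hp) as P2.
  induction n as [n IH] using lt_wf_ind; intros Hd Hn HN.
  specialize (H2 p n Hp Hd Hn HN).
  destruct (Nat.eq_dec p q) as [->|Npq].
  - rewrite euler_mul_divide, (euler_mul_ndivide q al c n) in H2 by (auto; lia).
    replace (euler_mul q al c q) with (c q - al)%C in H2.
    2: { replace q with (q * 1)%nat at 3 by lia; rewrite euler_mul_divide by lia.
         rewrite C1, Nat.mul_1_r; ring. }
    replace (c (q * n)%nat) with (c (q * n)%nat - al * c n + al * c n)%C by ring.
    rewrite H2; ring.
  - assert (Dqp : ~ Nat.divide q p).
    { intros D; apply Npq; symmetry; now apply is_prime_divide_eq. }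
    rewrite (euler_mul_ndivide q al c p) in H2 by (auto; lia).
    destruct (classic (Nat.divide q n)) as [D|D].
    + destruct D as (k & ->).
      replace (k * q)%nat with (q * k)%nat in * by lia.
      replace (p * (q * k))%nat with (q * (p * k))%nat in * by lia.
      rewrite !euler_mul_divide in H2 by lia.
      assert (Ik : c (p * k)%nat = (c p * c k)%C).
      { apply IH; try nia; intros (r & ->); apply Hd; exists (q * r)%nat; lia. }
      rewrite Ik in H2.
      replace (c (q * (p * k))%nat) with (c (q * (p * k))%nat - al * (c p * c k) + al * (c p * c k))%C by ring.
      rewrite H2; ring.
    + rewrite !euler_mul_ndivide in H2; auto; try lia.
      intros D'; apply is_prime_mult in D'; tauto.
Qed.

(** Once the factors below [N] are cleared, the coefficients below [N] are those of 1 and trivially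
    multiplicative. Putting the factors back one by one preserves this, and [N] is arbitrary. *)
Lemma selberg_multiplicative (L : C -> C) (a : nat -> C) (m : nat) (alpha : nat -> nat -> C) :
  selberg_class_poly L a m alpha -> a 1%nat = RtoC 1 /\
  forall p n, is_prime p -> ~ Nat.divide p n -> (1 <= n)%nat -> a (p * n)%nat = (a p * a n)%C.
Proof.
  intros HL.
  assert (M : forall N, (2 <= N)%nat -> mult_upto N a).
  { intros N HN.
    assert (K : mult_upto N (euler_all m alpha N a)).
    { split; [rewrite (euler_all_coef L) by (auto; lia); reflexivity|].
      intros p n Hp Hd Hn HN'; pose proof (is_prime_ge_2 p Hp).
      rewrite !(euler_all_coef L a m alpha N) by (auto; nia); unfold unit_at_1.
      replace (p * n =? 1)%nat with false by (symmetry; apply Nat.eqb_neq; nia).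
      replace (p =? 1)%nat with false by (symmetry; apply Nat.eqb_neq; nia); ring. }
    revert K; generalize N at 2; intros k; induction k as [|k IH]; cbn [euler_all]; auto.
    destruct (is_prime_dec k) as [Hp|]; auto; intros K; apply IH; revert K.
    generalize m at 1; intros i; induction i as [|i IHi]; cbn [euler_iter]; auto.
    intros K; apply IHi; now apply (mult_upto_euler_mul N k (alpha i k)). }
  split; [apply (M 2%nat); lia|].
  intros p n Hp Hd Hn; pose proof (is_prime_ge_2 p Hp); apply (M (S (p * n))); auto; nia.
Qed.

(** * Local parameters: power series in p^(-s) and the bound |alpha_j(p)| <= 1 *)

Fixpoint shift_iter (al : nat -> C) (m : nat) (b : nat -> C) : nat -> C :=
  match m with
  | O => b
  | S m' => fun k => match k with
      | O => shift_iter al m' b O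
      | S k' => (shift_iter al m' b (S k') - al m' * shift_iter al m' b k')%C
      end
  end.

Lemma is_prime_divide_pow (q p k : nat) : is_prime q -> is_prime p ->
  Nat.divide q (p ^ k) -> q = p.
Proof.
  intros Hq Hp; induction k as [|k IH]; simpl; intros D.
  - apply is_prime_ndivide_1 in D; easy.
  - apply is_prime_mult in D; auto; destruct D as [D|D]; auto; now apply is_prime_divide_eq.
Qed.

Lemma euler_iter_pow (al : nat -> C) (p m : nat) (c : nat -> C) (k : nat) : is_prime p ->
  euler_iter al p m c (p ^ k) = shift_iter al m (fun k => c (p ^ k)%nat) k.
Proof.
  intros Hp; pose proof (is_prime_ge_2 p Hp); revert k; induction m as [|m IH]; intros k;
    cbn [euler_iter shift_iter]; auto.
  destruct k as [|k].
  - rewrite euler_mul_ndivide, <- IH; auto; try lia; now apply is_prime_ndivide_1.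
  - rewrite Nat.pow_succ_r', euler_mul_divide by lia; rewrite <- Nat.pow_succ_r', !IH; auto.
Qed.

Lemma euler_all_pow_other (m : nat) (alpha : nat -> nat -> C) (N : nat) (c : nat -> C) (p k : nat) :
  is_prime p -> (N <= p)%nat -> euler_all m alpha N c (p ^ k) = c (p ^ k)%nat.
Proof.
  intros Hp HN; induction N as [|N IH]; cbn [euler_all]; auto.
  destruct (is_prime_dec N) as [Hq|]; [|apply IH; lia].
  rewrite <- IH by lia; generalize m at 1; intros i; induction i as [|i IHi]; cbn [euler_iter]; auto.
  rewrite euler_mul_ndivide; auto; [apply is_prime_ge_2 in Hq; lia|].
  intros D; apply is_prime_divide_pow in D; auto; lia.
Qed.

Lemma euler_all_pow (m : nat) (alpha : nat -> nat -> C) (N : nat) (c : nat -> C) (p k : nat) :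
  is_prime p -> (p < N)%nat ->
  euler_all m alpha N c (p ^ k) = shift_iter (fun i => alpha i p) m (fun k => c (p ^ k)%nat) k.
Proof.
  intros Hp HN; induction N as [|N IH]; [lia|]; cbn [euler_all].
  destruct (Nat.eq_dec p N) as [->|n].
  - destruct (is_prime_dec N) as [_|]; [|easy].
    rewrite euler_iter_pow by auto.
    clear IH; revert k; generalize m at 1 3; intros i; induction i as [|i IHi]; intros k; cbn [shift_iter].
    + now rewrite euler_all_pow_other.
    + destruct k; rewrite !IHi; auto.
  - destruct (is_prime_dec N) as [Hq|]; [|apply IH; lia].
    rewrite <- IH by lia; generalize m at 1; intros i; induction i as [|i IHi]; cbn [euler_iter]; auto.
    rewrite euler_mul_ndivide; auto; [apply is_prime_ge_2 in Hq; lia|].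
    intros D; apply is_prime_divide_pow in D; auto; lia.
Qed.

(** At powers of [p] only the factors of [p] act, so [euler_all_coef] becomes the formal identity
    sum a(p^k) X^k . prod (1 - alpha_i(p) X) = 1; [shift_iter] computes the coefficients of the left
    side. *)
Lemma shift_iter_local (L : C -> C) (a : nat -> C) (m : nat) (alpha : nat -> nat -> C) (p k : nat) :
  selberg_class_poly L a m alpha -> is_prime p ->
  shift_iter (fun i => alpha i p) m (fun k => a (p ^ k)%nat) k
  = if (k =? 0)%nat then RtoC 1 else RtoC 0.
Proof.
  intros HL Hp; pose proof (is_prime_ge_2 p Hp).
  assert (K : (1 <= p ^ k)%nat) by (pose proof (Nat.pow_nonzero p k); lia).
  (* The bound has to exceed [p], so that its factors are cleared, and [p ^ k], so that the
     coefficient there is known. *)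
  rewrite <- (euler_all_pow m alpha (S (p ^ k + p))) by (auto; lia).
  rewrite (euler_all_coef L) by (auto; lia); unfold unit_at_1.
  destruct k as [|k]; simpl; auto.
  replace (p * p ^ k =? 1)%nat with false; auto.
  symmetry; apply Nat.eqb_neq; pose proof (Nat.pow_nonzero p k); nia.
Qed.

Definition tends_0 (u : nat -> C) : Prop :=
  forall eps, 0 < eps -> exists N, forall n, (N <= n)%nat -> Cmod (u n) < eps.

Lemma tends_0_lin (u : nat -> C) (c : C) : tends_0 u ->
  tends_0 (fun n => match n with O => u O | S n' => (u (S n') - c * u n')%C end).
Proof.
  intros H e He; pose proof (Cmod_ge_0 c) as Pc.
  destruct (H (e / (2 * (1 + Cmod c)))) as (N & HN); [apply Rdiv_lt_0_compat; lra|].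
  exists (S N); intros n Hn; destruct n as [|n]; [lia|].
  eapply Rle_lt_trans; [apply Cmod_triangle_minus|]; rewrite Cmod_mult.
  assert (K1 := HN (S n) ltac:(lia)); assert (K2 := HN n ltac:(lia)).
  apply Rle_lt_trans with (e / (2 * (1 + Cmod c)) * (1 + Cmod c)); [nra|].
  replace (e / (2 * (1 + Cmod c)) * (1 + Cmod c)) with (e / 2) by (field; lra); lra.
Qed.

Lemma tends_0_ext (u v : nat -> C) : (forall n, u n = v n) -> tends_0 u -> tends_0 v.
Proof. intros E H e He; destruct (H e He) as (N & HN); exists N; intros; rewrite <- E; auto. Qed.

Fixpoint power_sum (b : nat -> C) (X : C) (n : nat) : C :=
  match n with
  | O => b O
  | S n' => (power_sum b X n' + b n * X ^ n)%C
  end.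

Lemma power_sum_shift (al : nat -> C) (m : nat) (b : nat -> C) (X : C) (n : nat) :
  power_sum (shift_iter al (S m) b) X n
  = match n with
    | O => power_sum (shift_iter al m b) X O
    | S n' => (power_sum (shift_iter al m b) X (S n')
               - al m * X * power_sum (shift_iter al m b) X n')%C
    end.
Proof.
  induction n as [|n IH]; auto.
  cbn [power_sum]; rewrite IH; cbn [shift_iter]; destruct n as [|n]; cbn [power_sum].
  - rewrite !Cpow_S; replace (X ^ 0)%C with (RtoC 1) by reflexivity; ring.
  - rewrite !Cpow_S; ring.
Qed.

(* If X is the inverse of one of the al i, the terms alone decide: at that step the
   partial sums become b n X^n, so convergence of the power series is not needed. *)
Lemma shift_iter_root (al : nat -> C) (m i : nat) (b : nat -> C) (X : C) : (i < m)%nat ->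
  (al i * X = RtoC 1)%C -> tends_0 (fun n => b n * X ^ n)%C ->
  tends_0 (power_sum (shift_iter al m b) X).
Proof.
  intros Hi E Hb.
  assert (T : forall k, tends_0 (fun n => shift_iter al k b n * X ^ n)%C).
  { induction k as [|k IH]; auto.
    apply (tends_0_lin _ (al k * X)%C) in IH; revert IH; apply tends_0_ext; intros [|n]; cbn [shift_iter]; auto.
    rewrite Cpow_S; ring. }
  induction m as [|m IH]; [lia|].
  destruct (Nat.eq_dec i m) as [->|n].
  - apply tends_0_ext with (2 := T m); intros n; rewrite power_sum_shift; destruct n as [|n].
    + cbn [power_sum]; replace (X ^ 0)%C with (RtoC 1) by reflexivity; ring.
    + rewrite E; cbn [power_sum]; ring.
  - specialize (IH ltac:(lia)); apply (tends_0_lin _ (al m * X)%C) in IH; revert IH.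
    apply tends_0_ext; intros k; now rewrite power_sum_shift.
Qed.

(** If [|alpha| > 1], the Ramanujan bound with exponent [ln |alpha| / (2 ln p)] makes
    [a (p^n) * alpha^(-n)] decay like [|alpha|^(-n/2)]. By [shift_iter_root] the partial sums of the
    cleared local series at X = 1/alpha then tend to 0, whereas [shift_iter_local] says that they
    all equal 1. *)
Lemma selberg_alpha_le_1 (L : C -> C) (a : nat -> C) (m : nat) (alpha : nat -> nat -> C) (p i : nat) :
  selberg_class_poly L a m alpha -> is_prime p -> (i < m)%nat -> Cmod (alpha i p) <= 1.
Proof.
  intros HL Hp Hi; apply Rnot_lt_le; intros K; set (al := alpha i p) in *.
  pose proof (is_prime_ge_2 p Hp) as P2.
  assert (Pp : 1 < INR p) by (apply (lt_INR 1); apply is_prime_ge_2 in Hp; lia).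
  assert (Lp : 0 < ln (INR p)) by (rewrite <- ln_1; apply ln_increasing; lra).
  assert (La : 0 < ln (Cmod al)) by (rewrite <- ln_1; apply ln_increasing; lra).
  assert (Hal : al <> RtoC 0) by (apply Cmod_gt_0; lra).
  set (ep := ln (Cmod al) / (2 * ln (INR p))).
  assert (Hep : 0 < ep) by (apply Rdiv_lt_0_compat; lra).
  destruct (scp_ramanujan _ _ _ _ HL ep Hep) as (B & HB).
  set (X := (/ al)%C).
  set (r := exp (- (ln (Cmod al) / 2))).
  assert (Hr : 0 <= r < 1).
  { split; [left; apply exp_pos|]; unfold r; rewrite <- exp_0; apply exp_increasing; lra. }
  assert (T : tends_0 (fun n => a (p ^ n)%nat * X ^ n)%C).
  { intros e He; destruct (pow_small r (e / (Rabs B + 1)) Hr) as (N & HN).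
    { apply Rdiv_lt_0_compat; auto; pose proof (Rabs_pos B); lra. }
    exists N; intros n Hn; specialize (HN n Hn).
    assert (Q : Cmod (a (p ^ n)%nat) <= B * exp (INR n * (ln (Cmod al) / 2))).
    { eapply Rle_trans; [apply HB; pose proof (Nat.pow_nonzero p n); lia|].
      right; f_equal; unfold Rpower; f_equal.
      rewrite pow_INR, ln_pow by lra; unfold ep; field; lra. }
    assert (Xn : Cmod (X ^ n) = exp (- (INR n * ln (Cmod al)))).
    { unfold X; rewrite Cmod_pow, Cmod_inv by auto.
      rewrite <- Rpower_pow by (apply Rinv_0_lt_compat; lra).
      unfold Rpower; rewrite ln_Rinv by lra; f_equal; ring. }
    assert (rn : r ^ n = exp (- (INR n * (ln (Cmod al) / 2)))).
    { unfold r; rewrite <- Rpower_pow by apply exp_pos; unfold Rpower; rewrite ln_exp; f_equal; ring. }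
    rewrite Cmod_mult, Xn.
    apply Rle_lt_trans with (B * exp (INR n * (ln (Cmod al) / 2)) * exp (- (INR n * ln (Cmod al)))).
    { apply Rmult_le_compat_r; auto; left; apply exp_pos. }
    rewrite Rmult_assoc, <- exp_plus.
    replace (INR n * (ln (Cmod al) / 2) + - (INR n * ln (Cmod al)))
      with (- (INR n * (ln (Cmod al) / 2))) by field.
    rewrite <- rn.
    assert (Pr : 0 <= r ^ n) by (apply pow_le; lra).
    pose proof (Rle_abs B); pose proof (Rabs_pos B).
    apply Rle_lt_trans with ((Rabs B + 1) * r ^ n); [nra|].
    apply Rlt_le_trans with ((Rabs B + 1) * (e / (Rabs B + 1))).
    - apply Rmult_lt_compat_l; lra.
    - right; field; lra. }
  apply (shift_iter_root (fun i => alpha i p) m i) in T; auto.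
  2: { unfold X; fold al; now apply Cinv_r. }
  destruct (T 1 ltac:(lra)) as (N & HN); specialize (HN N (Nat.le_refl N)).
  enough (E : forall n, power_sum (shift_iter (fun i => alpha i p) m (fun n => a (p ^ n)%nat)) X n = RtoC 1).
  { rewrite E, Cmod_1 in HN; lra. }
  induction n as [|n IH]; cbn [power_sum]; [|rewrite IH];
    rewrite (shift_iter_local L) by auto; simpl; auto; ring.
Qed.

(** The coefficient of X in the local identity gives [a p] as the sum of the m parameters at [p],
    each of modulus at most 1. *)
Lemma selberg_coef_le (L : C -> C) (a : nat -> C) (m : nat) (alpha : nat -> nat -> C) (p : nat) :
  selberg_class_poly L a m alpha -> is_prime p -> Cmod (a p) <= INR m.
Proof.
  intros HL Hp.
  pose proof (shift_iter_local L a m alpha p 1 HL Hp) as E; cbn [Nat.eqb] in E.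
  assert (A1 : a (p ^ 0)%nat = RtoC 1) by (apply (selberg_multiplicative L a m alpha); auto).
  assert (K : forall k, (k <= m)%nat ->
    shift_iter (fun i => alpha i p) k (fun k => a (p ^ k)%nat) O = RtoC 1 /\
    Cmod (a p - shift_iter (fun i => alpha i p) k (fun k => a (p ^ k)%nat) 1%nat) <= INR k).
  { induction k as [|k IH]; intros Hk.
    - cbn [shift_iter]; rewrite A1, Nat.pow_1_r; split; auto.
      replace (a p - a p)%C with (RtoC 0) by ring; rewrite Cmod_0; simpl; lra.
    - destruct (IH ltac:(lia)) as [I1 I2]; cbn [shift_iter]; split; auto.
      rewrite I1, S_INR.
      match goal with |- Cmod (?x - (?y - ?z * RtoC 1)) <= _ =>
        replace (x - (y - z * RtoC 1))%C with ((x - y) + z)%C by ring end.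
      eapply Rle_trans; [apply Cmod_triangle|].
      apply Rplus_le_compat; auto; apply (selberg_alpha_le_1 L a m); auto. }
  destruct (K m (Nat.le_refl m)) as [_ K2]; rewrite E in K2.
  replace (a p - RtoC 0)%C with (a p) in K2 by ring; auto.
Qed.

(** * The smoothing kernel *)

Lemma exp_le (x y : R) : x <= y -> exp x <= exp y.
Proof. intros [H|H]; [left; now apply exp_increasing|rewrite H; lra]. Qed.

Lemma vertical_shift (f : C -> C) (x1 x2 y1 y2 B : R) : x1 <= x2 -> y1 <= y2 ->
  (forall x y, x1 <= x <= x2 -> y1 <= y <= y2 -> cdiff f (x, y)) ->
  (forall x, x1 <= x <= x2 -> Cmod (f (x, y1)) <= B /\ Cmod (f (x, y2)) <= B) ->
  Cmod (CI (fun t => f (x1, t)) y1 y2 - CI (fun t => f (x2, t)) y1 y2) <= 4 * (x2 - x1) * B.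
Proof.
  intros Hx Hy Hf HB; pose proof (goursat f x1 x2 y1 y2 Hx Hy Hf) as G; unfold rect_int in G.
  set (A1 := CI (fun t => f (x1, t)) y1 y2) in *; set (A2 := CI (fun t => f (x2, t)) y1 y2) in *.
  assert (H1 : Cmod (CI (fun x => f (x, y1)) x1 x2) <= 2 * (x2 - x1) * B).
  { apply Cmod_CI_le_const; auto; intros t Ht; [|apply HB; auto].
    apply rcont_horiz, cdiff_ccont, Hf; lra. }
  assert (H2 : Cmod (CI (fun x => f (x, y2)) x1 x2) <= 2 * (x2 - x1) * B).
  { apply Cmod_CI_le_const; auto; intros t Ht; [|apply HB; auto].
    apply rcont_horiz, cdiff_ccont, Hf; lra. }
  set (B1 := CI (fun x => f (x, y1)) x1 x2) in *; set (B2 := CI (fun x => f (x, y2)) x1 x2) in *.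
  assert (E : (Ci * (A1 - A2) = B1 - B2)%C).
  { replace (B1 - B2)%C with (B1 - B2 + Ci * (A2 - A1) + Ci * (A1 - A2))%C by ring.
    rewrite G; ring. }
  replace (Cmod (A1 - A2)) with (Cmod (Ci * (A1 - A2))) by (rewrite Cmod_mult, Cmod_Ci; ring).
  rewrite E; eapply Rle_trans; [apply Cmod_triangle_minus|]; lra.
Qed.

Lemma Cmod_pow_minus_1 (z : C) (n : nat) :
  Cmod ((RtoC 1 + z) ^ n - RtoC 1) <= (1 + Cmod z) ^ n - 1.
Proof.
  pose proof (Cmod_ge_0 z) as Pz; induction n as [|n IH].
  - simpl; replace (RtoC 1 - RtoC 1)%C with (RtoC 0) by ring; rewrite Cmod_0; lra.
  - rewrite Cpow_S; set (w := ((RtoC 1 + z) ^ n)%C) in *.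
    replace ((RtoC 1 + z) * w - RtoC 1)%C with ((w - RtoC 1) + (z * (w - RtoC 1) + z))%C by ring.
    eapply Rle_trans; [apply Cmod_triangle|].
    eapply Rle_trans; [apply Rplus_le_compat_l, Cmod_triangle|].
    rewrite Cmod_mult; simpl pow; pose proof (Cmod_ge_0 (w - RtoC 1)); nra.
Qed.

Lemma one_plus_pow_le (x : R) (n : nat) : 0 <= x -> INR n * x <= 1/3 -> (1 + x) ^ n <= 3/2.
Proof.
  intros Hx H; apply Rle_trans with (exp (INR n * x)).
  - rewrite <- Rpower_pow by lra; unfold Rpower.
    assert (ln (1 + x) <= x).
    { rewrite <- (ln_exp x) at 2; apply ln_le; [lra|apply exp_ineq1_le]. }
    assert (INR n * ln (1 + x) <= INR n * x) by (apply Rmult_le_compat_l; auto; apply pos_INR).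
    destruct H1 as [H1|H1]; [left; now apply exp_increasing|rewrite H1; lra].
  - apply Rle_trans with (exp (1/3)).
    + destruct H as [H|H]; [left; now apply exp_increasing|rewrite H; lra].
    + assert (E : exp (1/3) * exp (1/3) * exp (1/3) = exp 1) by (rewrite <- !exp_plus; f_equal; lra).
      pose proof exp_le_3; pose proof (exp_pos (1/3)).
      apply Rnot_lt_le; intros K.
      assert (9/4 < exp (1/3) * exp (1/3)) by nra; nra.
Qed.

Lemma Cpow_imag_4 (v : R) (h : nat) : ((0, v) ^ (4 * h))%C = RtoC (v ^ (4 * h)).
Proof.
  rewrite Cpow_mult_r, pow_mult.
  replace ((0, v) ^ 4)%C with (RtoC (v ^ 4)).
  - induction h as [|h IH]; [reflexivity|].
    rewrite Cpow_S, IH, <- RtoC_mult; reflexivity.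
  - rewrite !Cpow_S; replace ((0, v) ^ 0)%C with (RtoC 1) by reflexivity.
    apply injective_projections; simpl; ring.
Qed.

(** Write et + i v = i v (1 + z). The power of i v is [v ^ (4 * h)] because the exponent is a
    multiple of 4, and [|z| <= 1 / (3 n)] keeps the n-th power of 1 + z within 1/2 of 1. *)
Lemma Re_pow_lower (et v : R) (h : nat) : (1 <= h)%nat ->
  3 * INR (4 * h) * Rabs et <= Rabs v -> v ^ (4 * h) / 2 <= Re ((et, v) ^ (4 * h)).
Proof.
  intros Hh H; set (n := (4 * h)%nat) in *.
  assert (Pn : 1 <= INR n) by (apply INR_ge_1; unfold n; lia).
  destruct (Req_dec v 0) as [->|Hv].
  - rewrite Rabs_R0 in H; pose proof (Rabs_pos et).
    assert (E : et = 0).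
    { apply Rabs_eq_0; nra. }
    subst et; unfold n; rewrite Cpow_imag_4, pow_i by lia; simpl; lra.
  - set (z := (0, - (et / v))).
    replace ((et, v)) with ((0, v) * (RtoC 1 + z))%C
      by (unfold z; apply injective_projections; simpl; field; auto).
    rewrite Cpow_mult_l; unfold n at 2; rewrite Cpow_imag_4; fold n.
    assert (P : 0 <= v ^ n).
    { unfold n; replace (4 * h)%nat with (2 * (2 * h))%nat by lia; rewrite pow_mult; apply pow_le; nra. }
    assert (Mz : Cmod z = Rabs et / Rabs v).
    { unfold z; replace (0, - (et / v)) with (Ci * RtoC (- (et / v)))%C
        by (apply injective_projections; simpl; ring).
      rewrite Cmod_mult, Cmod_Ci, Cmod_R, Rabs_Ropp, Rmult_1_l.
      unfold Rdiv; rewrite Rabs_mult, Rabs_inv; auto. }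
    assert (Hz : INR n * Cmod z <= 1/3).
    { rewrite Mz; assert (0 < Rabs v) by now apply Rabs_pos_lt.
      apply Rmult_le_reg_r with (Rabs v); auto; field_simplify; lra. }
    pose proof (one_plus_pow_le (Cmod z) n (Cmod_ge_0 z) Hz) as B.
    pose proof (Cmod_pow_minus_1 z n) as B'.
    pose proof (re_le_Cmod ((RtoC 1 + z) ^ n - RtoC 1)) as R.
    set (u := ((RtoC 1 + z) ^ n)%C) in *.
    replace (Re (u - RtoC 1)) with (Re u - 1) in R
      by (unfold Re, Cminus, Cplus, Copp, RtoC; cbn [fst snd]; ring).
    apply Rabs_le_between in R.
    replace (Re (RtoC (v ^ n) * u)) with (v ^ n * Re u) by (unfold Re, Cmult, RtoC; cbn [fst snd]; ring).
    assert (1/2 <= Re u) by lra; nra.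
Qed.

Section Kernel.

Variables (T W : R) (h : nat).
Hypotheses (Hh : (1 <= h)%nat) (HW : 1 <= W) (HT : 2 * W <= T).

Let n := (4 * h)%nat.

(** The exponent [n = 4 h] is a multiple of 4, so that [ker] is real and positive on the imaginary
    axis and small at heights T and 2 T throughout a strip whose width is proportional to [W]. *)
Definition ker (w : C) : C := Cexp (- ((w - (0, 3 * T / 2)%R) / RtoC W) ^ n).

(** The half-width of the strip in which [Re_pow_lower] applies as soon as the height is at distance
    at least [W] from 3 T / 2. *)
Definition ker_width : R := W / (3 * INR n).
Definition ker_edge : R := exp (- ((T / (2 * W)) ^ n / 2)).
Definition ker_sup : R := exp (2 ^ n).

Lemma ker_n_pos : 1 <= INR n.
Proof. apply INR_ge_1; unfold n; lia. Qed.

Lemma Cmod_ker (u t : R) :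
  Cmod (ker (u, t)) = exp (- Re ((u / W, (t - 3 * T / 2) / W) ^ n)).
Proof.
  unfold ker; rewrite Cmod_Cexp; f_equal.
  replace (((u, t) - (0, 3 * T / 2)%R) / RtoC W)%C with (u / W, (t - 3 * T / 2) / W).
  - reflexivity.
  - apply injective_projections; simpl; field; lra.
Qed.

Lemma ker_le_sup (u t : R) : Rabs u <= ker_width -> Cmod (ker (u, t)) <= ker_sup.
Proof.
  intros Hu; rewrite Cmod_ker; pose proof ker_n_pos as Pn.
  set (et := u / W); set (v := (t - 3 * T / 2) / W).
  assert (He : 3 * INR n * Rabs et <= 1).
  { unfold et, Rdiv; rewrite Rabs_mult, Rabs_inv, (Rabs_pos_eq W) by lra.
    apply Rle_trans with (3 * INR n * (ker_width * / W)).
    - apply Rmult_le_compat_l; [lra|]; apply Rmult_le_compat_r; auto.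
      left; apply Rinv_0_lt_compat; lra.
    - right; unfold ker_width; field; lra. }
  assert (P2 : 0 < 2 ^ n) by (apply pow_lt; lra).
  unfold ker_sup; apply exp_le.
  (* Away from the centre the exponent of the kernel has nonpositive real part. Near the centre the
     base has modulus at most 2, whence the value [exp (2 ^ n)] of [ker_sup]. *)
  destruct (Rle_dec 1 (Rabs v)) as [H1|H1].
  - assert (K := Re_pow_lower et v h Hh ltac:(fold n; lra)); fold n in K.
    assert (0 <= v ^ n); [|lra].
    unfold n; replace (4 * h)%nat with (2 * (2 * h))%nat by lia; rewrite pow_mult; apply pow_le; nra.
  - assert (K : Cmod ((et, v) ^ n) <= 2 ^ n).
    { rewrite Cmod_pow; apply pow_incr; split; [apply Cmod_ge_0|].
      eapply Rle_trans; [apply Cmod_le_abs|]; simpl; pose proof (Rabs_pos et); nra. }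
    pose proof (re_le_Cmod ((et, v) ^ n)) as K'.
    assert (K'' := Rle_trans _ _ _ K' K); apply Rabs_le_between in K''; lra.
Qed.

Lemma ker_le_edge (u t : R) : Rabs u <= ker_width -> Rabs (t - 3 * T / 2) = T / 2 ->
  Cmod (ker (u, t)) <= ker_edge.
Proof.
  intros Hu Ht; rewrite Cmod_ker; pose proof ker_n_pos as Pn.
  set (et := u / W); set (v := (t - 3 * T / 2) / W).
  assert (He : 3 * INR n * Rabs et <= 1).
  { unfold et, Rdiv; rewrite Rabs_mult, Rabs_inv, (Rabs_pos_eq W) by lra.
    apply Rle_trans with (3 * INR n * (ker_width * / W)).
    - apply Rmult_le_compat_l; [lra|]; apply Rmult_le_compat_r; auto.
      left; apply Rinv_0_lt_compat; lra.
    - right; unfold ker_width; field; lra. }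
  assert (Hv : Rabs v = T / (2 * W)).
  { unfold v, Rdiv at 1; rewrite Rabs_mult, Rabs_inv, (Rabs_pos_eq W), Ht by lra; field; lra. }
  assert (H1 : 1 <= Rabs v).
  { rewrite Hv; apply Rmult_le_reg_r with (2 * W); [lra|]; field_simplify; lra. }
  assert (K := Re_pow_lower et v h Hh ltac:(fold n; lra)); fold n in K.
  unfold ker_edge; apply exp_le; rewrite <- Hv.
  assert (E : Rabs v ^ n = v ^ n).
  { unfold n; replace (4 * h)%nat with (2 * (2 * h))%nat by lia; rewrite !(pow_mult _ 2), pow2_abs; auto. }
  rewrite E; lra.
Qed.

Lemma cdiff_ker (z : C) : cdiff ker z.
Proof.
  unfold ker; apply (cdiff_comp Cexp); [|apply cdiff_Cexp].
  apply cdiff_comp with (f := fun w => (- w)%C) (g := fun w => (((w - (0, 3 * T / 2)%R) / RtoC W) ^ n)%C).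
  - apply cdiff_comp with (f := fun w => (w ^ n)%C) (g := fun w => ((w - (0, 3 * T / 2)%R) / RtoC W)%C);
      [|apply cdiff_pow].
    apply (cdiff_mult (fun w => w - (0, 3 * T / 2)%R)%C (fun _ => / RtoC W)%C); [|apply cdiff_const].
    apply (cdiff_plus (fun w => w) (fun _ => - (0, 3 * T / 2)%R)%C); [apply cdiff_id|apply cdiff_const].
  - apply cdiff_ext_loc with (f := fun w => (- RtoC 1 * w)%C) (r := 1); [lra|intros; ring|].
    apply cdiff_mult; [apply cdiff_const|apply cdiff_id].
Qed.

Lemma cdiff_Rcpow (y : R) (z : C) : cdiff (Rcpow y) z.
Proof.
  unfold Rcpow; apply (cdiff_comp Cexp); [|apply cdiff_Cexp].
  apply (cdiff_mult (fun w => w) (fun _ => RtoC (ln y))); [apply cdiff_id|apply cdiff_const].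
Qed.

Lemma Cmod_Rcpow (y u t : R) : Cmod (Rcpow y (u, t)) = exp (u * ln y).
Proof. unfold Rcpow; rewrite Cmod_Cexp; f_equal; simpl; ring. Qed.

Definition wker (y : R) (w : C) : C := (Rcpow y w * ker w)%C.

Lemma cdiff_wker (y : R) (z : C) : cdiff (wker y) z.
Proof. apply cdiff_mult; [apply cdiff_Rcpow|apply cdiff_ker]. Qed.

Definition ker_int (y u : R) : C := CI (fun t => wker y (u, t)) T (2 * T).

Lemma ker_int_shift (y u1 u2 G : R) : u1 <= u2 -> - ker_width <= u1 -> u2 <= ker_width ->
  (forall u, u1 <= u <= u2 -> exp (u * ln y) <= G) ->
  Cmod (ker_int y u1 - ker_int y u2) <= 4 * (u2 - u1) * (G * ker_edge).
Proof.
  intros Hu H1 H2 HG; unfold ker_int.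
  apply (vertical_shift (wker y) u1 u2 T (2 * T) (G * ker_edge)); [exact Hu|lra| |].
  - intros; apply cdiff_wker.
  - intros u Hu'; assert (Rabs u <= ker_width) by (apply Rabs_le; lra).
    unfold wker; rewrite !Cmod_mult, !Cmod_Rcpow.
    split; (apply Rmult_le_compat; [left; apply exp_pos|apply Cmod_ge_0|auto|apply ker_le_edge; auto]).
    + rewrite Rabs_left1; lra.
    + rewrite Rabs_pos_eq; lra.
Qed.

Lemma ker_int_le (y u : R) : Rabs u <= ker_width ->
  Cmod (ker_int y u) <= 2 * T * (exp (u * ln y) * ker_sup).
Proof.
  intros Hu; eapply Rle_trans.
  - apply (Cmod_CI_le_const _ _ _ (exp (u * ln y) * ker_sup)); [lra| |].
    + intros t _; apply rcont_vert, cdiff_ccont, cdiff_wker.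
    + intros t _; unfold wker; rewrite Cmod_mult, Cmod_Rcpow.
      apply Rmult_le_compat_l; [left; apply exp_pos|now apply ker_le_sup].
  - right; ring.
Qed.

(** The first term comes from the horizontal edges, over a displacement of at most [ker_width + 3].
    The second is the integral on the displaced line, where [y^u] has gained
    [exp (- (ker_width - 3) * |ln y|)] with [|ln y| >= 1 / (2 N)]. *)
Definition ker_err (N : R) : R :=
  4 * (ker_width + 3) * ker_edge + 2 * T * ker_sup * exp (- ((ker_width - 3) / (2 * N))).

Lemma ker_err_pos (N : R) : 0 <= ker_err N.
Proof.
  unfold ker_err, ker_edge, ker_sup.
  assert (0 <= ker_width).
  { unfold ker_width; apply Rmult_le_pos; [lra|left; apply Rinv_0_lt_compat; pose proof ker_n_pos; lra]. }
  pose proof (exp_pos (- ((T / (2 * W)) ^ n / 2))); pose proof (exp_pos (2 ^ n)).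
  pose proof (exp_pos (- ((ker_width - 3) / (2 * N)))).
  apply Rplus_le_le_0_compat; repeat apply Rmult_le_pos; lra.
Qed.

(* The contour is moved by ker_width towards the side on which y^u decays. *)
Lemma ker_int_small (y u0 N : R) : 1 <= N -> / (2 * N) <= Rabs (ln y) -> 0 <= u0 <= 3 -> 3 <= ker_width ->
  Cmod (ker_int y u0) <= exp (u0 * ln y) * ker_err N.
Proof.
  intros HN Hy Hu Hw; set (Y := ker_width) in *.
  assert (PN : 0 < / (2 * N)) by (apply Rinv_0_lt_compat; lra).
  pose proof (exp_pos (u0 * ln y)) as Pe.
  assert (Pg : 0 < ker_edge) by apply exp_pos; assert (Ps : 0 < ker_sup) by apply exp_pos.
  destruct (Rle_dec 0 (ln y)) as [Hp|Hn].
  - rewrite Rabs_pos_eq in Hy by auto.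
    assert (S := ker_int_shift y (- Y) u0 (exp (u0 * ln y)) ltac:(lra) ltac:(unfold Y; lra) ltac:(unfold Y in *; lra)).
    assert (S' := S ltac:(intros u Hu'; apply exp_le; nra)); clear S.
    assert (B := ker_int_le y (- Y) ltac:(rewrite Rabs_Ropp, Rabs_pos_eq; unfold Y in *; lra)).
    assert (E : exp (- Y * ln y) <= exp (u0 * ln y) * exp (- ((Y - 3) / (2 * N)))).
    { rewrite <- exp_plus; apply exp_le; unfold Rdiv; nra. }
    replace (ker_int y u0) with (ker_int y (- Y) - (ker_int y (- Y) - ker_int y u0))%C by ring.
    eapply Rle_trans; [apply Cmod_triangle_minus|].
    unfold ker_err; fold Y; set (e1 := exp (u0 * ln y)) in *; set (e2 := exp (- ((Y - 3) / (2 * N)))) in *.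
    apply Rle_trans with (2 * T * (e1 * e2 * ker_sup) + 4 * (Y + 3) * (e1 * ker_edge)).
    + apply Rplus_le_compat.
      * eapply Rle_trans; [apply B|]; apply Rmult_le_compat_l; [lra|]; apply Rmult_le_compat_r; lra.
      * eapply Rle_trans; [apply S'|]; apply Rmult_le_compat_r; [|lra].
        apply Rmult_le_pos; lra.
    + right; ring.
  - rewrite Rabs_left in Hy by lra.
    assert (S := ker_int_shift y u0 Y (exp (u0 * ln y)) ltac:(lra) ltac:(unfold Y in *; lra) ltac:(unfold Y; lra)).
    assert (S' := S ltac:(intros u Hu'; apply exp_le; nra)); clear S.
    assert (B := ker_int_le y Y ltac:(rewrite Rabs_pos_eq; unfold Y in *; lra)).
    assert (E : exp (Y * ln y) <= exp (u0 * ln y) * exp (- ((Y - 3) / (2 * N)))).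
    { rewrite <- exp_plus; apply exp_le; unfold Rdiv.
      assert ((Y - u0) * / (2 * N) <= (Y - u0) * - ln y) by (apply Rmult_le_compat_l; lra).
      assert ((Y - 3) * / (2 * N) <= (Y - u0) * / (2 * N)) by (apply Rmult_le_compat_r; lra).
      lra. }
    replace (ker_int y u0) with (ker_int y Y + (ker_int y u0 - ker_int y Y))%C by ring.
    eapply Rle_trans; [apply Cmod_triangle|].
    unfold ker_err; fold Y; set (e1 := exp (u0 * ln y)) in *; set (e2 := exp (- ((Y - 3) / (2 * N)))) in *.
    apply Rle_trans with (2 * T * (e1 * e2 * ker_sup) + 4 * (Y + 3) * (e1 * ker_edge)).
    + apply Rplus_le_compat.
      * eapply Rle_trans; [apply B|]; apply Rmult_le_compat_l; [lra|]; apply Rmult_le_compat_r; lra.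
      * eapply Rle_trans; [apply S'|]; apply Rmult_le_compat_r; [|lra].
        apply Rmult_le_pos; lra.
    + right; ring.
Qed.

(** At [y = 1] the integral is the same on all vertical lines up to the edges, so every diagonal
    term carries the same mass. *)
Lemma ker_int_diag (u0 N : R) : 0 <= u0 <= 3 -> 3 <= ker_width ->
  Cmod (ker_int 1 u0 - ker_int 1 0) <= ker_err N.
Proof.
  intros Hu Hw; rewrite Cmod_minus_sym.
  assert (Pg : 0 < ker_edge) by apply exp_pos; assert (Ps : 0 < ker_sup) by apply exp_pos.
  eapply Rle_trans.
  - apply (ker_int_shift 1 0 u0 1); try lra.
    intros u _; rewrite ln_1, Rmult_0_r, exp_0; lra.
  - unfold ker_err; assert (0 <= 2 * T * ker_sup * exp (- ((ker_width - 3) / (2 * N)))).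
    { repeat apply Rmult_le_pos; try lra; left; apply exp_pos. }
    assert (4 * (u0 - 0) * (1 * ker_edge) <= 4 * (ker_width + 3) * ker_edge); [|lra].
    rewrite Rmult_1_l; apply Rmult_le_compat_r; lra.
Qed.

Definition ker_real (t : R) : R := exp (- ((t - 3 * T / 2) / W) ^ n).

Lemma ker_imag (t : R) : ker (0, t) = RtoC (ker_real t).
Proof.
  unfold ker, ker_real; rewrite <- Cexp_R; f_equal.
  replace (((0, t) - (0, 3 * T / 2)%R) / RtoC W)%C with (0, (t - 3 * T / 2) / W).
  - unfold n; rewrite Cpow_imag_4, RtoC_opp; auto.
  - apply injective_projections; simpl; field; lra.
Qed.

Lemma ker_real_cont (t : R) : continuous ker_real t.
Proof.
  destruct (rcont_vert ker 0 t) as [H _]; [apply cdiff_ccont, cdiff_ker|].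
  revert H; apply continuous_ext; intros s; rewrite ker_imag; auto.
Qed.

Definition ker_mass : R := RInt ker_real T (2 * T).

Lemma ker_int_1_0 : ker_int 1 0 = RtoC ker_mass.
Proof.
  unfold ker_int; rewrite (CI_ext _ (fun t => RtoC (ker_real t))); [|lra|].
  - unfold CI, ker_mass; apply injective_projections; simpl; auto.
    rewrite RInt_const; unfold scal; simpl; unfold mult; simpl; ring.
  - intros t _; unfold wker; rewrite ker_imag; unfold Rcpow; rewrite ln_1.
    replace ((0, t) * RtoC 0)%C with (RtoC 0) by ring; rewrite Cexp_0; ring.
Qed.

(** Since [W >= 1], the kernel is at least 1/e on the unit neighbourhood of 3 T / 2. Any bound
    independent of T would do, because the mass is only compared with errors that tend to 0. *)
Lemma ker_mass_ge : 1/2 <= ker_mass.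
Proof.
  assert (I : forall a b, ex_RInt ker_real a b).
  { intros; apply (ex_RInt_continuous (V := R_CompleteNormedModule)); intros; apply ker_real_cont. }
  unfold ker_mass; set (t0 := 3 * T / 2).
  rewrite <- (RInt_Chasles (V := R_CompleteNormedModule) ker_real T (t0 - 1) (2 * T)); auto.
  rewrite <- (RInt_Chasles (V := R_CompleteNormedModule) ker_real (t0 - 1) (t0 + 1) (2 * T)); auto.
  unfold plus; simpl.
  assert (A1 : 0 <= RInt ker_real T (t0 - 1)).
  { apply RInt_ge_0; auto; [unfold t0; lra|]; intros; left; apply exp_pos. }
  assert (A3 : 0 <= RInt ker_real (t0 + 1) (2 * T)).
  { apply RInt_ge_0; auto; [unfold t0; lra|]; intros; left; apply exp_pos. }
  assert (A2 : RInt (fun _ => 1/4) (t0 - 1) (t0 + 1) <= RInt ker_real (t0 - 1) (t0 + 1)).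
  { apply RInt_le; auto; [lra|apply ex_RInt_const|]; intros t Ht.
    apply Rle_trans with (exp (- (1))).
    - pose proof exp_le_3; rewrite exp_Ropp.
      apply Rle_trans with (/ 3); [lra|]; apply Rinv_le_contravar; auto; apply exp_pos.
    - unfold ker_real; apply exp_le, Ropp_le_contravar; fold t0.
      assert (Q : Rabs ((t - t0) / W) <= 1).
      { unfold Rdiv; rewrite Rabs_mult, Rabs_inv, (Rabs_pos_eq W) by lra.
        assert (Rabs (t - t0) <= 1) by (apply Rabs_le; lra).
        assert (0 < / W <= 1).
        { split; [apply Rinv_0_lt_compat; lra|]; rewrite <- Rinv_1; apply Rinv_le_contravar; lra. }
        pose proof (Rabs_pos (t - t0)); nra. }
      rewrite <- (pow1 (2 * h)); unfold n.
      replace (4 * h)%nat with (2 * (2 * h))%nat by lia; rewrite (pow_mult _ 2).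
      apply pow_incr; split; [apply pow2_ge_0|].
      rewrite <- (pow2_abs ((t - t0) / W)); pose proof (Rabs_pos ((t - t0) / W)); nra. }
  rewrite RInt_const in A2; unfold scal in A2; simpl in A2; unfold mult in A2; simpl in A2; lra.
Qed.

End Kernel.

(** * Smoothed twisted moments *)

Fixpoint nsum (f : nat -> C) (Z : nat) : C :=
  match Z with O => RtoC 0 | S Z' => (nsum f Z' + f Z)%C end.

Lemma nsum_0 (f : nat -> C) (Z : nat) :
  (forall k, (1 <= k <= Z)%nat -> f k = RtoC 0) -> nsum f Z = RtoC 0.
Proof.
  induction Z as [|Z IH]; intros H; cbn [nsum]; auto.
  rewrite IH, H; [ring|lia|]; intros; apply H; lia.
Qed.

Lemma rcont_nsum (f : nat -> R -> C) (Z : nat) (t : R) :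
  (forall k, rcont (f k) t) -> rcont (fun t => nsum (fun k => f k t) Z) t.
Proof.
  intros H; induction Z as [|Z IH]; cbn [nsum]; [apply rcont_const|now apply rcont_plus].
Qed.

Lemma CI_nsum (f : nat -> R -> C) (Z : nat) (a b : R) : a <= b ->
  (forall k, rcont_on (f k) a b) ->
  CI (fun t => nsum (fun k => f k t) Z) a b = nsum (fun k => CI (f k) a b) Z.
Proof.
  intros Hab H; induction Z as [|Z IH]; cbn [nsum].
  - unfold CI; simpl; rewrite RInt_const; unfold scal; simpl; unfold mult; simpl.
    apply injective_projections; simpl; ring.
  - rewrite CI_plus, IH; auto; intros t Ht.
    apply (rcont_nsum f); intros; apply H; auto.
Qed.

(** On Re s = 3 the crude bound [|a k| <= K k] makes the terms at most [K / k^2], and these are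
    compared with a telescoping sum. *)
Lemma dirichlet_tail (a : nat -> C) (L : C -> C) (K t : R) (Z : nat) : dirichlet_series a L ->
  0 <= K -> (forall k, (1 <= k)%nat -> Cmod (a k) <= K * INR k) -> (1 <= Z)%nat ->
  Cmod (L (3, t) - nsum (fun k => a k * Rcpow (INR k) (- (3, t)))%C Z) <= K / INR Z.
Proof.
  intros HD HK Ha HZ; set (f := fun k => (a k * Rcpow (INR k) (- (3, t)))%C).
  assert (Hf : forall k, (1 <= k)%nat -> Cmod (f (S k)) <= K * (/ INR k - / INR (S k))).
  { intros k Hk; unfold f; rewrite Cmod_mult.
    pose proof (INR_ge_1 k Hk); rewrite S_INR; set (y := INR k) in *.
    replace (- (3, t))%C with (- (3), - t) by reflexivity; rewrite Cmod_Rcpow.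
    eapply Rle_trans; [apply Rmult_le_compat_r; [left; apply exp_pos|apply Ha; lia]|].
    rewrite S_INR; fold y; rewrite Rmult_assoc; apply Rmult_le_compat_l; auto.
    replace (- (3) * ln (y + 1)) with (- (ln ((y + 1) ^ 3))) by (rewrite ln_pow by lra; simpl; ring).
    rewrite exp_Ropp, exp_ln by (apply pow_lt; lra).
    replace (/ y - / (y + 1)) with (/ (y * (y + 1))) by (field; lra).
    replace ((y + 1) * / (y + 1) ^ 3) with (/ ((y + 1) * (y + 1))) by (field; lra).
    apply Rinv_le_contravar; nra. }
  assert (Htl : forall M, Cmod (nsum f (Z + M) - nsum f Z) <= K * (/ INR Z - / INR (Z + M))).
  { induction M as [|M IH].
    - rewrite Nat.add_0_r; replace (nsum f Z - nsum f Z)%C with (RtoC 0) by ring; rewrite Cmod_0; lra.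
    - rewrite Nat.add_succ_r; cbn [nsum].
      replace (nsum f (Z + M) + f (S (Z + M)) - nsum f Z)%C
        with (nsum f (Z + M) - nsum f Z + f (S (Z + M)))%C by ring.
      eapply Rle_trans; [apply Cmod_triangle|].
      pose proof (Hf (Z + M)%nat ltac:(lia)); lra. }
  apply le_epsilon; intros e He.
  destruct (filterlim_Cmod _ _ (HD (3, t) ltac:(simpl; lra)) e He) as (N0 & HN0).
  set (M := (N0 + Z)%nat); specialize (HN0 M ltac:(lia)).
  assert (E : sum_n (G := C_NormedModule) (fun n => (a (S n) * Rcpow (INR (S n)) (- (3, t)))%C) M = nsum f (S M)).
  { clear; induction M as [|M IH].
    - rewrite sum_O; cbn [nsum]; symmetry; apply Cplus_0_l.
    - rewrite sum_Sn, IH; reflexivity. }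
  rewrite E in HN0.
  specialize (Htl (S M - Z)%nat); replace (Z + (S M - Z))%nat with (S M) in Htl by lia.
  assert (0 < / INR (S M)) by (apply Rinv_0_lt_compat, lt_0_INR; lia).
  assert (0 <= K * / INR (S M)) by nra.
  replace (L (3, t) - nsum f Z)%C with ((nsum f (S M) - nsum f Z) - (nsum f (S M) - L (3, t)))%C by ring.
  eapply Rle_trans; [apply Cmod_triangle_minus|]; unfold Rdiv; lra.
Qed.

(** Distinct integers differ by at least 1. Only [n] is bounded by [N]: in the application [b] is
    [k * n1], with [k] running over the whole Dirichlet series, and a larger [b] only moves the
    ratio further from 1. *)
Lemma abs_ln_ratio (b n : nat) (N : R) : (1 <= b)%nat -> (1 <= n)%nat -> INR n <= N -> b <> n ->
  / (2 * N) <= Rabs (ln (INR n / INR b)).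
Proof.
  intros Hb Hn HN Hd; pose proof (INR_ge_1 b Hb) as Pb; pose proof (INR_ge_1 n Hn) as Pn.
  assert (K : forall z, 0 < z -> ln z <= z - 1).
  { intros z Hz; rewrite <- (ln_exp (z - 1)); apply ln_le; auto.
    pose proof (exp_ineq1_le (z - 1)); lra. }
  assert (PN : / (2 * N) * (2 * N) = 1) by (field; lra).
  assert (0 < / (2 * N)) by (apply Rinv_0_lt_compat; lra).
  assert (Sw : ln (INR n / INR b) = - ln (INR b / INR n)).
  { rewrite <- ln_Rinv by (apply Rdiv_lt_0_compat; lra); f_equal; field; lra. }
  destruct (Nat.lt_total b n) as [l|[l|l]]; [|easy|].
  - assert (G : INR b + 1 <= INR n) by (rewrite <- S_INR; apply le_INR; lia).
    assert (Q := K (INR b / INR n) ltac:(apply Rdiv_lt_0_compat; lra)).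
    eapply Rle_trans; [|apply Rle_abs]; rewrite Sw.
    assert (INR b / INR n <= 1 - / N); [|assert (/ (2 * N) <= / N) by (apply Rinv_le_contravar; lra); lra].
    apply Rmult_le_reg_r with (INR n); [lra|].
    unfold Rdiv; rewrite Rmult_assoc, Rinv_l, Rmult_1_r by lra.
    assert (/ N * INR n <= 1); [|lra].
    apply Rle_trans with (/ N * N); [|right; field; lra].
    apply Rmult_le_compat_l; [left; apply Rinv_0_lt_compat|]; lra.
  - assert (G : INR n + 1 <= INR b) by (rewrite <- S_INR; apply le_INR; lia).
    assert (Q := K (INR n / INR b) ltac:(apply Rdiv_lt_0_compat; lra)).
    rewrite <- Rabs_Ropp; eapply Rle_trans; [|apply Rle_abs].
    assert (INR n / INR b <= 1 - / (2 * N)); [|lra].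
    apply Rmult_le_reg_r with (INR b); [lra|].
    unfold Rdiv; rewrite Rmult_assoc, Rinv_l, Rmult_1_r by lra.
    assert (/ (2 * N) * (INR n + 1) <= 1).
    { rewrite <- PN; apply Rmult_le_compat_l; lra. }
    assert (/ (2 * N) <= 1/2).
    { replace (1/2) with (/ 2) by lra; apply Rinv_le_contravar; lra. }
    nra.
Qed.

Lemma Rcpow_real_neg (x s : R) : Rcpow x (- RtoC s) = RtoC (Rpower x (- s)).
Proof.
  unfold Rcpow, Rpower; rewrite <- Cexp_R; f_equal; apply injective_projections; simpl; ring.
Qed.

(** * Finite sums and Hermitian forms in the coefficients of the polynomial *)

Definition lsumC {A : Type} (f : A -> C) (l : list A) : C :=
  fold_right (fun x s => f x + s)%C (RtoC 0) l.

Definition lsumR {A : Type} (f : A -> R) (l : list A) : R :=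
  fold_right (fun x s => f x + s) 0 l.

Lemma lsumC_ext {A : Type} (f g : A -> C) (l : list A) :
  (forall x, In x l -> f x = g x) -> lsumC f l = lsumC g l.
Proof.
  induction l as [|x l IH]; intros H; simpl; auto.
  rewrite H, IH; simpl; auto; intros; apply H; simpl; auto.
Qed.

Lemma lsumC_scal {A : Type} (c : C) (f : A -> C) (l : list A) :
  lsumC (fun x => c * f x)%C l = (c * lsumC f l)%C.
Proof. induction l as [|x l IH]; simpl; [ring|rewrite IH; ring]. Qed.

Lemma lsumC_RtoC {A : Type} (f : A -> R) (l : list A) :
  lsumC (fun x => RtoC (f x)) l = RtoC (lsumR f l).
Proof. induction l as [|x l IH]; simpl; auto; rewrite IH, RtoC_plus; auto. Qed.

Lemma lsumR_le {A : Type} (f g : A -> R) (l : list A) :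
  (forall x, In x l -> f x <= g x) -> lsumR f l <= lsumR g l.
Proof.
  induction l as [|x l IH]; intros H; simpl; [lra|].
  apply Rplus_le_compat; [apply H; simpl; auto|apply IH; intros; apply H; simpl; auto].
Qed.

Lemma lsumR_scal {A : Type} (c : R) (f : A -> R) (l : list A) :
  lsumR (fun x => c * f x) l = c * lsumR f l.
Proof. induction l as [|x l IH]; simpl; [ring|rewrite IH; ring]. Qed.

Lemma lsumR_plus {A : Type} (f g : A -> R) (l : list A) :
  lsumR (fun x => f x + g x) l = lsumR f l + lsumR g l.
Proof. induction l as [|x l IH]; simpl; [ring|rewrite IH; ring]. Qed.

Lemma lsumR_const {A : Type} (c : R) (l : list A) : lsumR (fun _ => c) l = INR (length l) * c.
Proof. induction l as [|x l IH]; cbn [length]; [simpl; ring|rewrite S_INR; simpl; rewrite IH; ring]. Qed.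

Lemma Cmod_lsumC_diff_le {A : Type} (f g : A -> C) (e : A -> R) (l : list A) :
  (forall x, In x l -> Cmod (f x - g x) <= e x) -> Cmod (lsumC f l - lsumC g l) <= lsumR e l.
Proof.
  induction l as [|x l IH]; intros H; simpl.
  - replace (RtoC 0 - RtoC 0)%C with (RtoC 0) by ring; rewrite Cmod_0; lra.
  - replace (f x + lsumC f l - (g x + lsumC g l))%C
      with ((f x - g x) + (lsumC f l - lsumC g l))%C by ring.
    eapply Rle_trans; [apply Cmod_triangle|].
    apply Rplus_le_compat; [apply H; simpl; auto|apply IH; intros; apply H; simpl; auto].
Qed.

Lemma rcont_lsumC {A : Type} (f : A -> R -> C) (l : list A) (t : R) :
  (forall x, In x l -> rcont (f x) t) -> rcont (fun t => lsumC (fun x => f x t) l) t.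
Proof.
  induction l as [|x l IH]; intros H; simpl; [apply rcont_const|].
  apply rcont_plus; [apply H; simpl; auto|apply IH; intros; apply H; simpl; auto].
Qed.

Lemma CI_lsumC {A : Type} (f : A -> R -> C) (l : list A) (a b : R) : a <= b ->
  (forall x, In x l -> rcont_on (f x) a b) ->
  CI (fun t => lsumC (fun x => f x t) l) a b = lsumC (fun x => CI (f x) a b) l.
Proof.
  intros Hab; induction l as [|x l IH]; intros H; simpl.
  - unfold CI; simpl; rewrite RInt_const; unfold scal; simpl; unfold mult; simpl.
    apply injective_projections; simpl; ring.
  - rewrite CI_plus, IH; auto.
    + intros; apply H; simpl; auto.
    + apply H; simpl; auto.
    + intros t Ht; apply rcont_lsumC; intros; apply H; simpl; auto.
Qed.

(** With [F n1 n2 = (n2/n1)^(it)] this is [|R(t)|^2]. Replacing [F] by the integrals of these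
    twists, with or without the factor L, gives the two moments that are compared. *)
Definition quad (l : list (nat * C)) (F : nat -> nat -> C) : C :=
  lsumC (fun p => lsumC (fun q => snd p * Cconj (snd q) * F (fst p) (fst q))%C l) l.

Definition energy (l : list (nat * C)) : R := lsumR (fun p => Cmod (snd p) ^ 2) l.

Lemma energy_pos (l : list (nat * C)) : 0 <= energy l.
Proof.
  unfold energy; replace 0 with (lsumR (fun _ => 0) l).
  - apply lsumR_le; intros; apply pow2_ge_0.
  - rewrite lsumR_const; ring.
Qed.

(** The product of two moduli is at most half the sum of their squares. The resulting factor
    [length l] is harmless, since [e] will be smaller than any power of T. *)
Lemma quad_diff_le (l : list (nat * C)) (F G : nat -> nat -> C) (m e : R) : 0 <= e ->
  (forall p q, In p l -> In q l -> Cmod (F (fst p) (fst q) - RtoC m * G (fst p) (fst q)) <= e) ->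
  Cmod (quad l F - RtoC m * quad l G) <= e * INR (length l) * energy l.
Proof.
  intros He H; unfold quad; rewrite <- lsumC_scal.
  eapply Rle_trans.
  - apply (Cmod_lsumC_diff_le _ _ (fun p => lsumR (fun q => e / 2 * (Cmod (snd p) ^ 2 + Cmod (snd q) ^ 2)) l)).
    intros p Hp; rewrite <- lsumC_scal; apply Cmod_lsumC_diff_le; intros q Hq.
    match goal with |- Cmod (?A * ?F - ?m * (?A * ?G)) <= _ =>
      replace (A * F - m * (A * G))%C with (A * (F - m * G))%C by ring end.
    rewrite !Cmod_mult, Cmod_conj.
    specialize (H p q Hp Hq).
    pose proof (Cmod_ge_0 (snd p)); pose proof (Cmod_ge_0 (snd q)).
    apply Rle_trans with (Cmod (snd p) * Cmod (snd q) * e).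
    + apply Rmult_le_compat_l; auto; now apply Rmult_le_pos.
    + assert (Cmod (snd p) * Cmod (snd q) <= (Cmod (snd p) ^ 2 + Cmod (snd q) ^ 2) / 2).
      { pose proof (pow2_ge_0 (Cmod (snd p) - Cmod (snd q))); nra. }
      nra.
  - right; unfold energy.
    transitivity (lsumR (fun p => e / 2 * INR (length l) * Cmod (snd p) ^ 2
        + e / 2 * lsumR (fun q => Cmod (snd q) ^ 2) l) l).
    + f_equal; apply functional_extensionality; intros p.
      rewrite lsumR_scal, lsumR_plus, lsumR_const; ring.
    + rewrite lsumR_plus, lsumR_scal, lsumR_const; field.
Qed.

Lemma quad_delta (l : list (nat * C)) : NoDup (map fst l) ->
  quad l (fun n1 n2 => if (n1 =? n2)%nat then RtoC 1 else RtoC 0) = RtoC (energy l).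
Proof.
  intros HN; unfold quad, energy; rewrite <- lsumC_RtoC; apply lsumC_ext; intros p Hp.
  revert HN Hp; induction l as [|q l IH]; intros HN Hp; [easy|]; inversion HN as [|? ? Nq Nl]; subst.
  simpl lsumC; destruct Hp as [->|Hp].
  - rewrite Nat.eqb_refl.
    rewrite (lsumC_ext _ (fun _ => RtoC 0 * RtoC 0)%C).
    + rewrite lsumC_scal, Cmod2_conj; ring.
    + intros x Hx; replace (fst p =? fst x)%nat with false; [ring|].
      symmetry; apply Nat.eqb_neq; intros E; apply Nq; rewrite E; now apply in_map.
  - rewrite IH by auto; replace (fst p =? fst q)%nat with false; [ring|].
    symmetry; apply Nat.eqb_neq; intros E; apply Nq; rewrite <- E; now apply in_map.
Qed.

Lemma quad_square (l : list (nat * C)) (b : nat -> C) (k : C) :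
  quad l (fun n1 n2 => b n1 * Cconj (b n2) * k)%C
  = (RtoC (Cmod (lsumC (fun p => snd p * b (fst p)) l) ^ 2) * k)%C.
Proof.
  rewrite Cmod2_conj; set (S := lsumC (fun p => snd p * b (fst p))%C l).
  assert (E : Cconj S = lsumC (fun q => Cconj (snd q) * Cconj (b (fst q)))%C l).
  { unfold S; induction l as [|x l IH]; simpl.
    - apply injective_projections; simpl; ring.
    - rewrite Cplus_conj, Cmult_conj, IH; auto. }
  unfold quad; rewrite E.
  rewrite (lsumC_ext _ (fun p => k * lsumC (fun q => Cconj (snd q) * Cconj (b (fst q))) l * (snd p * b (fst p)))%C).
  - rewrite lsumC_scal; fold S; ring.
  - intros p _; rewrite (lsumC_ext _ (fun q => k * (snd p * b (fst p)) * (Cconj (snd q) * Cconj (b (fst q))))%C).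
    + rewrite lsumC_scal; ring.
    + intros q _; ring.
Qed.

Section Moment.

Variables (T W : R) (h : nat) (L : C -> C) (a : nat -> C) (sigma K BL : R) (N : nat).
Hypotheses (Hh : (1 <= h)%nat) (HW : 1 <= W) (HT : 2 * W <= T).
Hypothesis HLd : forall x y, T <= y -> cdiff L (x, y).
Hypothesis HLe : forall u, 0 <= u <= 3 -> Cmod (L (u, T)) <= BL /\ Cmod (L (u, 2 * T)) <= BL.
Hypothesis HD : dirichlet_series a L.
Hypotheses (HK : 0 <= K) (Ha : forall k, (1 <= k)%nat -> Cmod (a k) <= K * INR k).
Hypotheses (Hs : 0 <= sigma <= 3) (HN : (1 <= N)%nat) (Hwd : 3 <= ker_width W h).

Let wk := wker T W h.
Let kint := ker_int T W h.
Let err := ker_err T W h (INR N).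
Let edge := ker_edge T W h.

(** The integral of L(sigma + it) x^(it) against the kernel; the values x = n2/n1 arise on expanding
    |R(t)|^2. *)
Definition twisted (x : R) : C := CI (fun t => L (sigma, t) * wk x (0, t))%C T (2 * T).

Lemma exp_ln_le_cube (x u : R) : 0 < x <= INR N -> 0 <= u <= 3 -> exp (u * ln x) <= INR N ^ 3.
Proof.
  intros Hx Hu; pose proof (INR_ge_1 N HN) as PN.
  rewrite <- (exp_ln (INR N ^ 3)) by (apply pow_lt; lra); apply exp_le.
  rewrite ln_pow by lra; simpl INR.
  assert (ln x <= ln (INR N)) by (apply ln_le; lra).
  assert (0 <= ln (INR N)) by (rewrite <- ln_1; apply ln_le; lra).
  nra.
Qed.

Lemma ker_width_bound (u : R) : 0 <= u <= 3 -> Rabs u <= ker_width W h.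
Proof. intros; rewrite Rabs_pos_eq; lra. Qed.

Lemma twisted_shift (x : R) : 0 < x <= INR N ->
  Cmod (twisted x - CI (fun t => L (3%R, t) * wk x ((3 - sigma)%R, t))%C T (2 * T))
  <= 12 * (BL * (INR N ^ 3 * edge)).
Proof.
  intros Hx; pose proof (INR_ge_1 N HN) as PN.
  assert (Pe : 0 < edge) by apply exp_pos.
  set (F := fun w => (L (w + RtoC sigma) * wk x w)%C).
  assert (E : forall u t, F (u, t) = (L ((u + sigma)%R, t) * wk x (u, t))%C).
  { intros; unfold F; do 2 f_equal; apply injective_projections; simpl; ring. }
  assert (S := vertical_shift F 0 (3 - sigma) T (2 * T) (BL * (INR N ^ 3 * edge))).
  replace (CI (fun t => F (0, t)) T (2 * T)) with (twisted x) in S.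
  2: { apply CI_ext; [lra|]; intros t _; rewrite E; do 3 f_equal; ring. }
  replace (CI (fun t => F (3 - sigma, t)) T (2 * T))
    with (CI (fun t => L (3%R, t) * wk x ((3 - sigma)%R, t))%C T (2 * T)) in S.
  2: { apply CI_ext; [lra|]; intros t _; rewrite E; do 3 f_equal; ring. }
  assert (B0 : 0 <= BL * (INR N ^ 3 * edge)).
  { destruct (HLe 0 ltac:(lra)) as [Q _]; pose proof (Cmod_ge_0 (L (0, T))).
    apply Rmult_le_pos; [lra|]; apply Rmult_le_pos; [apply pow_le|]; lra. }
  eapply Rle_trans; [apply S; try lra|].
  - intros u t Hu Ht; apply (cdiff_mult (fun w => L (w + RtoC sigma)%C) (wk x)); [|apply cdiff_wker].
    apply (cdiff_comp L (fun w => w + RtoC sigma)%C).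
    + apply cdiff_plus; [apply cdiff_id|apply cdiff_const].
    + replace ((u, t) + RtoC sigma)%C with (u + sigma, t); [apply HLd; lra|].
      apply injective_projections; simpl; ring.
  - intros u Hu; rewrite !E; destruct (HLe (u + sigma) ltac:(lra)) as [Q1 Q2].
    unfold wk, wker; rewrite !Cmod_mult, !Cmod_Rcpow.
    pose proof (exp_ln_le_cube x u Hx ltac:(lra)); pose proof (exp_pos (u * ln x)).
    split; (apply Rmult_le_compat;
      [apply Cmod_ge_0|apply Rmult_le_pos; [lra|apply Cmod_ge_0]|auto|]);
      (apply Rmult_le_compat; [lra|apply Cmod_ge_0|auto|
        apply ker_le_edge; auto; [apply ker_width_bound; lra|]]).
    + rewrite Rabs_left1; lra.
    + rewrite Rabs_pos_eq; lra.
  - apply Rmult_le_compat_r; lra.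
Qed.

(** On the shifted line the k-th term of the series regroups as k^(-sigma) times the twist by x/k.
    The k-th integral is therefore a kernel integral at the ratio x/k, large only when x = k. *)
Lemma wker_split (k : nat) (x t : R) : (1 <= k)%nat -> 0 < x ->
  (a k * Rcpow (INR k) (- (3%R, t)) * wk x ((3 - sigma)%R, t)
   = a k * Rcpow (INR k) (- RtoC sigma) * wk (x / INR k)%R ((3 - sigma)%R, t))%C.
Proof.
  intros Hk Hx; pose proof (INR_ge_1 k Hk); unfold wk, wker, Rcpow.
  rewrite ln_div by lra.
  match goal with |- (?A * Cexp ?p * (Cexp ?q * ?k) = ?A * Cexp ?r * (Cexp ?s * ?k))%C =>
    transitivity (A * k * (Cexp p * Cexp q))%C; [ring|];
    transitivity (A * k * (Cexp r * Cexp s))%C; [|ring];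
    rewrite <- !Cexp_plus; replace (p + q)%C with (r + s)%C; [reflexivity|] end.
  apply injective_projections; simpl; ring.
Qed.

Definition diag_coef (x : R) (Z : nat) : C :=
  nsum (fun k => if Req_EM_T x (INR k) then a k * Rcpow (INR k) (- RtoC sigma) else RtoC 0)%C Z.

Lemma twisted_series (n1 n2 Z : nat) : (1 <= n1 <= N)%nat -> (1 <= n2 <= N)%nat ->
  Cmod (nsum (fun k => a k * Rcpow (INR k) (- RtoC sigma) * kint (INR n2 / INR n1 / INR k)%R (3 - sigma)%R)%C Z
        - RtoC (ker_mass T W h) * diag_coef (INR n2 / INR n1) Z)
  <= K * INR N ^ 3 * err * (2 * (1 - / INR (S Z))).
Proof.
  intros H1 H2; set (x := INR n2 / INR n1).
  pose proof (INR_ge_1 n1 ltac:(lia)) as P1; pose proof (INR_ge_1 n2 ltac:(lia)) as P2.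
  pose proof (INR_ge_1 N HN) as PN.
  assert (L1 : INR n1 <= INR N) by (apply le_INR; lia).
  assert (L2 : INR n2 <= INR N) by (apply le_INR; lia).
  assert (Px : 0 < x) by (apply Rdiv_lt_0_compat; lra).
  assert (Hx : x <= INR N).
  { apply Rle_trans with (INR n2); auto; unfold x; apply Rmult_le_reg_r with (INR n1); [lra|].
    unfold Rdiv; rewrite Rmult_assoc, Rinv_l, Rmult_1_r by lra; nra. }
  assert (Pe : 0 <= err) by (apply ker_err_pos; auto).
  assert (PN3 : 0 <= INR N ^ 3) by (apply pow_le; lra).
  assert (PKe : 0 <= K * INR N ^ 3 * err) by (apply Rmult_le_pos; auto; apply Rmult_le_pos; auto).
  induction Z as [|Z IH].
  - unfold diag_coef; cbn [nsum].
    replace (RtoC 0 - RtoC (ker_mass T W h) * RtoC 0)%C with (RtoC 0) by ring.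
    rewrite Cmod_0; apply Rmult_le_pos; auto; simpl; rewrite Rinv_1; lra.
  - unfold diag_coef in *; cbn [nsum]; set (k := S Z) in *.
    set (ak := (a k * Rcpow (INR k) (- RtoC sigma))%C).
    match goal with |- Cmod (?A + ?B - ?m * (?D + ?E)) <= _ =>
      replace (A + B - m * (D + E))%C with ((A - m * D) + (B - m * E))%C by ring end.
    eapply Rle_trans; [apply Cmod_triangle|].
    pose proof (INR_ge_1 k ltac:(lia)) as Pk.
    assert (Mk : Cmod ak <= K * INR k * exp (- sigma * ln (INR k))).
    { unfold ak; rewrite Cmod_mult; replace (- RtoC sigma)%C with (- sigma, - 0) by reflexivity.
      rewrite Cmod_Rcpow; apply Rmult_le_compat_r; [left; apply exp_pos|apply Ha; lia]. }
    assert (Step : Cmod (ak * kint (x / INR k) (3 - sigma)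
        - RtoC (ker_mass T W h) * (if Req_EM_T x (INR k) then ak else RtoC 0))
        <= Cmod ak * (exp ((3 - sigma) * ln (x / INR k)) * err)).
    { destruct (Req_EM_T x (INR k)) as [E|E].
      - rewrite <- E; replace (x / x) with 1 by (field; lra); rewrite ln_1, Rmult_0_r, exp_0, Rmult_1_l.
        rewrite <- (ker_int_1_0 T W h) by auto.
        replace (ak * kint 1 (3 - sigma)%R - ker_int T W h 1 0 * ak)%C
          with (ak * (kint 1 (3 - sigma)%R - ker_int T W h 1 0))%C by ring.
        rewrite Cmod_mult; apply Rmult_le_compat_l; [apply Cmod_ge_0|].
        apply ker_int_diag; auto; lra.
      - replace (ak * kint (x / INR k)%R (3 - sigma)%R - RtoC (ker_mass T W h) * RtoC 0)%C
          with (ak * kint (x / INR k)%R (3 - sigma)%R)%C by ring.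
        rewrite Cmod_mult; apply Rmult_le_compat_l; [apply Cmod_ge_0|].
        apply ker_int_small; auto; [|lra].
        replace (x / INR k) with (INR n2 / INR (k * n1)) by (unfold x; rewrite mult_INR; field; lra).
        apply abs_ln_ratio; auto; try nia.
        intros Ek; apply E; unfold x; rewrite <- Ek, mult_INR; field; lra. }
    (* The weights combine to [K x^(3-sigma) / k^2], and [1/k^2 <= 2 (1/k - 1/(k+1))] lets the
       errors telescope. *)
    assert (Fin : Cmod ak * (exp ((3 - sigma) * ln (x / INR k)) * err)
        <= K * INR N ^ 3 * err * (/ INR k - / INR (S k)) * 2).
    { apply Rle_trans with (K * INR k * exp (- sigma * ln (INR k)) * (exp ((3 - sigma) * ln (x / INR k)) * err)).
      { apply Rmult_le_compat_r; auto; apply Rmult_le_pos; auto; left; apply exp_pos. }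
      rewrite ln_div by lra.
      replace (K * INR k * exp (- sigma * ln (INR k)) * (exp ((3 - sigma) * (ln x - ln (INR k))) * err))
        with (K * err * (INR k * (exp (- sigma * ln (INR k)) * exp ((3 - sigma) * (ln x - ln (INR k)))))) by ring.
      rewrite <- exp_plus.
      replace (- sigma * ln (INR k) + (3 - sigma) * (ln x - ln (INR k)))
        with ((3 - sigma) * ln x + - ln (INR k ^ 3)) by (rewrite ln_pow by lra; simpl; ring).
      rewrite exp_plus, exp_Ropp, exp_ln by (apply pow_lt; lra).
      replace (K * INR N ^ 3 * err * (/ INR k - / INR (S k)) * 2)
        with (K * err * (INR N ^ 3 * ((/ INR k - / INR (S k)) * 2))) by ring.
      apply Rmult_le_compat_l; [now apply Rmult_le_pos|].
      replace (INR k * (exp ((3 - sigma) * ln x) * / INR k ^ 3))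
        with (exp ((3 - sigma) * ln x) * / (INR k * INR k)) by (field; lra).
      apply Rmult_le_compat.
      - left; apply exp_pos.
      - left; apply Rinv_0_lt_compat; nra.
      - apply exp_ln_le_cube; lra.
      - rewrite S_INR; replace ((/ INR k - / (INR k + 1)) * 2) with (2 / (INR k * (INR k + 1))) by (field; lra).
        apply Rmult_le_reg_r with (INR k * INR k * (INR k * (INR k + 1))); [repeat apply Rmult_lt_0_compat; lra|].
        field_simplify; nra. }
    pose proof (Rle_trans _ _ _ Step Fin) as SF.
    eapply Rle_trans; [apply Rplus_le_compat; [apply IH|apply SF]|].
    right; ring.
Qed.

Definition dir_coef (n1 n2 : nat) : C :=
  if (n2 mod n1 =? 0)%nat
  then (a (n2 / n1)%nat * Rcpow (INR (n2 / n1)) (- RtoC sigma))%C else RtoC 0.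

Lemma diag_coef_ratio (n1 n2 Z : nat) : (1 <= n1)%nat -> (1 <= n2 <= Z)%nat ->
  diag_coef (INR n2 / INR n1) Z = dir_coef n1 n2.
Proof.
  intros H1 H2; pose proof (INR_ge_1 n1 H1) as P1; unfold diag_coef, dir_coef.
  destruct (n2 mod n1 =? 0)%nat eqn:E.
  - apply mod_eqb_divide in E; [|lia]; destruct E as (k0 & ->).
    rewrite Nat.div_mul by lia.
    assert (Hk : (1 <= k0 <= Z)%nat) by nia.
    replace (INR (k0 * n1) / INR n1) with (INR k0) by (rewrite mult_INR; field; lra).
    clear H2; induction Z as [|Z IH]; [lia|]; cbn [nsum].
    destruct (Nat.eq_dec k0 (S Z)) as [->|n].
    + rewrite nsum_0.
      * destruct (Req_EM_T (INR (S Z)) (INR (S Z))); [ring|easy].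
      * intros k Hk'; destruct (Req_EM_T (INR (S Z)) (INR k)) as [E|]; auto; apply INR_eq in E; lia.
    + rewrite IH by lia; destruct (Req_EM_T (INR k0) (INR (S Z))) as [E|]; [apply INR_eq in E; lia|ring].
  - apply nsum_0; intros k Hk; destruct (Req_EM_T (INR n2 / INR n1) (INR k)) as [E'|]; auto.
    exfalso; assert (D : Nat.divide n1 n2).
    { exists k; apply INR_eq; rewrite mult_INR, <- E'; field; lra. }
    apply mod_eqb_divide in D; [|lia]; congruence.
Qed.

Definition moment_err : R := 12 * (BL * (INR N ^ 3 * edge)) + 2 * K * INR N ^ 3 * err.

Lemma twisted_est (n1 n2 : nat) : (1 <= n1 <= N)%nat -> (1 <= n2 <= N)%nat ->
  Cmod (twisted (INR n2 / INR n1) - RtoC (ker_mass T W h) * dir_coef n1 n2) <= moment_err.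
Proof.
  intros H1 H2; set (x := INR n2 / INR n1).
  pose proof (INR_ge_1 n1 ltac:(lia)) as P1; pose proof (INR_ge_1 n2 ltac:(lia)) as P2.
  pose proof (INR_ge_1 N HN) as PN.
  assert (L1 : INR n1 <= INR N) by (apply le_INR; lia).
  assert (L2 : INR n2 <= INR N) by (apply le_INR; lia).
  assert (Px : 0 < x) by (apply Rdiv_lt_0_compat; lra).
  assert (Hx : x <= INR N).
  { apply Rle_trans with (INR n2); auto; unfold x; apply Rmult_le_reg_r with (INR n1); [lra|].
    unfold Rdiv; rewrite Rmult_assoc, Rinv_l, Rmult_1_r by lra; nra. }
  assert (Pe : 0 <= err) by (apply ker_err_pos; auto).
  assert (PN3 : 0 <= INR N ^ 3) by (apply pow_le; lra).
  assert (PKe : 0 <= K * INR N ^ 3 * err) by (apply Rmult_le_pos; auto; apply Rmult_le_pos; auto).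
  assert (Psup : 0 < ker_sup h) by apply exp_pos.
  apply le_epsilon; intros e He.
  set (A := 2 * T * (K * (INR N ^ 3 * ker_sup h))).
  assert (PA : 0 <= A).
  { unfold A; apply Rmult_le_pos; [lra|]; apply Rmult_le_pos; auto; apply Rmult_le_pos; lra. }
  (* [Z > A / e] makes the tail of the series on Re s = 3 contribute at most [e], and [Z >= N]
     ensures that the partial sum contains the diagonal index n2/n1 whenever it is an integer. *)
  destruct (INR_unbounded (A / e + INR N)) as (Z & HZ).
  assert (HZ1 : (N <= Z)%nat).
  { apply INR_le; assert (0 <= A / e) by (apply Rmult_le_pos; auto; left; now apply Rinv_0_lt_compat); lra. }
  assert (HZ2 : A / INR Z <= e).
  { assert (0 < INR Z) by (apply lt_0_INR; lia).
    apply Rmult_le_reg_r with (INR Z); auto; unfold Rdiv; rewrite Rmult_assoc, Rinv_l, Rmult_1_r by lra.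
    apply Rle_trans with (e * (A / e)); [right; field; lra|]; apply Rmult_le_compat_l; lra. }
  set (S := fun t => nsum (fun k => a k * Rcpow (INR k) (- (3%R, t)))%C Z).
  set (wx := fun t => wk x ((3 - sigma)%R, t)).
  assert (Cw : forall y t, rcont (fun t => wk y ((3 - sigma)%R, t)) t).
  { intros; apply rcont_vert, cdiff_ccont, cdiff_wker. }
  assert (E1 : CI (fun t => S t * wx t)%C T (2 * T)
     = nsum (fun k => a k * Rcpow (INR k) (- RtoC sigma) * kint (x / INR k)%R (3 - sigma)%R)%C Z).
  { rewrite (CI_ext _ (fun t => nsum (fun k => (if (k =? 0)%nat then RtoC 0 else a k * Rcpow (INR k) (- RtoC sigma)) * wk (x / INR k)%R ((3 - sigma)%R, t))%C Z)); [|lra|].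
    - rewrite (CI_nsum (fun k t => (if (k =? 0)%nat then RtoC 0 else a k * Rcpow (INR k) (- RtoC sigma)) * wk (x / INR k)%R ((3 - sigma)%R, t))%C); [|lra|].
      + generalize Z; induction Z0 as [|z IH]; cbn [nsum]; auto; rewrite IH; f_equal.
        cbn [Nat.eqb]; apply CI_scal; [lra|]; intros t _; apply rcont_vert, cdiff_ccont, cdiff_wker.
      + intros k t _; apply rcont_mult; [apply rcont_const|apply Cw].
    - intros t _; unfold S, wx; generalize Z.
      induction Z0 as [|z IH]; cbn [nsum]; [ring|]; rewrite Cmult_plus_distr_r, IH; f_equal.
      cbn [Nat.eqb]; apply wker_split; auto; lia. }
  assert (CS : forall t, T <= t <= 2 * T -> rcont S t).
  { intros t _; apply (rcont_nsum (fun k t => a k * Rcpow (INR k) (- (3%R, t)))%C); intros k.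
    apply rcont_mult; [apply rcont_const|].
    apply (rcont_vert (fun w => Rcpow (INR k) (- w))%C), cdiff_ccont.
    apply (cdiff_comp (Rcpow (INR k)) (fun w => - w)%C); [|apply cdiff_Rcpow].
    apply cdiff_ext_loc with (f := fun w => (- RtoC 1 * w)%C) (r := 1); [lra|intros; ring|].
    apply cdiff_mult; [apply cdiff_const|apply cdiff_id]. }
  assert (CL : forall t, T <= t <= 2 * T -> rcont (fun t => L (3, t)) t).
  { intros t Ht; apply rcont_vert, cdiff_ccont, HLd; lra. }
  assert (E2 : CI (fun t => L (3%R, t) * wx t)%C T (2 * T)
     = (CI (fun t => (L (3%R, t) + - RtoC 1 * S t) * wx t)%C T (2 * T) + CI (fun t => S t * wx t)%C T (2 * T))%C).
  { rewrite <- CI_plus; [apply CI_ext; [lra|]; intros; ring|lra| |].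
    - intros t Ht; apply rcont_mult; [|apply Cw]; apply rcont_plus; [apply CL; auto|].
      apply rcont_mult; [apply rcont_const|apply CS; auto].
    - intros t Ht; apply rcont_mult; [apply CS; auto|apply Cw]. }
  assert (B2 : Cmod (CI (fun t => (L (3%R, t) + - RtoC 1 * S t) * wx t)%C T (2 * T)) <= e).
  { eapply Rle_trans; [|apply HZ2].
    eapply Rle_trans.
    - apply (Cmod_CI_le_const _ _ _ (K / INR Z * (INR N ^ 3 * ker_sup h))); [lra| |].
      + intros t Ht; apply rcont_mult; [|apply Cw]; apply rcont_plus; [apply CL; auto|].
        apply rcont_mult; [apply rcont_const|apply CS; auto].
      + intros t Ht; rewrite Cmod_mult; apply Rmult_le_compat; try apply Cmod_ge_0.
        * replace (L (3%R, t) + - RtoC 1 * S t)%C with (L (3%R, t) - S t)%C by ring.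
          apply dirichlet_tail; auto; lia.
        * unfold wx, wk, wker; rewrite Cmod_mult, Cmod_Rcpow.
          apply Rmult_le_compat; [left; apply exp_pos|apply Cmod_ge_0|apply exp_ln_le_cube; lra|].
          apply ker_le_sup; auto; apply ker_width_bound; lra.
    - right; unfold A; field; apply Rgt_not_eq, lt_0_INR; lia. }
  pose proof (twisted_series n1 n2 Z H1 H2) as B3; fold x in B3.
  rewrite <- E1 in B3; unfold x in B3 at 1; rewrite diag_coef_ratio in B3 by lia.
  pose proof (twisted_shift x ltac:(lra)) as B1; fold wx in B1.
  change (fun t => (L (3, t) * wk x ((3 - sigma)%R, t))%C) with (fun t => (L (3, t) * wx t)%C) in B1.
  rewrite E2 in B1.
  set (I2 := CI (fun t => (L (3, t) + - RtoC 1 * S t) * wx t)%C T (2 * T)) in *.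
  set (I3 := CI (fun t => S t * wx t)%C T (2 * T)) in *.
  replace (twisted x - RtoC (ker_mass T W h) * dir_coef n1 n2)%C
    with ((twisted x - (I2 + I3)) + (I2 + (I3 - RtoC (ker_mass T W h) * dir_coef n1 n2)))%C by ring.
  eapply Rle_trans; [apply Cmod_triangle|].
  eapply Rle_trans; [apply Rplus_le_compat_l, Cmod_triangle|].
  assert (B3' : K * INR N ^ 3 * err * (2 * (1 - / INR (Datatypes.S Z))) <= 2 * K * INR N ^ 3 * err).
  { assert (0 < / INR (Datatypes.S Z)) by (apply Rinv_0_lt_compat, lt_0_INR; lia).
    replace (2 * K * INR N ^ 3 * err) with (K * INR N ^ 3 * err * 2) by ring.
    apply Rmult_le_compat_l; lra. }
  unfold moment_err; lra.
Qed.

(** Two evaluations are combined: the mean of L |R|^2 is the mass times the divisor form, and the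
    mean of |R|^2 is the mass times the energy, up to errors. The first mean is at most 2 [M] times
    the second, where positivity of the kernel on the line is used. *)
Lemma moment_bound (l : list (nat * C)) (M : R) : NoDup (map fst l) ->
  (forall p, In p l -> (1 <= fst p <= N)%nat) ->
  (forall t, T <= t <= 2 * T -> Cmod (L (sigma, t)) <= M) ->
  ker_mass T W h * Cmod (quad l dir_coef)
  <= 2 * M * ((ker_mass T W h + err * INR N) * energy l) + moment_err * INR N * energy l.
Proof.
  intros Hnd Hl HM; set (mass := ker_mass T W h).
  pose proof (INR_ge_1 N HN) as PN; pose proof (energy_pos l) as PE.
  assert (Pe : 0 <= err) by (apply ker_err_pos; auto).
  assert (Pm : 0 <= moment_err).
  { eapply Rle_trans; [apply Cmod_ge_0|apply (twisted_est 1 1); lia]. }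
  assert (PM : 0 <= M) by (eapply Rle_trans; [apply Cmod_ge_0|apply (HM T); lra]).
  assert (Hlen : INR (length l) <= INR N).
  { apply le_INR; rewrite <- (length_map fst l), <- (length_seq N 1).
    apply NoDup_incl_length; auto; intros n Hn; apply in_map_iff in Hn; destruct Hn as (p & <- & Hp).
    apply in_seq; specialize (Hl p Hp); lia. }
  assert (Cw : forall y t, rcont (fun t => wk y (0, t)) t).
  { intros; apply rcont_vert, cdiff_ccont, cdiff_wker. }
  assert (CLs : forall t, T <= t <= 2 * T -> rcont (fun t => L (sigma, t)) t).
  { intros t Ht; apply rcont_vert, cdiff_ccont, HLd; lra. }
  set (P := fun t => Cmod (lsumC (fun p => snd p * Rcpow (INR (fst p)) (- (0%R, t)))%C l) ^ 2 * ker_real T W h t).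
  assert (QP : forall t, quad l (fun n1 n2 => wk (INR n2 / INR n1)%R (0%R, t)) = RtoC (P t)).
  { intros t; unfold P; rewrite RtoC_mult, <- (ker_imag T W h) by auto.
    rewrite <- (quad_square l (fun n => Rcpow (INR n) (- (0%R, t)))).
    unfold quad; apply lsumC_ext; intros p Hp; apply lsumC_ext; intros q Hq.
    f_equal; unfold wk, wker; f_equal; unfold Rcpow.
    pose proof (INR_ge_1 (fst p) ltac:(apply Hl; auto)); pose proof (INR_ge_1 (fst q) ltac:(apply Hl; auto)).
    rewrite ln_div by lra.
    assert (Cc : forall z, Cconj (Cexp z) = Cexp (Cconj z)).
    { intros [u v]; unfold Cexp, Cconj; simpl; rewrite cos_neg, sin_neg; f_equal; ring. }
    rewrite Cc, <- Cexp_plus; f_equal; apply injective_projections; simpl; ring. }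
  assert (EJ : CI (fun t => L (sigma, t) * RtoC (P t))%C T (2 * T)
             = quad l (fun n1 n2 => twisted (INR n2 / INR n1))).
  { rewrite (CI_ext _ (fun t => lsumC (fun p => lsumC (fun q =>
        snd p * Cconj (snd q) * (L (sigma, t) * wk (INR (fst q) / INR (fst p))%R (0%R, t)))%C l) l)); [|lra|].
    - assert (RC : forall p q t, T <= t <= 2 * T -> rcont (fun t =>
         snd p * Cconj (snd q) * (L (sigma, t) * wk (INR (fst q) / INR (fst p))%R (0%R, t)))%C t).
      { intros; apply rcont_mult; [apply rcont_const|]; apply rcont_mult; auto. }
      rewrite (CI_lsumC (fun p t => lsumC (fun q => snd p * Cconj (snd q)
          * (L (sigma, t) * wk (INR (fst q) / INR (fst p))%R (0%R, t)))%C l)); [|lra|].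
      + unfold quad; apply lsumC_ext; intros p Hp.
        rewrite (CI_lsumC (fun q t => snd p * Cconj (snd q)
          * (L (sigma, t) * wk (INR (fst q) / INR (fst p))%R (0%R, t)))%C); [|lra|].
        * apply lsumC_ext; intros q Hq; apply CI_scal; [lra|].
          intros t Ht; apply rcont_mult; auto.
        * intros q Hq t Ht; apply RC; auto.
      + intros p Hp t Ht; apply (rcont_lsumC (fun q t => snd p * Cconj (snd q)
          * (L (sigma, t) * wk (INR (fst q) / INR (fst p))%R (0%R, t)))%C); intros; apply RC; auto.
    - intros t _; rewrite <- QP; unfold quad; rewrite <- lsumC_scal; apply lsumC_ext; intros p _.
      rewrite <- lsumC_scal; apply lsumC_ext; intros q _; ring. }
  assert (RP : forall t, rcont (fun t => RtoC (P t)) t).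
  { intros t; assert (Q : rcont (fun t => quad l (fun n1 n2 => wk (INR n2 / INR n1)%R (0%R, t))) t).
    { unfold quad; apply (rcont_lsumC (fun p t => lsumC (fun q =>
         snd p * Cconj (snd q) * wk (INR (fst q) / INR (fst p))%R (0%R, t))%C l)); intros p _.
      apply (rcont_lsumC (fun q t => snd p * Cconj (snd q) * wk (INR (fst q) / INR (fst p))%R (0%R, t))%C).
      intros q _; apply rcont_mult; [apply rcont_const|apply Cw]. }
    destruct Q as [Q1 Q2]; split; revert Q1 Q2; [intros Q _|intros _ Q]; revert Q;
      apply continuous_ext; intros s; rewrite QP; auto. }
  assert (EI : CI (fun t => RtoC (P t)) T (2 * T) = quad l (fun n1 n2 => kint (INR n2 / INR n1) 0)).
  { rewrite (CI_ext _ (fun t => lsumC (fun p => lsumC (fun q =>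
        snd p * Cconj (snd q) * wk (INR (fst q) / INR (fst p))%R (0%R, t))%C l) l)); [|lra|].
    - assert (RC : forall p q t, rcont (fun t =>
         snd p * Cconj (snd q) * wk (INR (fst q) / INR (fst p))%R (0%R, t))%C t).
      { intros; apply rcont_mult; [apply rcont_const|auto]. }
      rewrite (CI_lsumC (fun p t => lsumC (fun q => snd p * Cconj (snd q)
          * wk (INR (fst q) / INR (fst p))%R (0%R, t))%C l)); [|lra|].
      + unfold quad; apply lsumC_ext; intros p Hp.
        rewrite (CI_lsumC (fun q t => snd p * Cconj (snd q)
          * wk (INR (fst q) / INR (fst p))%R (0%R, t))%C); [|lra|].
        * apply lsumC_ext; intros q Hq; apply CI_scal; [lra|]; intros t Ht; apply Cw.
        * intros q Hq t Ht; apply RC.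
      + intros p Hp t Ht; apply (rcont_lsumC (fun q t => snd p * Cconj (snd q)
          * wk (INR (fst q) / INR (fst p))%R (0%R, t))%C); intros; apply RC.
    - intros t _; rewrite <- QP; reflexivity. }
  assert (IP : ex_RInt P T (2 * T)).
  { apply (ex_RInt_continuous (V := R_CompleteNormedModule)); intros t _; apply (RP t). }
  assert (B1 := quad_diff_le l (fun n1 n2 => twisted (INR n2 / INR n1)) dir_coef mass moment_err Pm
    (fun p q Hp Hq => twisted_est (fst p) (fst q) (Hl p Hp) (Hl q Hq))).
  assert (B2 : Cmod (quad l (fun n1 n2 => kint (INR n2 / INR n1) 0)
     - RtoC mass * quad l (fun n1 n2 => if (n1 =? n2)%nat then RtoC 1 else RtoC 0))
     <= err * INR (length l) * energy l).
  { apply quad_diff_le; auto; intros p q Hp Hq; pose proof (Hl p Hp); pose proof (Hl q Hq).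
    pose proof (INR_ge_1 (fst p) ltac:(lia)); pose proof (INR_ge_1 (fst q) ltac:(lia)).
    destruct (Nat.eqb_spec (fst p) (fst q)) as [E|E].
    - rewrite E; replace (INR (fst q) / INR (fst q)) with 1 by (field; lra).
      unfold kint; rewrite ker_int_1_0 by auto; fold mass.
      replace (RtoC mass - RtoC mass * RtoC 1)%C with (RtoC 0) by ring; rewrite Cmod_0; auto.
    - replace (kint (INR (fst q) / INR (fst p)) 0 - RtoC mass * RtoC 0)%C
        with (kint (INR (fst q) / INR (fst p))%R 0%R) by ring.
      replace err with (exp (0 * ln (INR (fst q) / INR (fst p))) * err)
        by (rewrite Rmult_0_l, exp_0; ring).
      apply ker_int_small; auto; [|lra].
      apply abs_ln_ratio; try lia; apply le_INR; lia. }
  rewrite quad_delta in B2 by auto; rewrite <- EI in B2; rewrite <- EJ in B1.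
  assert (I1 : RInt P T (2 * T) <= mass * energy l + err * INR (length l) * energy l).
  { pose proof (re_le_Cmod (CI (fun t => RtoC (P t)) T (2 * T) - RtoC mass * RtoC (energy l))) as Q.
    assert (Q' := Rle_trans _ _ _ Q B2); apply Rabs_le_between in Q'; simpl in Q'.
    change (RInt (fun t => P t) T (2 * T)) with (RInt P T (2 * T)) in Q'; lra. }
  assert (I2 : Cmod (CI (fun t => L (sigma, t) * RtoC (P t))%C T (2 * T)) <= 2 * (M * RInt P T (2 * T))).
  { replace (M * RInt P T (2 * T)) with (RInt (fun t => M * P t) T (2 * T))
      by exact (RInt_scal (V := R_CompleteNormedModule) P T (2 * T) M IP).
    apply Cmod_CI_le; [lra| | |].
    - intros t Ht; apply rcont_mult; auto.
    - apply (ex_RInt_scal (V := R_NormedModule) P T (2 * T) M IP).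
    - intros t Ht; rewrite Cmod_mult, Cmod_R.
      assert (0 <= P t).
      { unfold P; apply Rmult_le_pos; [apply pow2_ge_0|left; apply exp_pos]. }
      rewrite Rabs_pos_eq by auto; apply Rmult_le_compat_r; auto. }
  assert (PS : 0 <= mass) by (pose proof (ker_mass_ge T W h Hh HW HT); unfold mass; lra).
  assert (F1 : err * INR (length l) * energy l <= err * INR N * energy l).
  { apply Rmult_le_compat_r; auto; apply Rmult_le_compat_l; auto. }
  assert (F2 : moment_err * INR (length l) * energy l <= moment_err * INR N * energy l).
  { apply Rmult_le_compat_r; auto; apply Rmult_le_compat_l; auto. }
  set (J := CI (fun t => L (sigma, t) * RtoC (P t))%C T (2 * T)) in *.
  pose proof (Cmod_triangle_inv (RtoC mass * quad l dir_coef) J) as Tri.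
  rewrite Cmod_minus_sym in Tri; rewrite Cmod_mult, Cmod_R, (Rabs_pos_eq mass) in Tri by auto.
  assert (2 * (M * RInt P T (2 * T)) <= 2 * M * ((mass + err * INR N) * energy l)).
  { rewrite <- Rmult_assoc; apply Rmult_le_compat_l; lra. }
  lra.
Qed.

End Moment.

(** * Sizes of the parameters: growth of L against decay of the kernel *)

Lemma pow_exp_small (d : nat) (c e : R) : 0 < c -> 0 < e ->
  exists X0, 1 <= X0 /\ forall X, X0 <= X -> X ^ d * exp (- (c * X)) <= e.
Proof.
  intros Hc He; set (k := (INR (S d) / c) ^ S d).
  assert (Pd : 0 < INR (S d)) by (apply lt_0_INR; lia).
  assert (Pk : 0 < k) by (apply pow_lt, Rdiv_lt_0_compat; auto).
  exists (1 + k / e); split.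
  { assert (0 < k / e) by now apply Rdiv_lt_0_compat. lra. }
  intros X HX.
  assert (Pke : 0 < k / e) by now apply Rdiv_lt_0_compat.
  assert (PX : 0 < X) by lra.
  assert (E1 : (c * X / INR (S d)) ^ S d <= exp (c * X)).
  { replace (c * X) with (INR (S d) * (c * X / INR (S d))) at 2 by (field; lra).
    rewrite <- (ln_exp (c * X / INR (S d))) at 2.
    change (exp (INR (S d) * ln (exp (c * X / INR (S d)))))
      with (Rpower (exp (c * X / INR (S d))) (INR (S d))).
    rewrite Rpower_pow by apply exp_pos.
    apply pow_incr; split.
    - left; apply Rdiv_lt_0_compat; auto; nra.
    - pose proof (exp_ineq1_le (c * X / INR (S d))); lra. }
  assert (E2 : X ^ S d <= k * exp (c * X)).
  { apply Rle_trans with (k * (c * X / INR (S d)) ^ S d).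
    - right; unfold k; rewrite <- Rpow_mult_distr; f_equal; field; lra.
    - apply Rmult_le_compat_l; lra. }
  rewrite exp_Ropp; pose proof (exp_pos (c * X)) as Pe.
  apply Rmult_le_reg_r with (exp (c * X)); auto.
  rewrite Rmult_assoc, Rinv_l, Rmult_1_r by lra.
  apply Rmult_le_reg_r with X; auto.
  apply Rle_trans with (k * exp (c * X)); [simpl in E2; lra|].
  replace (e * exp (c * X) * X) with (e * X * exp (c * X)) by ring.
  apply Rmult_le_compat_r; [lra|].
  apply Rle_trans with (e * (k / e)); [right; field; lra|]; apply Rmult_le_compat_l; lra.
Qed.

Lemma L_cdiff (L : C -> C) : continuation L -> forall x y, y <> 0 -> cdiff L (x, y).
Proof.
  intros (k0 & F & HF & _ & HE) x y Hy.
  assert (NZ : forall w : C, Im w <> 0 -> (w - RtoC 1)%C <> RtoC 0).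
  { intros w Hw E; apply Hw; replace (Im w) with (Im (w - RtoC 1)); [rewrite E; auto|].
    destruct w; simpl; ring. }
  apply cdiff_ext_loc with (f := fun w => (F w * / (w - RtoC 1) ^ k0)%C) (r := Rabs y).
  - now apply Rabs_pos_lt.
  - intros w Hw.
    assert (Hi : Im w <> 0).
    { intros E; pose proof (im_le_Cmod (w - (x, y))) as Q.
      replace (Im (w - (x, y))) with (- y) in Q.
      - rewrite Rabs_Ropp in Q; lra.
      - destruct w as [u v]; simpl in *; rewrite E; ring. }
    rewrite HE.
    + field; apply Cpow_nz; auto.
    + intros E; apply Hi; rewrite E; auto.
  - apply cdiff_mult; [apply ex_derive_cdiff, HF|].
    apply (cdiff_comp Cinv (fun w => (w - RtoC 1) ^ k0)%C).
    + apply (cdiff_comp (fun w => w ^ k0)%C (fun w => w - RtoC 1)%C); [|apply cdiff_pow].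
      apply (cdiff_plus (fun w => w) (fun _ => - RtoC 1)%C); [apply cdiff_id|apply cdiff_const].
    + apply cdiff_inv, Cpow_nz, NZ; auto.
Qed.

(** At these heights [|s - 1| >= 1], so [|L|] is at most the modulus of the entire function. The
    order is rounded up to a natural number to allow ordinary powers. *)
Lemma L_growth (L : C -> C) : continuation L -> exists (rho : nat) (T0 : R), 3 <= T0 /\
  forall T u y, T0 <= T -> 0 <= u <= 3 -> T <= y <= 2 * T -> Cmod (L (u, y)) <= exp ((3 * T) ^ rho).
Proof.
  intros (k0 & F & _ & (ro & r & HF) & HE).
  destruct (INR_unbounded ro) as (rho & Hrho); exists rho, (Rmax 3 (r + 1)); split; [apply Rmax_l|].
  intros T u y HT Hu Hy.
  assert (H3 : 3 <= T) by (eapply Rle_trans; [apply Rmax_l|apply HT]).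
  assert (Hr : r < T) by (assert (r + 1 <= T) by (eapply Rle_trans; [apply Rmax_r|apply HT]); lra).
  assert (Im1 : y <= Cmod ((u, y) - RtoC 1)).
  { eapply Rle_trans; [|apply im_le_Cmod]; simpl; eapply Rle_trans; [|apply Rle_abs]; lra. }
  assert (Im2 : y <= Cmod (u, y)).
  { eapply Rle_trans; [|apply im_le_Cmod]; simpl; apply Rle_abs. }
  assert (Im3 : Cmod (u, y) <= 3 * T).
  { eapply Rle_trans; [apply Cmod_le_abs|]; simpl; rewrite !Rabs_pos_eq; lra. }
  assert (Ne : (u, y) <> RtoC 1) by (intros E; injection E; intros; lra).
  specialize (HE _ Ne); specialize (HF (u, y) ltac:(lra)).
  apply Rle_trans with (Cmod (F (u, y))).
  - rewrite HE, Cmod_mult, Cmod_pow.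
    rewrite <- (Rmult_1_l (Cmod (L (u, y)))) at 1; apply Rmult_le_compat_r; [apply Cmod_ge_0|].
    apply pow_R1_Rle; lra.
  - eapply Rle_trans; [apply HF|]; apply exp_le.
    rewrite <- Rpower_pow by lra; unfold Rpower; apply exp_le.
    assert (0 <= ln (Cmod (u, y))) by (rewrite <- ln_1; apply ln_le; lra).
    assert (ln (Cmod (u, y)) <= ln (3 * T)) by (apply ln_le; lra).
    pose proof (pos_INR rho); nra.
Qed.

(** Here T = X^q and W = X^(q-1). On an edge L is at most exp (3^rho X^(q rho)) while the kernel is
    at most exp (- (X/2)^n / 2), so n > q rho decides; one further degree leaves room for - X. *)
Lemma edge_beats_growth (q rho n : nat) (X : R) : (q * rho + 2 <= n)%nat ->
  2 ^ S n * (3 ^ rho + 1) <= X ->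
  3 ^ rho * X ^ (q * rho) - (X / 2) ^ n / 2 <= - X.
Proof.
  intros Hn HX.
  assert (P2 : 1 <= 2 ^ S n) by (apply pow_R1_Rle; lra).
  assert (P3 : 1 <= 3 ^ rho) by (apply pow_R1_Rle; lra).
  assert (PX : 1 <= X) by nra.
  set (d := (q * rho)%nat) in *.
  assert (PXd : 1 <= X ^ d) by (apply pow_R1_Rle; auto).
  replace ((X / 2) ^ n / 2) with (X ^ n / 2 ^ S n).
  2: { unfold Rdiv; rewrite Rpow_mult_distr, pow_inv; simpl; field; apply pow_nonzero; lra. }
  replace n with (d + 2 + (n - d - 2))%nat at 1 by lia; rewrite !pow_add.
  assert (PXe : 1 <= X ^ (n - d - 2)) by (apply pow_R1_Rle; auto).
  assert (Q : (3 ^ rho + 1) * (X ^ d * X) <= X ^ d * X ^ 2 * X ^ (n - d - 2) / 2 ^ S n).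
  { apply Rmult_le_reg_r with (2 ^ S n); [lra|].
    unfold Rdiv; rewrite (Rmult_assoc _ (/ _)), Rinv_l, Rmult_1_r by lra.
    apply Rle_trans with (X ^ d * X ^ 2 * 1).
    - replace ((3 ^ rho + 1) * (X ^ d * X) * 2 ^ S n) with (X ^ d * X * (2 ^ S n * (3 ^ rho + 1))) by ring.
      replace (X ^ d * X ^ 2 * 1) with (X ^ d * X * X) by ring.
      apply Rmult_le_compat_l; auto; nra.
    - apply Rmult_le_compat_l; auto; apply Rmult_le_pos; nra. }
  assert (3 ^ rho * X ^ d <= 3 ^ rho * (X ^ d * X)) by (apply Rmult_le_compat_l; nra).
  assert (X <= X ^ d * X) by nra.
  lra.
Qed.

(** With W = X^(q-1) and N <= X^(q-2) the ratio W / N is at least X. Both sources of error are then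
    exponentially small in X, while everything multiplying them is a power of T = X^q. *)
Lemma moment_err_small (q rho h : nat) (K : R) : (3 <= q)%nat -> (q * rho + 2 <= 4 * h)%nat -> 0 <= K ->
  exists X0, 3 <= X0 /\ forall X N, X0 <= X -> (1 <= N)%nat -> INR N <= X ^ (q - 2) ->
    3 <= ker_width (X ^ (q - 1)) h /\
    ker_err (X ^ q) (X ^ (q - 1)) h (INR N) * INR N <= 1/8 /\
    moment_err (X ^ q) (X ^ (q - 1)) h K (exp ((3 * X ^ q) ^ rho)) N * INR N <= 1/8.
Proof.
  intros Hq Hn HK; set (n := (4 * h)%nat) in *.
  assert (Pn : 1 <= INR n) by (apply INR_ge_1; lia).
  set (sp := ker_sup h); assert (Psp : 1 <= sp).
  { unfold sp, ker_sup; rewrite <- exp_0; apply exp_le, pow_le; lra. }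
  pose proof (exp_pos (3/2)) as P32.
  (* All constants of the two estimates are collected here; [exp (3/2)] comes from the 3 in
     [ker_width - 3], as [3 / (2 N) <= 3/2]. *)
  set (B := 16 * (12 + (2 * K + 1) * (8 + 2 * sp * exp (3/2)))).
  assert (PB : 0 < B).
  { unfold B; assert (0 < sp * exp (3/2)) by (apply Rmult_lt_0_compat; lra).
    assert (0 <= (2 * K + 1) * (8 + 2 * sp * exp (3/2))) by (apply Rmult_le_pos; nra); lra. }
  (* T^5 = X^(5q) is the largest power met: N^3 from the twist, T from [ker_err], and the final
     factor N. *)
  destruct (pow_exp_small (5 * q) 1 (/ B)) as (X1 & HX1 & G1); [lra|now apply Rinv_0_lt_compat|].
  destruct (pow_exp_small (5 * q) (/ (6 * INR n)) (/ B)) as (X2 & HX2 & G2);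
    [apply Rinv_0_lt_compat; lra|now apply Rinv_0_lt_compat|].
  exists (Rmax 3 (Rmax (Rmax X1 X2) (Rmax (9 * INR n) (2 ^ S n * (3 ^ rho + 1))))).
  split; [apply Rmax_l|]; intros X N HX HN HNX.
  assert (H3 : 3 <= X) by (eapply Rle_trans; [apply Rmax_l|apply HX]).
  assert (HX' := Rle_trans _ _ _ (Rmax_r _ _) HX).
  assert (K1 : X1 <= X) by (eapply Rle_trans; [|apply HX']; eapply Rle_trans; [|apply Rmax_l]; apply Rmax_l).
  assert (K2 : X2 <= X) by (eapply Rle_trans; [|apply HX']; eapply Rle_trans; [|apply Rmax_l]; apply Rmax_r).
  assert (K3 : 9 * INR n <= X) by (eapply Rle_trans; [|apply HX']; eapply Rle_trans; [|apply Rmax_r]; apply Rmax_l).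
  assert (K4 : 2 ^ S n * (3 ^ rho + 1) <= X) by (eapply Rle_trans; [|apply HX']; eapply Rle_trans; [|apply Rmax_r]; apply Rmax_r).
  clear HX HX'; specialize (G1 X K1); specialize (G2 X K2).
  set (T := X ^ q); set (W := X ^ (q - 1)).
  assert (PN : 1 <= INR N) by now apply INR_ge_1.
  assert (Xq2 : 1 <= X ^ (q - 2)) by (apply pow_R1_Rle; lra).
  assert (EW : W = X * X ^ (q - 2)) by (unfold W; replace (q - 1)%nat with (S (q - 2)) by lia; auto).
  assert (ET : T = X * W) by (unfold T, W; replace q with (S (q - 1)) at 1 by lia; auto).
  assert (HW : X <= W) by (rewrite EW; nra).
  assert (HT : 3 * W <= T) by (rewrite ET; nra).
  assert (NT : INR N <= T) by nra.
  assert (Wn : W / INR n <= W).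
  { apply Rmult_le_reg_r with (INR n); [lra|]; unfold Rdiv; rewrite Rmult_assoc, Rinv_l by lra; nra. }
  assert (Wd : ker_width W h = W / INR n / 3).
  { unfold ker_width; fold n; field; lra. }
  assert (Wd3 : 3 <= ker_width W h).
  { rewrite Wd; apply Rmult_le_reg_r with (3 * INR n); [lra|].
    replace (W / INR n / 3 * (3 * INR n)) with W by (field; lra); lra. }
  split; auto.
  set (g := exp (- X)); set (f := exp (- (/ (6 * INR n) * X))).
  rewrite Rmult_1_l in G1; fold g in G1; fold f in G2.
  replace (X ^ (5 * q)) with (T ^ 5) in G1, G2 by (unfold T; rewrite <- pow_mult; f_equal; lia).
  assert (Pg : 0 < g) by apply exp_pos; assert (Pf : 0 < f) by apply exp_pos.
  assert (BE : exp ((3 * T) ^ rho) * ker_edge T W h <= g).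
  { unfold ker_edge; rewrite <- exp_plus; apply exp_le; fold n.
    replace (T / (2 * W)) with (X / 2) by (rewrite ET; field; nra).
    pose proof (edge_beats_growth q rho n X Hn K4) as Q.
    replace ((3 * T) ^ rho) with (3 ^ rho * X ^ (q * rho)); [lra|].
    unfold T; rewrite Rpow_mult_distr, <- pow_mult; auto. }
  assert (EE : ker_edge T W h <= g).
  { eapply Rle_trans; [|apply BE]; rewrite <- (Rmult_1_l (ker_edge T W h)) at 1.
    apply Rmult_le_compat_r; [left; apply exp_pos|]; rewrite <- exp_0; apply exp_le, pow_le; nra. }
  assert (FE : exp (- ((ker_width W h - 3) / (2 * INR N))) <= exp (3/2) * f).
  { unfold f; rewrite <- exp_plus; apply exp_le; rewrite Wd.
    assert (A1 : 3 / (2 * INR N) <= 3/2).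
    { unfold Rdiv; apply Rmult_le_compat_l; [lra|]; apply Rinv_le_contravar; lra. }
    assert (A2 : / (6 * INR n) * X <= W / INR n / 3 / (2 * INR N)).
    { replace (W / INR n / 3 / (2 * INR N)) with (/ (6 * INR n) * (W / INR N)) by (field; lra).
      apply Rmult_le_compat_l; [left; apply Rinv_0_lt_compat; lra|].
      apply Rmult_le_reg_r with (INR N); [lra|]; unfold Rdiv; rewrite Rmult_assoc, Rinv_l by lra.
      rewrite EW; nra. }
    replace ((W / INR n / 3 - 3) / (2 * INR N)) with (W / INR n / 3 / (2 * INR N) - 3 / (2 * INR N)) by (field; lra).
    lra. }
  assert (Err : ker_err T W h (INR N) <= T * (8 * g + 2 * sp * exp (3/2) * f)).
  { unfold ker_err; fold sp.
    assert (A1 : 4 * (ker_width W h + 3) * ker_edge T W h <= 8 * T * g).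
    { apply Rmult_le_compat; auto; [lra|left; apply exp_pos|rewrite Wd; lra]. }
    assert (A2 : 2 * T * sp * exp (- ((ker_width W h - 3) / (2 * INR N))) <= 2 * T * sp * (exp (3/2) * f)).
    { apply Rmult_le_compat_l; auto; apply Rmult_le_pos; lra. }
    lra. }
  assert (Err0 : 0 <= ker_err T W h (INR N)).
  { apply ker_err_pos; [lia|lra|lra]. }
  assert (PT : 1 <= T) by lra.
  assert (T5 : T ^ 2 <= T ^ 5).
  { replace (T ^ 5) with (T ^ 2 * T ^ 3) by ring.
    assert (1 <= T ^ 3) by (apply pow_R1_Rle; lra); assert (0 <= T ^ 2) by apply pow2_ge_0; nra. }
  set (c2 := 8 + 2 * sp * exp (3/2)).
  assert (Pc2 : 8 <= c2) by (unfold c2; nra).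
  set (w := T ^ 5 * (g + f)).
  assert (Hw : w * B <= 2).
  { unfold w; assert (T ^ 5 * g * B <= 1).
    { replace 1 with (/ B * B) by (field; lra); apply Rmult_le_compat_r; lra. }
    assert (T ^ 5 * f * B <= 1).
    { replace 1 with (/ B * B) by (field; lra); apply Rmult_le_compat_r; lra. }
    lra. }
  assert (Pw : 0 <= w) by (unfold w; apply Rmult_le_pos; [apply pow_le|]; lra).
  assert (Err2 : ker_err T W h (INR N) <= T * (c2 * (g + f))).
  { eapply Rle_trans; [apply Err|]; apply Rmult_le_compat_l; [lra|]; unfold c2.
    assert (0 <= 2 * sp * exp (3/2)) by nra; nra. }
  assert (PKw : 0 <= K * c2 * w) by (apply Rmult_le_pos; auto; apply Rmult_le_pos; lra).
  assert (Pcw : 0 <= c2 * w) by (apply Rmult_le_pos; lra).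
  split.
  - apply Rle_trans with (T * (c2 * (g + f)) * T).
    { apply Rmult_le_compat; auto; lra. }
    apply Rle_trans with (c2 * w).
    { unfold w; replace (T * (c2 * (g + f)) * T) with (c2 * (T ^ 2 * (g + f))) by ring.
      apply Rmult_le_compat_l; [lra|]; apply Rmult_le_compat_r; lra. }
    assert (16 * (12 + c2) * w <= 2) by (unfold B in Hw; fold c2 in Hw; lra). lra.
  - unfold moment_err; fold T W.
    assert (N3 : INR N ^ 3 <= T ^ 3) by (apply pow_incr; lra).
    assert (PN3 : 0 <= INR N ^ 3) by (apply pow_le; lra).
    apply Rle_trans with ((12 * (T ^ 3 * g) + 2 * K * T ^ 3 * (T * (c2 * (g + f)))) * T).
    { apply Rmult_le_compat; auto; [|lra|].
      - apply Rplus_le_le_0_compat; [|apply Rmult_le_pos; auto; apply Rmult_le_pos; lra].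
        apply Rmult_le_pos; [lra|]; apply Rmult_le_pos; [left; apply exp_pos|].
        apply Rmult_le_pos; auto; left; apply exp_pos.
      - apply Rplus_le_compat.
        + apply Rmult_le_compat_l; [lra|].
          replace (exp ((3 * T) ^ rho) * (INR N ^ 3 * ker_edge T W h))
            with (INR N ^ 3 * (exp ((3 * T) ^ rho) * ker_edge T W h)) by ring.
          apply Rmult_le_compat; auto.
          apply Rmult_le_pos; left; apply exp_pos.
        + apply Rmult_le_compat; auto; [apply Rmult_le_pos; lra|].
          apply Rmult_le_compat_l; lra. }
    replace ((12 * (T ^ 3 * g) + 2 * K * T ^ 3 * (T * (c2 * (g + f)))) * T)
      with (12 * (T ^ 4 * g) + 2 * K * c2 * w) by (unfold w; ring).
    assert (T ^ 4 * g <= w).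
    { unfold w; apply Rmult_le_compat; try lra; [apply pow_le; lra|].
      replace (T ^ 5) with (T ^ 4 * T) by ring; assert (0 <= T ^ 4) by (apply pow_le; lra); nra. }
    assert (16 * (12 + (2 * K + 1) * c2) * w <= 2) by (unfold B in Hw; fold c2 in Hw; lra).
    lra.
Qed.

(** The error in [moment_bound] is a small multiple of the energy; the assumption that the form is
    at least the energy lets it be absorbed on the left. *)
Lemma resonance (L : C -> C) (a : nat -> C) (m : nat) (alpha : nat -> nat -> C) (sigma : R) (q : nat) :
  selberg_class_poly L a m alpha -> 0 <= sigma <= 3 -> (3 <= q)%nat ->
  exists T0, 1 < T0 /\ forall T N l M, T0 <= T -> (1 <= N)%nat ->
    INR N <= Rpower T (/ INR q) ^ (q - 2) ->
    NoDup (map fst l) -> (forall p, In p l -> (1 <= fst p <= N)%nat) ->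
    (forall t, T <= t <= 2 * T -> Cmod (L (sigma, t)) <= M) ->
    energy l <= Cmod (quad l (dir_coef a sigma)) ->
    Cmod (quad l (dir_coef a sigma)) <= 4 * M * energy l.
Proof.
  intros HL Hs Hq.
  destruct (scp_ramanujan _ _ _ _ HL 1 ltac:(lra)) as (K & HK).
  destruct (L_growth L (scp_continuation _ _ _ _ HL)) as (rho & T1 & HT1 & HG).
  set (h := (q * rho + 2)%nat).
  destruct (moment_err_small q rho h (Rabs K) Hq ltac:(unfold h; lia) (Rabs_pos K)) as (X0 & HX0 & HX).
  exists (Rmax T1 (X0 ^ q)); split.
  { eapply Rlt_le_trans; [|apply Rmax_l]; lra. }
  intros T N l M HT HN HNX Hnd Hl HM HE.
  assert (HT1' : T1 <= T) by (eapply Rle_trans; [apply Rmax_l|apply HT]).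
  assert (HT2 : X0 ^ q <= T) by (eapply Rle_trans; [apply Rmax_r|apply HT]).
  assert (Pq : 0 < INR q) by (apply lt_0_INR; lia).
  set (X := Rpower T (/ INR q)) in *.
  assert (EX : X ^ q = T).
  { unfold X; rewrite <- Rpower_pow by apply exp_pos.
    rewrite Rpower_mult, Rinv_l, Rpower_1 by lra; auto. }
  assert (HX' : X0 <= X).
  { apply Rnot_lt_le; intros Q.
    assert (X ^ q < X0 ^ q); [|lra].
    rewrite <- !Rpower_pow by (try apply exp_pos; lra).
    apply Rlt_Rpower_l; auto; split; auto; apply exp_pos. }
  destruct (HX X N HX' HN HNX) as (W1 & W2 & W3).
  set (W := X ^ (q - 1)) in *.
  assert (HW : 1 <= W) by (apply pow_R1_Rle; lra).
  assert (HTW : 2 * W <= T).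
  { rewrite <- EX; replace (X ^ q) with (X * W); [nra|].
    unfold W; replace q with (S (q - 1)) at 2 by lia; reflexivity. }
  rewrite EX in *.
  pose proof (moment_bound T W h L a sigma (Rabs K) (exp ((3 * T) ^ rho)) N ltac:(unfold h; lia) HW HTW) as MB.
  assert (MB' := MB ltac:(intros x y Hy; apply L_cdiff; [apply HL|lra])
    ltac:(intros u Hu; split; apply HG; lra) (scp_dirichlet _ _ _ _ HL) (Rabs_pos K)); clear MB.
  assert (HKa : forall k, (1 <= k)%nat -> Cmod (a k) <= Rabs K * INR k).
  { intros k Hk; eapply Rle_trans; [apply HK; auto|].
    rewrite Rpower_1 by (apply lt_0_INR; lia).
    apply Rmult_le_compat_r; [apply pos_INR|apply Rle_abs]. }
  specialize (MB' HKa Hs HN W1 l M Hnd Hl HM).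
  assert (PM : 0 <= M) by (eapply Rle_trans; [apply Cmod_ge_0|apply (HM T); lra]).
  pose proof (energy_pos l) as PE.
  pose proof (ker_mass_ge T W h ltac:(unfold h; lia) HW HTW) as Pm.
  set (D := Cmod (quad l (dir_coef a sigma))) in *; set (ms := ker_mass T W h) in *.
  assert (A1 : 2 * M * ((ms + ker_err T W h (INR N) * INR N) * energy l) <= 2 * M * ((ms + ms / 4) * energy l)).
  { apply Rmult_le_compat_l; [lra|]; apply Rmult_le_compat_r; lra. }
  assert (A2 : moment_err T W h (Rabs K) (exp ((3 * T) ^ rho)) N * INR N * energy l <= ms / 4 * energy l).
  { apply Rmult_le_compat_r; lra. }
  apply Rmult_le_reg_l with (ms * (3 / 4)); [lra|].
  assert (ms / 4 * energy l <= ms / 4 * D) by (apply Rmult_le_compat_l; lra).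
  assert (0 <= ms * (M * energy l)) by (apply Rmult_le_pos; [lra|]; apply Rmult_le_pos; auto).
  lra.
Qed.

(** * The resonator *)

Lemma lsumC_app {A : Type} (f : A -> C) (l l' : list A) :
  lsumC f (l ++ l') = (lsumC f l + lsumC f l')%C.
Proof. induction l as [|x l IH]; simpl; [ring|rewrite IH; ring]. Qed.

Lemma lsumC_map {A B : Type} (f : B -> C) (g : A -> B) (l : list A) :
  lsumC f (map g l) = lsumC (fun x => f (g x)) l.
Proof. induction l as [|x l IH]; simpl; auto; rewrite IH; auto. Qed.

Lemma lsumC_plus {A : Type} (f g : A -> C) (l : list A) :
  lsumC (fun x => f x + g x)%C l = (lsumC f l + lsumC g l)%C.
Proof. induction l as [|x l IH]; simpl; [ring|rewrite IH; ring]. Qed.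

Lemma lsumC_filter {A : Type} (f : A -> C) (P : A -> bool) (l : list A) :
  lsumC f (filter P l) = lsumC (fun x => if P x then f x else RtoC 0) l.
Proof. induction l as [|x l IH]; simpl; auto; destruct (P x); simpl; rewrite IH; ring. Qed.

Lemma lsumR_app {A : Type} (f : A -> R) (l l' : list A) : lsumR f (l ++ l') = lsumR f l + lsumR f l'.
Proof. induction l as [|x l IH]; simpl; [ring|rewrite IH; ring]. Qed.

Lemma lsumR_map {A B : Type} (f : B -> R) (g : A -> B) (l : list A) :
  lsumR f (map g l) = lsumR (fun x => f (g x)) l.
Proof. induction l as [|x l IH]; simpl; auto; rewrite IH; auto. Qed.

(** The expansion of the product of the 1 + r(p) over [ps]: all squarefree products of these primes
    with their coefficients. *)
Fixpoint reson (r : nat -> C) (ps : list nat) : list (nat * C) :=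
  match ps with
  | nil => (1%nat, RtoC 1) :: nil
  | p :: ps' => reson r ps' ++ map (fun x => ((p * fst x)%nat, (r p * snd x)%C)) (reson r ps')
  end.

Lemma reson_pos (r : nat -> C) (ps : list nat) (x : nat * C) :
  (forall p, In p ps -> is_prime p) -> In x (reson r ps) -> (1 <= fst x)%nat.
Proof.
  revert x; induction ps as [|p ps IH]; intros x Hp; simpl.
  - intros [<-|[]]; simpl; lia.
  - intros H; apply in_app_or in H; destruct H as [H|H].
    + apply IH; auto; intros; apply Hp; simpl; auto.
    + apply in_map_iff in H; destruct H as (y & <- & Hy); simpl.
      assert (1 <= fst y)%nat by (apply IH; auto; intros; apply Hp; simpl; auto).
      pose proof (is_prime_ge_2 p (Hp p (or_introl eq_refl))); nia.
Qed.

Lemma reson_coprime (r : nat -> C) (ps : list nat) (q : nat) (x : nat * C) :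
  (forall p, In p ps -> is_prime p) -> is_prime q -> ~ In q ps -> In x (reson r ps) ->
  ~ Nat.divide q (fst x).
Proof.
  revert x; induction ps as [|p ps IH]; intros x Hp Hq Nq; simpl.
  - intros [<-|[]]; simpl; now apply is_prime_ndivide_1.
  - intros H; apply in_app_or in H; destruct H as [H|H].
    + apply IH; auto; [intros; apply Hp|intros K; apply Nq]; simpl; auto.
    + apply in_map_iff in H; destruct H as (y & <- & Hy); simpl; intros D.
      apply is_prime_mult in D; auto; destruct D as [D|D].
      * apply is_prime_divide_eq in D; auto; [apply Nq; simpl; auto|apply Hp; simpl; auto].
      * revert D; apply IH; auto; [intros; apply Hp|intros K; apply Nq]; simpl; auto.
Qed.

Lemma reson_NoDup (r : nat -> C) (ps : list nat) :
  (forall p, In p ps -> is_prime p) -> NoDup ps -> NoDup (map fst (reson r ps)).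
Proof.
  induction ps as [|p ps IH]; intros Hp Hn; simpl.
  - constructor; auto; constructor.
  - inversion Hn as [|? ? N1 N2]; subst.
    assert (Hp' : forall p, In p ps -> is_prime p) by (intros; apply Hp; simpl; auto).
    assert (Pp := Hp p (or_introl eq_refl)); pose proof (is_prime_ge_2 p Pp) as P2.
    rewrite map_app; apply NoDup_app; auto.
    + rewrite map_map; simpl.
      rewrite <- (map_map fst (fun n => p * n)%nat).
      apply FinFun.Injective_map_NoDup; auto; intros x y E; nia.
    + intros n H1 H2; rewrite map_map in H2; simpl in H2.
      apply in_map_iff in H1; destruct H1 as (x & <- & Hx).
      apply in_map_iff in H2; destruct H2 as (y & E & Hy).
      apply (reson_coprime r ps p x Hp' Pp N1 Hx); exists (fst y); lia.
Qed.

Section Resonator.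

Variables (a : nat -> C) (sigma : R) (rho : nat -> R).
Hypothesis Ha1 : a 1%nat = RtoC 1.
Hypothesis Ha : forall p n, is_prime p -> ~ Nat.divide p n -> (1 <= n)%nat -> a (p * n)%nat = (a p * a n)%C.
Hypothesis Hrho : forall p, 0 <= rho p.

Let dir := dir_coef a sigma.
Let r (p : nat) : C := (a p * RtoC (rho p))%C.

(** [resA p] is [|r(p)|^2] and [resB p] is [a(p) p^(-sigma)] times the conjugate of [r(p)]. The
    choice [r(p) = a(p) rho(p)] makes the second quantity real and nonnegative. *)
Definition resA (p : nat) : R := Cmod (a p) ^ 2 * rho p ^ 2.
Definition resB (p : nat) : R := Cmod (a p) ^ 2 * (rho p * Rpower (INR p) (- sigma)).

Lemma resA_pos (p : nat) : 0 <= resA p.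
Proof. unfold resA; apply Rmult_le_pos; apply pow2_ge_0. Qed.

Lemma resB_pos (p : nat) : 0 <= resB p.
Proof.
  unfold resB; apply Rmult_le_pos; [apply pow2_ge_0|].
  apply Rmult_le_pos; auto; left; apply exp_pos.
Qed.

Lemma dir_divide (n1 k : nat) : (1 <= n1)%nat ->
  dir n1 (k * n1) = (a k * Rcpow (INR k) (- RtoC sigma))%C.
Proof.
  intros H; unfold dir, dir_coef.
  rewrite Nat.Div0.mod_mul, Nat.div_mul by lia; reflexivity.
Qed.

Lemma dir_ndivide (n1 n2 : nat) : (1 <= n1)%nat -> ~ Nat.divide n1 n2 -> dir n1 n2 = RtoC 0.
Proof.
  intros H D; unfold dir, dir_coef; destruct (n2 mod n1 =? 0)%nat eqn:E; auto.
  apply mod_eqb_divide in E; [easy|lia].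
Qed.

Lemma Rcpow_INR_mult (p k : nat) (s : C) : (1 <= p)%nat -> (1 <= k)%nat ->
  Rcpow (INR (p * k)) s = (Rcpow (INR p) s * Rcpow (INR k) s)%C.
Proof.
  intros Hp Hk; pose proof (INR_ge_1 p Hp); pose proof (INR_ge_1 k Hk).
  unfold Rcpow; rewrite <- Cexp_plus, mult_INR, ln_mult, RtoC_plus by lra; f_equal; ring.
Qed.

Lemma dir_mul_r (p n1 n2 : nat) : is_prime p -> ~ Nat.divide p n1 -> ~ Nat.divide p n2 ->
  (1 <= n1)%nat -> (1 <= n2)%nat ->
  dir n1 (p * n2) = (a p * RtoC (Rpower (INR p) (- sigma)) * dir n1 n2)%C.
Proof.
  intros Hp D1 D2 H1 H2; pose proof (is_prime_ge_2 p Hp).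
  destruct (classic (Nat.divide n1 n2)) as [(k & ->)|D].
  - replace (p * (k * n1))%nat with ((p * k) * n1)%nat by lia; rewrite !dir_divide by auto.
    rewrite Ha; auto; [|intros (j & ->); apply D2; exists (j * n1)%nat; lia|nia].
    rewrite Rcpow_INR_mult, <- Rcpow_real_neg by nia; ring.
  - rewrite !dir_ndivide; auto; [ring|]; intros D'; apply D.
    rewrite <- divide_of_nat in *; rewrite Nat2Z.inj_mul in D'.
    apply Gauss with (1 := D'); apply rel_prime_sym, prime_rel_prime; auto.
Qed.

Lemma dir_mul_l (p n1 n2 : nat) : is_prime p -> ~ Nat.divide p n2 -> (1 <= n1)%nat ->
  dir (p * n1) n2 = RtoC 0.
Proof.
  intros Hp D H1; pose proof (is_prime_ge_2 p Hp); apply dir_ndivide; [nia|].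
  intros (k & ->); apply D; exists (k * n1)%nat; lia.
Qed.

Lemma dir_mul_lr (p n1 n2 : nat) : is_prime p -> (1 <= n1)%nat -> dir (p * n1) (p * n2) = dir n1 n2.
Proof.
  intros Hp H1; pose proof (is_prime_ge_2 p Hp).
  destruct (classic (Nat.divide n1 n2)) as [(k & ->)|D].
  - replace (p * (k * n1))%nat with (k * (p * n1))%nat by lia; rewrite !dir_divide by nia; auto.
  - rewrite !dir_ndivide; auto; [nia|]; intros (k & E); apply D; exists k; nia.
Qed.

(** The sum of [f n] times the product of [resA p + resB p] over p dividing n, for squarefree n
    composed of [ps]. *)
Fixpoint dsum (ps : list nat) (f : nat -> R) : R :=
  match ps with
  | nil => f 1%nat
  | p :: ps' => dsum ps' f + (resA p + resB p) * dsum ps' (fun n => f (p * n)%nat)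
  end.

(** For each prime there are four blocks. If p divides n2, it divides n1 as well, with weight
    [resA p], or it belongs to the quotient, with weight [resB p]. If p divides only n1, then n1
    does not divide n2 and the block vanishes. *)
Lemma quad_reson (ps : list nat) (f : nat -> R) :
  (forall p, In p ps -> is_prime p) -> NoDup ps ->
  quad (reson r ps) (fun n1 n2 => RtoC (f n2) * dir n1 n2)%C = RtoC (dsum ps f).
Proof.
  revert f; induction ps as [|p ps IH]; intros f Hp Hn.
  - unfold quad; simpl; replace 1%nat with (1 * 1)%nat at 3 by lia; rewrite dir_divide, Ha1 by lia.
    unfold Rcpow; simpl INR; rewrite ln_1; replace (- RtoC sigma * RtoC 0)%C with (RtoC 0) by ring.
    rewrite Cexp_0; replace (Cconj (RtoC 1)) with (RtoC 1) by (apply injective_projections; simpl; ring); ring.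
  - inversion Hn as [|? ? N1 N2]; subst.
    assert (Hp' : forall p, In p ps -> is_prime p) by (intros; apply Hp; simpl; auto).
    assert (Pp := Hp p (or_introl eq_refl)); pose proof (is_prime_ge_2 p Pp) as P2.
    cbn [reson dsum]; set (l := reson r ps) in *.
    assert (Q : forall x, In x l -> (1 <= fst x)%nat /\ ~ Nat.divide p (fst x)).
    { intros x Hx; split; [apply (reson_pos r ps); auto|apply (reson_coprime r ps); auto]. }
    set (F := fun n1 n2 => (RtoC (f n2) * dir n1 n2)%C).
    set (F' := fun n1 n2 => (RtoC (f (p * n2)%nat) * dir n1 n2)%C).
    assert (I1 : quad l F = RtoC (dsum ps f)) by (apply IH; auto).
    assert (I2 : quad l F' = RtoC (dsum ps (fun n => f (p * n)%nat))) by (apply (IH (fun n => f (p * n)%nat)); auto).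
    rewrite RtoC_plus, RtoC_mult, <- I1, <- I2; unfold quad.
    rewrite lsumC_app, lsumC_map; cbn [fst snd].
    transitivity (lsumC (fun x => lsumC (fun y => snd x * Cconj (snd y) * F (fst x) (fst y))%C l
         + RtoC (resB p) * lsumC (fun y => snd x * Cconj (snd y) * F' (fst x) (fst y))%C l)%C l
       + lsumC (fun x => RtoC (resA p) * lsumC (fun y => snd x * Cconj (snd y) * F' (fst x) (fst y))%C l)%C l)%C;
      [f_equal; apply lsumC_ext; intros x Hx; destruct (Q x Hx) as [X1 X2]; rewrite lsumC_app, lsumC_map;
         cbn [fst snd]|rewrite lsumC_plus, !lsumC_scal, RtoC_plus; ring].
    + f_equal; rewrite <- lsumC_scal; apply lsumC_ext; intros y Hy; destruct (Q y Hy) as [Y1 Y2].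
      unfold F, F'; rewrite dir_mul_r by auto.
      unfold resB; rewrite !RtoC_mult, Cmod2_conj, Cmult_conj; unfold r; rewrite Cmult_conj.
      replace (Cconj (RtoC (rho p))) with (RtoC (rho p)) by (apply injective_projections; simpl; ring).
      ring.
    + transitivity (lsumC (fun _ => RtoC 0 * RtoC 0)%C l
         + RtoC (resA p) * lsumC (fun y => snd x * Cconj (snd y) * F' (fst x) (fst y))%C l)%C;
        [|rewrite lsumC_scal; ring].
      rewrite <- lsumC_scal; f_equal; apply lsumC_ext; intros y Hy; destruct (Q y Hy) as [Y1 Y2]; unfold F, F'.
      * rewrite dir_mul_l by auto; ring.
      * rewrite dir_mul_lr by auto.
        unfold resA; rewrite RtoC_mult, Cmod2_conj, Cmult_conj; unfold r; rewrite Cmult_conj.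
        replace (Cconj (RtoC (rho p))) with (RtoC (rho p)) by (apply injective_projections; simpl; ring).
        replace (RtoC (rho p ^ 2)) with (RtoC (rho p) * RtoC (rho p))%C
          by (rewrite <- RtoC_mult; f_equal; ring).
        ring.
Qed.

Definition lprod (f : nat -> R) (ps : list nat) : R := fold_right (fun p s => f p * s) 1 ps.

Lemma energy_reson (ps : list nat) : energy (reson r ps) = lprod (fun p => 1 + resA p) ps.
Proof.
  unfold energy; induction ps as [|p ps IH]; cbn [reson].
  - simpl; rewrite Cmod_1; ring.
  - change (lprod (fun p => 1 + resA p) (p :: ps)) with ((1 + resA p) * lprod (fun p => 1 + resA p) ps).
    rewrite lsumR_app, lsumR_map, IH; cbn [snd].
    rewrite (f_equal (fun g => lsumR g (reson r ps)) (y := fun x => resA p * Cmod (snd x) ^ 2)).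
    + rewrite lsumR_scal, IH; ring.
    + apply functional_extensionality; intros x; unfold r, resA.
      rewrite !Cmod_mult, Cmod_R, Rabs_pos_eq by auto; ring.
Qed.

Lemma dsum_mono (ps : list nat) (f g : nat -> R) :
  (forall p, In p ps -> is_prime p) -> (forall n, (1 <= n)%nat -> f n <= g n) -> dsum ps f <= dsum ps g.
Proof.
  revert f g; induction ps as [|p ps IH]; intros f g Hp H; cbn [dsum]; [apply H; lia|].
  assert (Hp' : forall p, In p ps -> is_prime p) by (intros; apply Hp; simpl; auto).
  pose proof (is_prime_ge_2 p (Hp p (or_introl eq_refl))).
  apply Rplus_le_compat; auto; apply Rmult_le_compat_l.
  - pose proof (resA_pos p); pose proof (resB_pos p); lra.
  - apply IH; auto; intros n Hn; apply H; nia.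
Qed.

Lemma dsum_lin (ps : list nat) (f g : nat -> R) (c : R) :
  dsum ps (fun n => f n - c * g n) = dsum ps f - c * dsum ps g.
Proof.
  revert f g; induction ps as [|p ps IH]; intros f g; cbn [dsum]; auto.
  rewrite IH, (IH (fun n => f (p * n)%nat) (fun n => g (p * n)%nat)); ring.
Qed.

Lemma dsum_scal (ps : list nat) (f : nat -> R) (c : R) : dsum ps (fun n => c * f n) = c * dsum ps f.
Proof.
  revert f; induction ps as [|p ps IH]; intros f; cbn [dsum]; auto.
  rewrite IH, (IH (fun n => f (p * n)%nat)); ring.
Qed.

Lemma dsum_ext (ps : list nat) (f g : nat -> R) : (forall p, In p ps -> is_prime p) ->
  (forall n, (1 <= n)%nat -> f n = g n) -> dsum ps f = dsum ps g.
Proof.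
  intros Hp H; apply Rle_antisym; apply dsum_mono; auto; intros; rewrite H; auto; lra.
Qed.

Lemma dsum_power (ps : list nat) (al : R) : (forall p, In p ps -> is_prime p) ->
  dsum ps (fun n => Rpower (INR n) al)
  = lprod (fun p => 1 + Rpower (INR p) al * (resA p + resB p)) ps.
Proof.
  induction ps as [|p ps IH]; intros Hp; cbn [dsum lprod fold_right].
  - simpl; unfold Rpower; rewrite ln_1, Rmult_0_r, exp_0; auto.
  - assert (Hp' : forall p, In p ps -> is_prime p) by (intros; apply Hp; simpl; auto).
    pose proof (is_prime_ge_2 p (Hp p (or_introl eq_refl))).
    rewrite (dsum_ext ps (fun n => Rpower (INR (p * n)) al) (fun n => Rpower (INR p) al * Rpower (INR n) al)); auto.
    + rewrite dsum_scal, IH by auto; unfold lprod; ring.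
    + intros n Hn; rewrite mult_INR, Rpower_mult_distr; auto; apply lt_0_INR; lia.
Qed.

(** Terms survive only when n1 divides n2, so n2 <= N already implies n1 <= N: truncating both
    variables is the same as cutting off n2 alone. *)
Lemma quad_reson_filter (ps : list nat) (N : nat) :
  (forall p, In p ps -> is_prime p) -> NoDup ps ->
  quad (filter (fun x => (fst x <=? N)%nat) (reson r ps)) dir
  = RtoC (dsum ps (fun n => if (n <=? N)%nat then 1 else 0)).
Proof.
  intros Hp Hn; rewrite <- quad_reson by auto; unfold quad.
  rewrite lsumC_filter; apply lsumC_ext; intros x Hx; rewrite lsumC_filter.
  pose proof (reson_pos r ps x Hp Hx) as X1.
  assert (Q : forall y, In y (reson r ps) -> (fst y <= N)%nat -> (N < fst x)%nat -> dir (fst x) (fst y) = RtoC 0).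
  { intros y Hy Y1 Y2; pose proof (reson_pos r ps y Hp Hy); apply dir_ndivide; auto.
    intros D; apply Nat.divide_pos_le in D; lia. }
  destruct (Nat.leb_spec (fst x) N) as [l|l].
  - apply lsumC_ext; intros y Hy; destruct (fst y <=? N)%nat; ring.
  - rewrite (lsumC_ext _ (fun _ => RtoC 0 * RtoC 0)%C), lsumC_scal; [ring|].
    intros y Hy; destruct (Nat.leb_spec (fst y) N); [rewrite Q by auto|]; ring.
Qed.

(* Rankin's trick removes the truncation n <= N. *)
Lemma dsum_rankin (ps : list nat) (N : nat) (al : R) : (forall p, In p ps -> is_prime p) ->
  (1 <= N)%nat -> 0 < al ->
  lprod (fun p => 1 + (resA p + resB p)) ps
  - Rpower (INR N) (- al) * lprod (fun p => 1 + Rpower (INR p) al * (resA p + resB p)) ps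
  <= dsum ps (fun n => if (n <=? N)%nat then 1 else 0).
Proof.
  intros Hp HN Hal; pose proof (INR_ge_1 N HN) as PN.
  replace (lprod (fun p => 1 + (resA p + resB p)) ps) with (dsum ps (fun n => Rpower (INR n) 0)).
  2: { rewrite dsum_power by auto; unfold lprod; f_equal; apply functional_extensionality; intros p.
       apply functional_extensionality; intros s; unfold Rpower; rewrite Rmult_0_l, exp_0; ring. }
  rewrite <- dsum_power, <- dsum_lin by auto; apply dsum_mono; auto; intros n Hn.
  pose proof (INR_ge_1 n Hn); unfold Rpower at 1; rewrite Rmult_0_l, exp_0.
  pose proof (exp_pos (- al * ln (INR N))); pose proof (exp_pos (al * ln (INR n))).
  destruct (Nat.leb_spec n N) as [l|l].
  - unfold Rpower; nra.
  - assert (1 <= Rpower (INR N) (- al) * Rpower (INR n) al); [|lra].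
    unfold Rpower; rewrite <- exp_plus, <- exp_0; apply exp_le.
    assert (ln (INR N) <= ln (INR n)) by (apply ln_le; [lra|apply le_INR; lia]); nra.
Qed.

Lemma lprod_pos (f : nat -> R) (ps : list nat) : (forall p, In p ps -> 1 <= f p) -> 1 <= lprod f ps.
Proof.
  induction ps as [|p ps IH]; intros H; simpl; [lra|].
  assert (1 <= f p) by (apply H; simpl; auto).
  assert (1 <= lprod f ps) by (apply IH; intros; apply H; simpl; auto); nra.
Qed.

Lemma lprod_le_exp (f g u : nat -> R) (ps : list nat) :
  (forall p, In p ps -> 0 <= f p <= g p * exp (u p) /\ 1 <= g p) ->
  0 <= lprod f ps <= lprod g ps * exp (lsumR u ps).
Proof.
  induction ps as [|p ps IH]; intros H; simpl; [rewrite exp_0; lra|].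
  destruct (H p (or_introl eq_refl)) as [H1 H2].
  assert (I : 0 <= lprod f ps <= lprod g ps * exp (lsumR u ps)) by (apply IH; intros; apply H; simpl; auto).
  rewrite exp_plus; split; [apply Rmult_le_pos; lra|].
  replace (g p * lprod g ps * (exp (u p) * exp (lsumR u ps)))
    with (g p * exp (u p) * (lprod g ps * exp (lsumR u ps))) by ring.
  apply Rmult_le_compat; lra.
Qed.

Lemma exp_le_one_plus (x th : R) : 0 <= x <= th -> th <= 1/2 -> exp (x * (1 - th)) <= 1 + x.
Proof.
  intros Hx Ht; pose proof (exp_ineq1_le (- (x * (1 - th)))) as H.
  assert (E : exp (x * (1 - th)) * exp (- (x * (1 - th))) = 1).
  { rewrite <- exp_plus, Rplus_opp_r, exp_0; auto. }
  pose proof (exp_pos (x * (1 - th))) as P; set (y := exp (x * (1 - th))) in *.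
  assert (y * (1 - x * (1 - th)) <= 1) by nra.
  assert (1 <= (1 + x) * (1 - x * (1 - th))) by nra.
  assert (0 < 1 - x * (1 - th)) by nra.
  apply Rmult_le_reg_r with (1 - x * (1 - th)); lra.
Qed.

(** By [1 + k s <= (1 + s) exp ((k - 1) s)] the hypothesis on the sum makes Rankin's error at most
    [1/e], hence half, of the full product. Then 1 + A + B = (1 + A)(1 + B / (1 + A)), where the
    last factor is at least [exp ((1 - th) B / (1 + A0))]. *)
Lemma dsum_lower (ps : list nat) (N : nat) (al th A0 : R) : (forall p, In p ps -> is_prime p) ->
  (1 <= N)%nat -> 0 < al -> 0 < th <= 1/2 ->
  (forall p, In p ps -> resA p <= A0 /\ resB p <= th) ->
  lsumR (fun p => (Rpower (INR p) al - 1) * (resA p + resB p)) ps <= al * ln (INR N) - 1 ->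
  / 2 * (lprod (fun p => 1 + resA p) ps * exp ((1 - th) / (1 + A0) * lsumR resB ps))
  <= dsum ps (fun n => if (n <=? N)%nat then 1 else 0).
Proof.
  intros Hp HN Hal Hth HAB HS; pose proof (INR_ge_1 N HN) as PN.
  eapply Rle_trans; [|apply (dsum_rankin ps N al Hp HN Hal)].
  set (G := lprod (fun p => 1 + (resA p + resB p)) ps).
  assert (PG : 1 <= G).
  { apply lprod_pos; intros p _; pose proof (resA_pos p); pose proof (resB_pos p); lra. }
  assert (U1 : lprod (fun p => 1 + Rpower (INR p) al * (resA p + resB p)) ps
      <= G * exp (lsumR (fun p => (Rpower (INR p) al - 1) * (resA p + resB p)) ps)).
  { apply lprod_le_exp; intros p Hin; pose proof (resA_pos p); pose proof (resB_pos p).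
    pose proof (is_prime_ge_2 p (Hp p Hin)) as P2.
    assert (P1 : 1 <= Rpower (INR p) al).
    { unfold Rpower; rewrite <- exp_0; apply exp_le; apply Rmult_le_pos; [lra|].
      rewrite <- ln_1; apply ln_le; [lra|apply INR_ge_1; lia]. }
    set (s := resA p + resB p) in *; set (k := Rpower (INR p) al) in *.
    assert (0 <= s) by (unfold s; lra).
    pose proof (exp_ineq1_le ((k - 1) * s)).
    assert (0 <= (k - 1) * s) by (apply Rmult_le_pos; lra).
    split; [split; nra|lra]. }
  assert (U2 : Rpower (INR N) (- al) * lprod (fun p => 1 + Rpower (INR p) al * (resA p + resB p)) ps <= G / 2).
  { eapply Rle_trans; [apply Rmult_le_compat_l; [left; apply exp_pos|apply U1]|].
    rewrite (Rmult_comm G), <- Rmult_assoc; unfold Rpower at 1; rewrite <- exp_plus.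
    unfold Rdiv; rewrite (Rmult_comm G); apply Rmult_le_compat_r; [lra|].
    apply Rle_trans with (exp (- (1))); [apply exp_le; lra|].
    rewrite exp_Ropp; apply Rinv_le_contravar; [lra|].
    pose proof (exp_ineq1_le 1); lra. }
  assert (U3 : lprod (fun p => 1 + resA p) ps * exp ((1 - th) / (1 + A0) * lsumR resB ps) <= G).
  { unfold G; clear HS U1 U2 PG G HN PN; induction ps as [|p ps IH]; simpl.
    - rewrite Rmult_0_r, exp_0; lra.
    - assert (I : lprod (fun p => 1 + resA p) ps * exp ((1 - th) / (1 + A0) * lsumR resB ps)
         <= lprod (fun p => 1 + (resA p + resB p)) ps).
      { apply IH; [intros; apply Hp; simpl; auto|intros; apply HAB; simpl; auto]. }
      destruct (HAB p (or_introl eq_refl)) as [H1 H2].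
      pose proof (resA_pos p) as PA; pose proof (resB_pos p) as PB.
      rewrite Rmult_plus_distr_l, exp_plus.
      assert (PL : 1 <= lprod (fun p => 1 + resA p) ps).
      { apply lprod_pos; intros k _; pose proof (resA_pos k); lra. }
      replace ((1 + resA p) * lprod (fun p => 1 + resA p) ps *
         (exp ((1 - th) / (1 + A0) * resB p) * exp ((1 - th) / (1 + A0) * lsumR resB ps)))
        with (((1 + resA p) * exp ((1 - th) / (1 + A0) * resB p))
          * (lprod (fun p => 1 + resA p) ps * exp ((1 - th) / (1 + A0) * lsumR resB ps))) by ring.
      apply Rmult_le_compat; auto.
      + apply Rmult_le_pos; [lra|left; apply exp_pos].
      + apply Rmult_le_pos; [lra|left; apply exp_pos].
      + set (x := resB p / (1 + resA p)).
        assert (Ex : x * (1 + resA p) = resB p) by (unfold x; field; lra).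
        assert (Px : 0 <= x) by (apply Rmult_le_pos; auto; left; apply Rinv_0_lt_compat; lra).
        assert (Hx : x <= th) by nra.
        apply Rle_trans with ((1 + resA p) * (1 + x)); [|lra].
        apply Rmult_le_compat_l; [lra|].
        eapply Rle_trans; [|apply (exp_le_one_plus x th); lra]; apply exp_le.
        replace ((1 - th) / (1 + A0) * resB p) with ((1 - th) * (resB p * / (1 + A0))) by (field; lra).
        rewrite (Rmult_comm x); apply Rmult_le_compat_l; [lra|].
        unfold x, Rdiv; apply Rmult_le_compat_l; auto; apply Rinv_le_contravar; lra. }
  lra.
Qed.

End Resonator.

(** Truncation only lowers the energy, which is therefore at most the full product E. The form is at
    least E exp(Z) / 2 and at most 4 M E. The condition Z >= 1 gives exp(Z) >= 2, so that the form
    is at least the energy, as [resonance] demands. *)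
Lemma resonance_primes (L : C -> C) (a : nat -> C) (m : nat) (alpha : nat -> nat -> C) (sigma : R) (q : nat) :
  selberg_class_poly L a m alpha -> 0 <= sigma <= 3 -> (3 <= q)%nat ->
  exists T0, 1 < T0 /\ forall T N M ps rho al th A0, T0 <= T -> (1 <= N)%nat ->
    INR N <= Rpower T (/ INR q) ^ (q - 2) ->
    (forall t, T <= t <= 2 * T -> Cmod (L (sigma, t)) <= M) ->
    (forall p, In p ps -> is_prime p) -> NoDup ps -> (forall p, 0 <= rho p) ->
    0 < al -> 0 < th <= 1/2 ->
    (forall p, In p ps -> resA a rho p <= A0 /\ resB a sigma rho p <= th) ->
    lsumR (fun p => (Rpower (INR p) al - 1) * (resA a rho p + resB a sigma rho p)) ps <= al * ln (INR N) - 1 ->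
    1 <= (1 - th) / (1 + A0) * lsumR (resB a sigma rho) ps ->
    exp ((1 - th) / (1 + A0) * lsumR (resB a sigma rho) ps) <= 8 * M.
Proof.
  intros HL Hs Hq; destruct (resonance L a m alpha sigma q HL Hs Hq) as (T0 & HT0 & HR).
  exists T0; split; auto; intros T N M ps rho al th A0 HT HN HNX HM Hp Hnd Hrho Hal Hth HAB HS HZ.
  destruct (selberg_multiplicative L a m alpha HL) as [Ha1 Ha].
  set (rs := reson (fun p => a p * RtoC (rho p))%C ps).
  set (l := filter (fun x => (fst x <=? N)%nat) rs).
  set (Z := (1 - th) / (1 + A0) * lsumR (resB a sigma rho) ps) in *.
  assert (El : energy l <= lprod (fun p => 1 + resA a rho p) ps).
  { rewrite <- (energy_reson a rho Hrho ps); fold rs; unfold l, energy; clear.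
    induction rs as [|x rs IH]; simpl; [lra|].
    destruct (fst x <=? N)%nat; simpl; pose proof (pow2_ge_0 (Cmod (snd x))); simpl in *; lra. }
  assert (Dl : quad l (dir_coef a sigma)
     = RtoC (dsum a sigma rho ps (fun n => if (n <=? N)%nat then 1 else 0))).
  { apply quad_reson_filter; auto. }
  pose proof (dsum_lower a sigma rho Hrho ps N al th A0 Hp HN Hal Hth HAB HS) as Lo; fold Z in Lo.
  set (D := dsum a sigma rho ps (fun n => if (n <=? N)%nat then 1 else 0)) in *.
  set (E := lprod (fun p => 1 + resA a rho p) ps) in *.
  assert (PE : 1 <= E) by (apply lprod_pos; intros p _; pose proof (resA_pos a rho p); lra).
  assert (e2 : 2 <= exp Z) by (pose proof (exp_ineq1_le Z); lra).
  assert (PD : E <= D) by nra.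
  assert (PM : 0 <= M).
  { eapply Rle_trans; [apply Cmod_ge_0|apply (HM T)]; lra. }
  assert (K : Cmod (quad l (dir_coef a sigma)) <= 4 * M * energy l).
  { apply (HR T N); auto.
    - unfold l; assert (Q : NoDup (map fst rs)) by (apply reson_NoDup; auto).
      clear - Q; induction rs as [|x rs IH]; simpl; auto; inversion Q as [|? ? Q1 Q2]; subst.
      destruct (fst x <=? N)%nat; simpl; auto; constructor; auto.
      intros K; apply Q1; apply in_map_iff in K; destruct K as (y & E & Hy).
      apply filter_In in Hy; rewrite <- E; apply in_map; tauto.
    - intros x Hx; unfold l in Hx; apply filter_In in Hx; destruct Hx as [H1 H2].
      apply Nat.leb_le in H2; split; auto; apply (reson_pos _ ps x Hp H1).
    - rewrite Dl, Cmod_R, Rabs_pos_eq; lra. }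
  rewrite Dl, Cmod_R, Rabs_pos_eq in K by lra.
  assert (4 * M * energy l <= 4 * M * E) by (apply Rmult_le_compat_l; lra).
  apply Rmult_le_reg_l with E; lra.
Qed.

(** * Sums over primes *)

Definition primes_in (A k : nat) : list nat :=
  filter (fun n => if is_prime_dec n then true else false) (seq (S A) k).

Lemma primes_in_spec (A k p : nat) : In p (primes_in A k) -> is_prime p /\ (A < p <= A + k)%nat.
Proof.
  intros H; apply filter_In in H; destruct H as [H1 H2]; apply in_seq in H1.
  destruct (is_prime_dec p); [split; auto; lia|easy].
Qed.

Lemma primes_in_NoDup (A k : nat) : NoDup (primes_in A k).
Proof. apply NoDup_filter, seq_NoDup. Qed.

(** The Stieltjes sum of [f] against the increments of [u] over A < n <= A + k. *)
Fixpoint wsum (u f : nat -> R) (A k : nat) : R :=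
  match k with
  | O => 0
  | S k' => wsum u f A k' + (u (S (A + k')) - u (A + k')%nat) * f (S (A + k'))
  end.

Definition psum (a : nat -> C) (n : nat) : R :=
  sum_f_R0 (fun p => if is_prime_dec p then Cmod (a p) ^ 2 else 0) n.

Lemma lsumR_primes_in (a : nat -> C) (f : nat -> R) (A k : nat) :
  lsumR (fun p => Cmod (a p) ^ 2 * f p) (primes_in A k) = wsum (psum a) f A k.
Proof.
  induction k as [|k IH]; auto.
  unfold primes_in; rewrite seq_S, filter_app, lsumR_app; fold (primes_in A k); rewrite IH.
  cbn [wsum]; f_equal; replace (S A + k)%nat with (S (A + k)) by lia.
  unfold psum; cbn [sum_f_R0 filter]; destruct (is_prime_dec (S (A + k))); simpl lsumR; ring.
Qed.

Lemma wsum_le (E f : nat -> R) (A k : nat) :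
  (forall n, (A <= n)%nat -> E n <= 0 /\ f (S n) <= f n) ->
  wsum E f A k <= E (A + k)%nat * f (A + k)%nat - E A * f A.
Proof.
  intros H; induction k as [|k IH]; cbn [wsum].
  - rewrite Nat.add_0_r; lra.
  - replace (A + S k)%nat with (S (A + k)) by lia.
    destruct (H (A + k)%nat ltac:(lia)) as [H1 H2]; nra.
Qed.

Lemma wsum_lin (u v f : nat -> R) (c d : R) (A k : nat) :
  wsum (fun n => c * u n + d * v n) f A k = c * wsum u f A k + d * wsum v f A k.
Proof. induction k as [|k IH]; cbn [wsum]; [ring|rewrite IH; ring]. Qed.

Definition gfun (x : R) : R := x / ln x.

(** [H] stands for the integral of f / ln from x to infinity, the expected size of the sum of [f]
    over the primes beyond x. A closed form with the right derivative up to a factor 1 + d avoids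
    improper integrals. *)
Record good_weight (f H dH : R -> R) : Prop := {
  gw_deriv : forall x, 1 < x -> is_derive H x (dH x);
  gw_pos : forall x, 1 < x -> 0 < f x /\ 0 < H x;
  gw_decr : forall x y, 3 <= x <= y -> f y <= f x;
  gw_lower : forall x, 1 < x -> f x / ln x <= - dH x;
  gw_bound : forall x, 3 <= x -> gfun x * f x <= H x;
  gw_upper : forall d, 0 < d -> exists x0, forall x, x0 <= x ->
    - dH x <= (1 + d) * (f x / ln x) /\ (1 - d) * f x <= f (x + 1)
}.

Lemma ln_gt_1 (x : R) : 3 <= x -> 1 <= ln x.
Proof.
  intros H; rewrite <- (ln_exp 1); apply ln_le; [apply exp_pos|]; pose proof exp_le_3; lra.
Qed.

Lemma gfun_derive (x : R) : 1 < x -> is_derive gfun x (/ ln x - / (ln x) ^ 2).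
Proof.
  intros Hx; assert (0 < ln x) by (rewrite <- ln_1; apply ln_increasing; lra).
  unfold gfun; auto_derive; [split; [lra|split; auto; lra]|field; lra].
Qed.

Lemma decreasing_of_deriv (F dF : R -> R) (x y : R) : x <= y ->
  (forall z, x <= z <= y -> is_derive F z (dF z)) -> (forall z, x <= z <= y -> dF z <= 0) -> F y <= F x.
Proof.
  intros Hxy HF HN; destruct (MVT_gen F x y dF) as (c & Hc & E).
  - intros z Hz; rewrite Rmin_left, Rmax_right in Hz by auto; apply HF; lra.
  - intros z Hz; rewrite Rmin_left, Rmax_right in Hz by auto.
    apply derivable_continuous_pt; exists (dF z); apply is_derive_Reals, HF; auto.
  - rewrite Rmin_left, Rmax_right in Hc by auto; specialize (HN c Hc); nra.
Qed.

Section Weight.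

Variables f H dH : R -> R.
Hypothesis GW : good_weight f H dH.

(** On [x, x + 1] the constant [f (x + 1)] is at most [f z], and the derivative 1/ln - 1/ln^2 of
    [gfun] is below 1/ln; hence [f (x + 1) * gfun + H] decreases there. *)
Lemma weight_step_upper (x : R) : 3 <= x ->
  (gfun (x + 1) - gfun x) * f (x + 1) <= H x - H (x + 1).
Proof.
  intros Hx; set (c := f (x + 1)).
  assert (D : c * gfun (x + 1) + H (x + 1) <= c * gfun x + H x).
  { apply (decreasing_of_deriv (fun z => c * gfun z + H z) (fun z => c * (/ ln z - / (ln z) ^ 2) + dH z)); [lra| |].
    - intros z Hz; apply (is_derive_plus (fun z => c * gfun z) H); [|apply (gw_deriv f H dH GW); lra].
      apply (is_derive_scal gfun z c), gfun_derive; lra.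
    - intros z Hz; pose proof (ln_gt_1 z ltac:(lra)) as L.
      pose proof (gw_lower f H dH GW z ltac:(lra)) as B.
      pose proof (gw_decr f H dH GW z (x + 1) ltac:(lra)) as M; fold c in M.
      destruct (gw_pos f H dH GW (x + 1) ltac:(lra)) as [P _]; fold c in P.
      assert (Q : 0 < / ln z) by (apply Rinv_0_lt_compat; lra).
      assert (0 < / (ln z) ^ 2) by (apply Rinv_0_lt_compat, pow_lt; lra).
      unfold Rdiv in B; nra. }
  lra.
Qed.

(** The same comparison reversed: [f (x + 1) >= (1 - d) f z] and [1/ln^2 <= d/ln] for large x,
    together with (1 - 3d)(1 + d) <= (1 - d)^2. *)
Lemma weight_step_lower (d : R) : 0 < d <= 1/4 -> exists x0, 3 <= x0 /\ forall x, x0 <= x ->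
  (1 - 3 * d) * (H x - H (x + 1)) <= (gfun (x + 1) - gfun x) * f (x + 1).
Proof.
  intros Hd; destruct (gw_upper f H dH GW d ltac:(lra)) as (x0 & Hx0).
  exists (Rmax 3 (Rmax x0 (exp (/ d)))); split; [apply Rmax_l|]; intros x Hx.
  assert (H3 : 3 <= x) by (eapply Rle_trans; [apply Rmax_l|apply Hx]).
  assert (Hx1 : x0 <= x) by (eapply Rle_trans; [|apply Hx]; eapply Rle_trans; [|apply Rmax_r]; apply Rmax_l).
  assert (Hx2 : exp (/ d) <= x) by (eapply Rle_trans; [|apply Hx]; eapply Rle_trans; [|apply Rmax_r]; apply Rmax_r).
  set (c := f (x + 1)); set (k := 1 - 3 * d).
  assert (D : - (c * gfun (x + 1)) + - k * H (x + 1) <= - (c * gfun x) + - k * H x).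
  { apply (decreasing_of_deriv (fun z => - (c * gfun z) + - k * H z)
      (fun z => - (c * (/ ln z - / (ln z) ^ 2)) + - k * dH z)); [lra| |].
    - intros z Hz; apply (is_derive_plus (fun z => - (c * gfun z)) (fun z => - k * H z)).
      + apply (is_derive_opp (fun z => c * gfun z)), (is_derive_scal gfun z c), gfun_derive; lra.
      + apply (is_derive_scal H z (- k)), (gw_deriv f H dH GW); lra.
    - intros z Hz; pose proof (ln_gt_1 z ltac:(lra)) as L.
      destruct (Hx0 z ltac:(lra)) as [B1 B2].
      pose proof (gw_decr f H dH GW (x + 1) (z + 1) ltac:(lra)) as M; fold c in M.
      destruct (gw_pos f H dH GW z ltac:(lra)) as [P _].
      assert (Lz : / d <= ln z).
      { rewrite <- (ln_exp (/ d)); apply ln_le; [apply exp_pos|lra]. }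
      set (q := / ln z); assert (Q : 0 < q) by (apply Rinv_0_lt_compat; lra).
      assert (Qd : q <= d).
      { unfold q; rewrite <- (Rinv_inv d); apply Rinv_le_contravar; auto; apply Rinv_0_lt_compat; lra. }
      replace (/ (ln z) ^ 2) with (q * q) by (unfold q; field; lra).
      unfold Rdiv in B1; fold q in B1; fold q.
      assert (A1 : (1 - d) * f z * (q * (1 - d)) <= c * (q - q * q)).
      { replace (q - q * q) with (q * (1 - q)) by ring.
        apply Rmult_le_compat; try nra. }
      assert (Kp : 0 <= k) by (unfold k; lra).
      assert (A2 : k * - dH z <= k * ((1 + d) * (f z * q))) by (apply Rmult_le_compat_l; auto).
      assert (A3 : k * (1 + d) <= (1 - d) * (1 - d)) by (unfold k; nra).
      assert (0 <= f z * q) by nra.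
      assert (k * (1 + d) * (f z * q) <= (1 - d) * (1 - d) * (f z * q)) by (apply Rmult_le_compat_r; auto).
      lra. }
  lra.
Qed.

Let fn (n : nat) : R := f (INR n).
Let gn (n : nat) : R := gfun (INR n).
Let Hn (n : nat) : R := H (INR n).

Lemma wsum_gfun_upper (A k : nat) : (3 <= A)%nat -> wsum gn fn A k <= Hn A - Hn (A + k).
Proof.
  intros HA; assert (P : 3 <= INR A) by (replace 3 with (INR 3) by (simpl; ring); apply le_INR; auto).
  induction k as [|k IH]; cbn [wsum].
  - rewrite Nat.add_0_r; lra.
  - replace (A + S k)%nat with (S (A + k)) by lia.
    pose proof (weight_step_upper (INR (A + k)) ltac:(rewrite plus_INR; pose proof (pos_INR k); lra)) as S.
    unfold fn, gn, Hn in *; rewrite S_INR; lra.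
Qed.

Lemma wsum_gfun_lower (d : R) : 0 < d <= 1/4 -> exists n0, (3 <= n0)%nat /\ forall A k, (n0 <= A)%nat ->
  (1 - 3 * d) * (Hn A - Hn (A + k)) <= wsum gn fn A k.
Proof.
  intros Hd; destruct (weight_step_lower d Hd) as (x0 & Hx0 & S).
  destruct (INR_unbounded x0) as (n0 & Hn0); exists (n0 + 3)%nat; split; [lia|]; intros A k HA.
  assert (P : x0 <= INR A) by (assert (INR n0 <= INR A) by (apply le_INR; lia); lra).
  induction k as [|k IH]; cbn [wsum].
  - rewrite Nat.add_0_r; lra.
  - replace (A + Datatypes.S k)%nat with (Datatypes.S (A + k)) by lia.
    specialize (S (INR (A + k)) ltac:(rewrite plus_INR; pose proof (pos_INR k); lra)).
    unfold fn, gn, Hn in *; rewrite S_INR; lra.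
Qed.

Variables (a : nat -> C) (kappa : R).
Hypotheses (Hk : 0 < kappa) (HS : selberg_normality a kappa).

Lemma psum_asymp (d : R) : 0 < d -> exists n0, (3 <= n0)%nat /\ forall n, (n0 <= n)%nat ->
  (kappa - d) * gn n <= psum a n <= (kappa + d) * gn n.
Proof.
  intros Hd; destruct HS as (eps & He & HE).
  apply is_lim_spec in He; destruct (He (mkposreal d Hd)) as (M1 & H1); simpl in H1.
  destruct HE as (M2 & H2).
  destruct (INR_unbounded (Rmax M1 M2)) as (n0 & Hn0); exists (n0 + 3)%nat; split; [lia|]; intros n Hn'.
  assert (P3 : 3 <= INR n) by (replace 3 with (INR 3) by (simpl; ring); apply le_INR; lia).
  assert (Q : Rmax M1 M2 < INR n) by (assert (INR n0 <= INR n) by (apply le_INR; lia); lra).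
  specialize (H1 (INR n) (Rle_lt_trans _ _ _ (Rmax_l _ _) Q)).
  specialize (H2 (INR n) (Rle_lt_trans _ _ _ (Rmax_r _ _) Q)).
  unfold prime_square_sum in H2; rewrite Int_part_INR, Nat2Z.id in H2; fold (psum a n) in H2.
  fold (gfun (INR n)) in H2; fold (gn n) in H2.
  assert (0 < gn n).
  { unfold gn, gfun; apply Rdiv_lt_0_compat; [lra|]; pose proof (ln_gt_1 (INR n) P3); lra. }
  rewrite Rminus_0_r in H1; apply Rabs_def2 in H1; rewrite H2; nra.
Qed.

(** Summation by parts with one-sided errors: [psum a] is bracketed between two multiples of [gfun],
    whose Stieltjes sums are known. The boundary term at [A] is controlled by [gw_bound], and
    nothing depends on the length [k]. *)
Lemma prime_sum_asymp (d : R) : 0 < d -> exists n0, (3 <= n0)%nat /\ forall A k, (n0 <= A)%nat ->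
  (kappa - d) * (Hn A - Hn (A + k)) - d * Hn A
  <= lsumR (fun p => Cmod (a p) ^ 2 * fn p) (primes_in A k) <= (kappa + d) * Hn A.
Proof.
  intros Hd; set (d0 := Rmin (d / 4) (kappa / 2)); set (d1 := Rmin (1/4) (d / (6 * kappa))).
  assert (Hd0 : 0 < d0) by (apply Rmin_pos; lra).
  assert (Hd0a : d0 <= d / 4) by apply Rmin_l; assert (Hd0b : d0 <= kappa / 2) by apply Rmin_r.
  assert (Hd1 : 0 < d1) by (apply Rmin_pos; [lra|apply Rdiv_lt_0_compat; lra]).
  assert (Hd1a : d1 <= 1/4) by apply Rmin_l.
  assert (Hd1b : 3 * kappa * d1 <= d / 2).
  { apply Rle_trans with (3 * kappa * (d / (6 * kappa))); [|right; field; lra].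
    apply Rmult_le_compat_l; [lra|apply Rmin_r]. }
  destruct (psum_asymp d0 Hd0) as (n1 & N1 & P1).
  destruct (wsum_gfun_lower d1 ltac:(lra)) as (n2 & N2 & P2).
  exists (n1 + n2)%nat; split; [lia|]; intros A k HA; rewrite lsumR_primes_in.
  assert (P3 : forall n, (A <= n)%nat -> 3 <= INR n).
  { intros n Hn'; replace 3 with (INR 3) by (simpl; ring); apply le_INR; lia. }
  assert (Dec : forall n, (A <= n)%nat -> fn (S n) <= fn n).
  { intros n Hn'; unfold fn; apply (gw_decr f H dH GW); rewrite S_INR; specialize (P3 n Hn'); lra. }
  assert (G : forall n, (A <= n)%nat -> 0 < gn n).
  { intros n Hn'; unfold gn, gfun; specialize (P3 n Hn'); apply Rdiv_lt_0_compat; [lra|].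
    pose proof (ln_gt_1 (INR n) P3); lra. }
  assert (HH : forall n, (A <= n)%nat -> 0 < fn n /\ 0 < Hn n).
  { intros n Hn'; specialize (P3 n Hn'); apply (gw_pos f H dH GW (INR n)); lra. }
  assert (GF : gn A * fn A <= Hn A) by (apply (gw_bound f H dH GW), P3; lia).
  destruct (HH A (Nat.le_refl A)) as [PF PH]; destruct (HH (A + k)%nat ltac:(lia)) as [_ PHk].
  pose proof (G A (Nat.le_refl A)) as PG.
  pose proof (wsum_gfun_upper A k ltac:(lia)) as U; pose proof (P2 A k ltac:(lia)) as Lw.
  assert (Mono : Hn (A + k) <= Hn A).
  { apply (decreasing_of_deriv H dH); [apply le_INR; lia| |].
    - intros z Hz; apply (gw_deriv f H dH GW); specialize (P3 A (Nat.le_refl A)); lra.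
    - intros z Hz; specialize (P3 A (Nat.le_refl A)).
      pose proof (gw_lower f H dH GW z ltac:(lra)) as B.
      assert (0 < f z / ln z); [|lra].
      apply Rdiv_lt_0_compat; [apply (gw_pos f H dH GW z); lra|].
      pose proof (ln_gt_1 z ltac:(lra)); lra. }
  split.
  - set (E := fun n => (kappa - d0) * gn n + -1 * psum a n).
    pose proof (wsum_le E fn A k) as W.
    assert (W' : wsum E fn A k <= E (A + k)%nat * fn (A + k)%nat - E A * fn A).
    { apply W; intros n Hn'; split; auto; unfold E; destruct (P1 n ltac:(lia)); lra. }
    assert (E1 : E (A + k)%nat * fn (A + k)%nat <= 0).
    { destruct (HH (A + k)%nat ltac:(lia)) as [Q _]; unfold E; destruct (P1 (A + k)%nat ltac:(lia)); nra. }
    assert (E2 : - E A * fn A <= 2 * d0 * Hn A).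
    { apply Rle_trans with (2 * d0 * (gn A * fn A)); [|apply Rmult_le_compat_l; lra].
      rewrite <- Rmult_assoc; apply Rmult_le_compat_r; [lra|]; unfold E; destruct (P1 A ltac:(lia)); lra. }
    assert (EW : wsum E fn A k = (kappa - d0) * wsum gn fn A k + -1 * wsum (psum a) fn A k) by apply wsum_lin.
    assert (F1 : (kappa - d0) * ((1 - 3 * d1) * (Hn A - Hn (A + k))) <= (kappa - d0) * wsum gn fn A k).
    { apply Rmult_le_compat_l; lra. }
    assert (F2 : (kappa - d) * (Hn A - Hn (A + k)) <= (kappa - d0) * (1 - 3 * d1) * (Hn A - Hn (A + k))).
    { apply Rmult_le_compat_r; [lra|]; nra. }
    assert (2 * d0 * Hn A <= d * Hn A) by (apply Rmult_le_compat_r; lra).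
    lra.
  - set (E := fun n => 1 * psum a n + - (kappa + d0) * gn n).
    assert (W' : wsum E fn A k <= E (A + k)%nat * fn (A + k)%nat - E A * fn A).
    { apply wsum_le; intros n Hn'; split; auto; unfold E; destruct (P1 n ltac:(lia)); lra. }
    assert (E1 : E (A + k)%nat * fn (A + k)%nat <= 0).
    { destruct (HH (A + k)%nat ltac:(lia)) as [Q _]; unfold E; destruct (P1 (A + k)%nat ltac:(lia)); nra. }
    assert (E2 : - E A * fn A <= 2 * d0 * Hn A).
    { apply Rle_trans with (2 * d0 * (gn A * fn A)); [|apply Rmult_le_compat_l; lra].
      rewrite <- Rmult_assoc; apply Rmult_le_compat_r; [lra|]; unfold E; destruct (P1 A ltac:(lia)); lra. }
    assert (EW : wsum E fn A k = 1 * wsum (psum a) fn A k + - (kappa + d0) * wsum gn fn A k) by apply wsum_lin.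
    assert (F1 : (kappa + d0) * wsum gn fn A k <= (kappa + d0) * Hn A).
    { apply Rmult_le_compat_l; lra. }
    assert (4 * d0 * Hn A <= d * Hn A) by (apply Rmult_le_compat_r; lra).
    assert (0 <= d0 * Hn A) by (apply Rmult_le_pos; lra).
    lra.
Qed.

End Weight.

Lemma ln_pos (x : R) : 1 < x -> 0 < ln x.
Proof. intros H; rewrite <- ln_1; apply ln_increasing; lra. Qed.

Lemma ln_plus_1_le (x : R) : 0 < x -> ln (x + 1) <= ln x + / x.
Proof.
  intros Hx; replace (x + 1) with (x * (1 + / x)) by (field; lra).
  assert (0 < / x) by now apply Rinv_0_lt_compat.
  rewrite ln_mult by lra; apply Rplus_le_compat_l.
  rewrite <- (ln_exp (/ x)) at 2; apply ln_le; [lra|apply exp_ineq1_le].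
Qed.

Lemma ratio_sq_lower (x d : R) : 0 < d -> 2 / d <= x -> 1 <= x -> (1 - d) * (x + 1) ^ 2 <= x ^ 2.
Proof.
  intros Hd Hx H1; assert (2 <= d * x).
  { apply Rle_trans with (d * (2 / d)); [right; field; lra|apply Rmult_le_compat_l; lra]. }
  nra.
Qed.

(** Differentiating [H] leaves an extra term of relative size [1 / ((be - 1) ln x)], whence the
    threshold for x. The condition [be <= 2] bounds the ratio of [f] at x + 1 and x below by (x / (x
    + 1))^2. The case of interest is [be = 2 sigma]. *)
Lemma good_weight_power (be : R) : 1 < be <= 2 ->
  good_weight (fun x => Rpower x (- be)) (fun x => Rpower x (1 - be) / ((be - 1) * ln x))
    (fun x => - (Rpower x (- be) / ln x + Rpower x (- be) / ((be - 1) * (ln x) ^ 2))).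
Proof.
  intros Hb.
  assert (Split : forall x, 0 < x -> Rpower x (1 - be) = x * Rpower x (- be)).
  { intros x Hx; unfold Rminus; rewrite Rpower_plus, Rpower_1; auto. }
  split.
  - intros x Hx; pose proof (ln_pos x Hx) as L.
    apply (is_derive_ext (fun x => exp ((1 - be) * ln x) / ((be - 1) * ln x))); [reflexivity|].
    auto_derive; [split; [lra|split; [lra|split; auto; apply Rgt_not_eq, Rmult_lt_0_compat; lra]]|].
    change (exp ((1 - be) * ln x)) with (Rpower x (1 - be)); rewrite Split by lra.
    field; lra.
  - intros x Hx; pose proof (ln_pos x Hx) as L; split; [apply exp_pos|].
    apply Rdiv_lt_0_compat; [apply exp_pos|apply Rmult_lt_0_compat; lra].
  - intros x y Hxy; unfold Rpower; apply exp_le.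
    assert (ln x <= ln y) by (apply ln_le; lra); nra.
  - intros x Hx; pose proof (ln_pos x Hx) as L; rewrite Ropp_involutive.
    assert (0 < Rpower x (- be) / ((be - 1) * ln x ^ 2)); [|lra].
    apply Rdiv_lt_0_compat; [apply exp_pos|]; apply Rmult_lt_0_compat; [lra|apply pow_lt; lra].
  - intros x Hx; pose proof (ln_pos x ltac:(lra)) as L; rewrite Split by lra; unfold gfun.
    pose proof (exp_pos (- be * ln x)) as P; fold (Rpower x (- be)) in P.
    replace (x / ln x * Rpower x (- be)) with (x * Rpower x (- be) * / ln x) by (field; lra).
    unfold Rdiv; apply Rmult_le_compat_l; [nra|]; apply Rinv_le_contravar; nra.
  - intros d Hd; exists (Rmax 3 (Rmax (2 / d) (exp (/ ((be - 1) * d))))); intros x Hx.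
    assert (H3 : 3 <= x) by (eapply Rle_trans; [apply Rmax_l|apply Hx]).
    assert (Hx1 : 2 / d <= x) by (eapply Rle_trans; [|apply Hx]; eapply Rle_trans; [|apply Rmax_r]; apply Rmax_l).
    assert (Hx2 : exp (/ ((be - 1) * d)) <= x) by (eapply Rle_trans; [|apply Hx]; eapply Rle_trans; [|apply Rmax_r]; apply Rmax_r).
    pose proof (ln_pos x ltac:(lra)) as L.
    pose proof (exp_pos (- be * ln x)) as P; fold (Rpower x (- be)) in P.
    assert (Pbd : 0 < (be - 1) * d) by nra.
    assert (Lx : / ((be - 1) * d) <= ln x).
    { rewrite <- (ln_exp (/ ((be - 1) * d))); apply ln_le; [apply exp_pos|auto]. }
    split.
    + rewrite Ropp_involutive.
      replace (Rpower x (- be) / ((be - 1) * ln x ^ 2))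
        with (/ ((be - 1) * ln x) * (Rpower x (- be) / ln x)) by (field; lra).
      assert (/ ((be - 1) * ln x) <= d).
      { rewrite <- (Rinv_inv d); apply Rinv_le_contravar; [now apply Rinv_0_lt_compat|].
        apply Rle_trans with ((be - 1) * / ((be - 1) * d)); [right; field; lra|].
        apply Rmult_le_compat_l; lra. }
      assert (0 < Rpower x (- be) / ln x) by now apply Rdiv_lt_0_compat.
      nra.
    + destruct (Rle_dec 1 d) as [Hd1|Hd1].
      { pose proof (exp_pos (- be * ln (x + 1))); unfold Rpower at 2; nra. }
      pose proof (ratio_sq_lower x d Hd Hx1 ltac:(lra)) as Q.
      apply Rle_trans with (x ^ 2 / (x + 1) ^ 2 * Rpower x (- be)).
      * apply Rmult_le_compat_r; [lra|]; apply Rmult_le_reg_r with ((x + 1) ^ 2); [nra|].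
        unfold Rdiv; rewrite Rmult_assoc, Rinv_l by nra; lra.
      * assert (E : x ^ 2 / (x + 1) ^ 2 = exp (2 * ln x - 2 * ln (x + 1))).
        { unfold Rminus; rewrite exp_plus, exp_Ropp.
          replace (2 * ln x) with (ln (x ^ 2)) by (rewrite ln_pow by lra; simpl; ring).
          replace (2 * ln (x + 1)) with (ln ((x + 1) ^ 2)) by (rewrite ln_pow by lra; simpl; ring).
          rewrite !exp_ln by nra; auto. }
        rewrite E; unfold Rpower; rewrite <- exp_plus; apply exp_le.
        assert (ln x <= ln (x + 1)) by (apply ln_le; lra); nra.
Qed.

(** The weight for sigma = 1/2; here the derivative of [- H] is exactly f / ln. *)
Lemma good_weight_log : good_weight (fun x => / (x * ln x)) (fun x => / ln x) (fun x => - / (x * (ln x) ^ 2)).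
Proof.
  split.
  - intros x Hx; pose proof (ln_pos x Hx); auto_derive; [split; lra|field; lra].
  - intros x Hx; pose proof (ln_pos x Hx); split; apply Rinv_0_lt_compat; nra.
  - intros x y Hxy; pose proof (ln_pos x ltac:(lra)).
    assert (ln x <= ln y) by (apply ln_le; lra); apply Rinv_le_contravar; nra.
  - intros x Hx; pose proof (ln_pos x Hx); right; field; lra.
  - intros x Hx; pose proof (ln_gt_1 x Hx); unfold gfun.
    replace (x / ln x * / (x * ln x)) with (/ ln x * / ln x) by (field; lra).
    assert (0 < / ln x <= 1); [|nra].
    split; [apply Rinv_0_lt_compat; lra|]; rewrite <- Rinv_1; apply Rinv_le_contravar; lra.
  - intros d Hd; exists (Rmax 3 (2 / d)); intros x Hx.
    assert (H3 : 3 <= x) by (eapply Rle_trans; [apply Rmax_l|apply Hx]).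
    assert (Hx1 : 2 / d <= x) by (eapply Rle_trans; [apply Rmax_r|apply Hx]).
    pose proof (ln_gt_1 x H3) as L; split.
    + assert (0 < / (x * ln x) / ln x) by (apply Rdiv_lt_0_compat; [apply Rinv_0_lt_compat; nra|lra]).
      replace (- - / (x * ln x ^ 2)) with (/ (x * ln x) / ln x) by (field; lra); nra.
    + pose proof (ratio_sq_lower x d Hd Hx1 ltac:(lra)) as Q.
      pose proof (ln_plus_1_le x ltac:(lra)) as L1; pose proof (ln_gt_1 (x + 1) ltac:(lra)) as L2.
      assert (Lx : x * ln (x + 1) <= (x + 1) * ln x).
      { apply Rle_trans with (x * (ln x + / x)); [apply Rmult_le_compat_l; lra|].
        rewrite Rmult_plus_distr_l, Rinv_r by lra; lra. }
      apply Rmult_le_reg_r with (x * ln x * ((x + 1) * ln (x + 1))); [repeat apply Rmult_lt_0_compat; lra|].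
      replace ((1 - d) * / (x * ln x) * (x * ln x * ((x + 1) * ln (x + 1))))
        with ((1 - d) * ((x + 1) * ln (x + 1))) by (field; lra).
      replace (/ ((x + 1) * ln (x + 1)) * (x * ln x * ((x + 1) * ln (x + 1)))) with (x * ln x) by (field; lra).
      destruct (Rle_dec 1 d) as [Hd1|Hd1]; [nra|].
      apply Rmult_le_reg_l with (x * (x + 1)); [nra|].
      apply Rle_trans with ((1 - d) * (x + 1) ^ 2 * (x * ln (x + 1))); [right; ring|].
      apply Rle_trans with (x ^ 2 * ((x + 1) * ln x)); [|right; ring].
      apply Rmult_le_compat; auto; nra.
Qed.

(** The condition with [p^al - 1] is replaced by its first-order form in [ln p]. The proportion 2/q
    of log T is lost in the length N; a second 2/q pays for the linearisation and for the additive
    constants. *)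
Lemma resonance_ev (L : C -> C) (a : nat -> C) (m : nat) (alpha : nat -> nat -> C) (sigma : R) (q : nat) (c3 : R) :
  selberg_class_poly L a m alpha -> 0 <= sigma <= 3 -> (5 <= q)%nat -> 0 < c3 ->
  exists y0, 1 <= y0 /\ forall T M ps rho th A0, 1 < T -> 0 < ln T -> y0 <= ln (ln T) ->
    (forall t, T <= t <= 2 * T -> Cmod (L (sigma, t)) <= M) ->
    (forall p, In p ps -> is_prime p) -> NoDup ps -> (forall p, 0 <= rho p) ->
    0 < th <= 1/2 ->
    (forall p, In p ps -> resA a rho p <= A0 /\ resB a sigma rho p <= th) ->
    (forall p, In p ps -> ln (INR p) <= c3 * ln (ln T)) ->
    lsumR (fun p => ln (INR p) * (resA a rho p + resB a sigma rho p)) ps <= (1 - 4 / INR q) * ln T ->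
    1 <= (1 - th) / (1 + A0) * lsumR (resB a sigma rho) ps ->
    exp ((1 - th) / (1 + A0) * lsumR (resB a sigma rho) ps) <= 8 * M.
Proof.
  intros HL Hs Hq Hc3.
  destruct (resonance_primes L a m alpha sigma q HL Hs ltac:(lia)) as (T0 & HT0 & HR).
  assert (Pq : 5 <= INR q) by (replace 5 with (INR 5) by (simpl; ring); apply le_INR; auto).
  destruct (pow_exp_small 2 1 (/ (2 * INR q))) as (y1 & Hy1 & G1); [lra|apply Rinv_0_lt_compat; lra|].
  destruct (pow_exp_small 0 1 (/ (2 * INR q))) as (y2 & Hy2 & G2); [lra|apply Rinv_0_lt_compat; lra|].
  exists (Rmax 1 (Rmax (Rmax y1 y2) (Rmax (ln (ln T0)) (4 * INR q * c3)))); split; [apply Rmax_l|].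
  intros T M ps rho th A0 HT1 Hl HT HM Hp Hnd Hrho Hth HAB Hc HS HZ.
  set (l := ln T) in *; set (y := ln l) in *.
  assert (Y1 : 1 <= y) by (eapply Rle_trans; [apply Rmax_l|apply HT]).
  assert (HT' := Rle_trans _ _ _ (Rmax_r _ _) HT).
  assert (K1 : y1 <= y) by (eapply Rle_trans; [|apply HT']; eapply Rle_trans; [|apply Rmax_l]; apply Rmax_l).
  assert (K2 : y2 <= y) by (eapply Rle_trans; [|apply HT']; eapply Rle_trans; [|apply Rmax_l]; apply Rmax_r).
  assert (K3 : ln (ln T0) <= y) by (eapply Rle_trans; [|apply HT']; eapply Rle_trans; [|apply Rmax_r]; apply Rmax_l).
  assert (K4 : 4 * INR q * c3 <= y) by (eapply Rle_trans; [|apply HT']; eapply Rle_trans; [|apply Rmax_r]; apply Rmax_r).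
  specialize (G1 y K1); specialize (G2 y K2).
  replace (1 * y) with y in G1, G2 by ring; change (y ^ 0) with 1 in G2.
  assert (El : exp y = l) by (unfold y; apply exp_ln; auto).
  rewrite exp_Ropp, El in G1, G2.
  assert (Big : INR q * (y ^ 2 + 1) <= l).
  { apply Rmult_le_reg_r with (/ l); [now apply Rinv_0_lt_compat|]; rewrite Rinv_r by lra.
    replace 1 with (INR q * (/ (2 * INR q) + / (2 * INR q))) at 2 by (field; lra).
    rewrite Rmult_assoc; apply Rmult_le_compat_l; lra. }
  assert (HTT : T0 <= T).
  { apply Rnot_lt_le; intros K.
    assert (L1 : l < ln T0) by (apply ln_increasing; lra).
    assert (L2 : y < ln (ln T0)) by (apply ln_increasing; auto); lra. }
  set (X := Rpower T (/ INR q)) in *.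
  assert (EX : ln (X ^ (q - 2)) = (1 - 2 / INR q) * l).
  { rewrite ln_pow by apply exp_pos; unfold X, Rpower; rewrite ln_exp, minus_INR by lia; fold l.
    simpl; field; lra. }
  assert (PX : 0 < X ^ (q - 2)) by (apply pow_lt, exp_pos).
  assert (X2 : 2 <= X ^ (q - 2)).
  { rewrite <- (exp_ln (X ^ (q - 2))) by auto; rewrite EX.
    pose proof (exp_ineq1_le ((1 - 2 / INR q) * l)).
    assert (1 <= (1 - 2 / INR q) * l); [|lra].
    assert (2 / INR q <= 2 / 5) by (apply Rmult_le_compat_l; [lra|apply Rinv_le_contravar; lra]).
    nra. }
  destruct (nfloor_ex (X ^ (q - 2))) as (N & HN1 & HN2); [lra|].
  assert (HN : (1 <= N)%nat) by (apply INR_le; simpl; lra).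
  pose proof (INR_ge_1 N HN) as PN.
  assert (LN : (1 - 2 / INR q) * l - 1 <= ln (INR N)).
  { rewrite <- EX; apply Rle_trans with (ln (X ^ (q - 2) / 2)).
    - rewrite ln_div by lra; assert (ln 2 <= 1); [|lra].
      rewrite <- (ln_exp 1); apply ln_le; [lra|]; pose proof (exp_ineq1_le 1); lra.
    - apply ln_le; lra. }
  (* With y = ln ln T, [al] lies well between 1 / ln T and 1 / y: [al * ln p <= c3 / y] is small
     enough to linearise [p^al], while a fixed proportion of [al * ln T] still exceeds 1. *)
  set (al := / y ^ 2).
  assert (Py2 : 1 <= y ^ 2) by nra.
  assert (Pal : 0 < al) by (apply Rinv_0_lt_compat; lra).
  apply (HR T N M ps rho al th A0); auto.
  eapply Rle_trans.
  - apply (lsumR_le _ (fun p => al * (1 + / (2 * INR q)) * (ln (INR p) * (resA a rho p + resB a sigma rho p)))).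
    intros p Hin; rewrite <- Rmult_assoc; apply Rmult_le_compat_r.
    { pose proof (resA_pos a rho p); pose proof (resB_pos a sigma rho Hrho p); lra. }
    set (v := al * ln (INR p)).
    assert (Lp : 0 <= ln (INR p)).
    { rewrite <- ln_1; apply ln_le; [lra|]; apply INR_ge_1.
      pose proof (is_prime_ge_2 p (Hp p Hin)); lia. }
    assert (Pv : 0 <= v) by (unfold v; nra).
    assert (Hv : v <= / (4 * INR q)).
    { apply Rle_trans with (al * (c3 * y)); [apply Rmult_le_compat_l; [lra|apply Hc; auto]|].
      unfold al; replace (/ y ^ 2 * (c3 * y)) with (c3 * / y) by (field; lra).
      apply Rmult_le_reg_r with (y * (4 * INR q)); [nra|].
      replace (c3 * / y * (y * (4 * INR q))) with (4 * INR q * c3) by (field; lra).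
      replace (/ (4 * INR q) * (y * (4 * INR q))) with y by (field; lra); auto. }
    assert (V2 : / (4 * INR q) <= / 20) by (apply Rinv_le_contravar; lra).
    destruct (exp_taylor1 v) as [E _]; [rewrite Rabs_pos_eq; lra|].
    unfold Rpower; fold v.
    replace (al * (1 + / (2 * INR q)) * ln (INR p)) with (v * (1 + 2 * / (4 * INR q))) by (unfold v; field; lra).
    nra.
  - rewrite lsumR_scal.
    apply Rle_trans with (al * (1 + / (2 * INR q)) * ((1 - 4 / INR q) * l)).
    { apply Rmult_le_compat_l; auto; apply Rmult_le_pos; [lra|].
      assert (0 < / (2 * INR q)) by (apply Rinv_0_lt_compat; lra); lra. }
    apply Rle_trans with (al * ((1 - 2 / INR q) * l - 1) - 1).
    2: { apply Rplus_le_compat_r, Rmult_le_compat_l; lra. }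
    replace 1 with (al * y ^ 2) at 5 by (unfold al; field; lra).
    rewrite Rmult_assoc, <- Rmult_minus_distr_l; apply Rmult_le_compat_l; [lra|].
    assert (Q : y ^ 2 + 1 <= / INR q * l).
    { apply Rmult_le_reg_l with (INR q); [lra|]; rewrite <- Rmult_assoc, Rinv_r by lra; lra. }
    unfold Rdiv; rewrite Rinv_mult; set (z := / INR q) in *.
    assert (Pz : 0 < z) by (apply Rinv_0_lt_compat; lra).
    assert (0 <= z * l) by nra; assert (0 <= z * z * l) by (apply Rmult_le_pos; nra); nra.
Qed.

(** * Large values *)

Lemma ln_le_small (e : R) : 0 < e -> exists y0, 1 <= y0 /\ forall y, y0 <= y -> ln y <= e * y.
Proof.
  intros He; set (z := 2 / e); assert (Pz : 0 < z) by (apply Rdiv_lt_0_compat; lra).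
  exists (1 + z * z); split; [nra|]; intros y Hy.
  assert (Py : 0 < y) by nra; assert (Ps : 0 < sqrt y) by now apply sqrt_lt_R0.
  pose proof (sqrt_sqrt y ltac:(lra)) as E.
  assert (Hs : z <= sqrt y) by (apply Rnot_lt_le; intros K; nra).
  assert (L : ln (sqrt y) <= sqrt y).
  { rewrite <- (ln_exp (sqrt y)) at 2; apply ln_le; auto; pose proof (exp_ineq1_le (sqrt y)); lra. }
  assert (L2 : ln y = 2 * ln (sqrt y)) by (rewrite <- E at 1; rewrite ln_mult by auto; ring).
  replace (e * y) with (e * sqrt y * sqrt y) by (rewrite Rmult_assoc, E; ring); rewrite L2.
  assert (2 <= e * sqrt y).
  { apply Rle_trans with (e * z); [unfold z; right; field; lra|apply Rmult_le_compat_l; lra]. }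
  nra.
Qed.

(** The starting point lambda of the primes, as an integer. [j = 0] serves sigma > 1/2, where lambda
    is of order log T, and [j = 1] serves sigma = 1/2, where it is of order log T log log T. *)
Lemma floor_scale (K0 e G : R) (j : nat) : 0 < K0 -> 0 < e <= 1/2 -> (j <= 1)%nat ->
  exists y0, 1 <= y0 /\ forall y, y0 <= y -> exists A : nat,
    INR A <= K0 * (exp y * y ^ j) /\ (1 - e) * (K0 * (exp y * y ^ j)) <= INR A /\
    (1 - e) * y <= ln (INR A) <= (1 + e) * y /\ G <= INR A /\ 3 <= INR A.
Proof.
  intros HK He Hj.
  destruct (ln_le_small (e / 2) ltac:(lra)) as (y1 & Hy1 & L1).
  set (B := Rabs G + 6 + / e).
  assert (PB : 0 < / e) by (apply Rinv_0_lt_compat; lra).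
  exists (y1 + (2 * (Rabs (ln K0) + 1)) / e + B / K0).
  pose proof (Rabs_pos (ln K0)) as PK; pose proof (Rabs_pos G) as PG.
  assert (Q1 : 0 < (2 * (Rabs (ln K0) + 1)) / e) by (apply Rdiv_lt_0_compat; lra).
  assert (Q2 : 0 < B / K0) by (apply Rdiv_lt_0_compat; unfold B; lra).
  split; [lra|]; intros y Hy.
  assert (Y1 : 1 <= y) by lra; specialize (L1 y ltac:(lra)).
  assert (LK : Rabs (ln K0) + 1 <= e / 2 * y).
  { apply Rle_trans with (e / 2 * ((2 * (Rabs (ln K0) + 1)) / e)); [right; field; lra|].
    apply Rmult_le_compat_l; lra. }
  set (lam := K0 * (exp y * y ^ j)).
  assert (Pyj : 1 <= y ^ j) by (apply pow_R1_Rle; auto).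
  pose proof (exp_ineq1_le y) as Ey; pose proof (exp_pos y) as Pe.
  assert (Hlam : B <= lam).
  { apply Rle_trans with (K0 * (B / K0)); [right; field; lra|].
    unfold lam; apply Rmult_le_compat_l; [lra|]; nra. }
  assert (Plam : 0 < lam) by (unfold B in Hlam; lra).
  destruct (nfloor_ex lam) as (A & HA1 & HA2); [lra|].
  assert (Lny : 0 <= ln y) by (rewrite <- ln_1; apply ln_le; lra).
  assert (Elam : ln lam = ln K0 + (y + INR j * ln y)).
  { unfold lam; rewrite ln_mult, ln_mult, ln_exp, ln_pow; auto; try lra.
    apply Rmult_lt_0_compat; lra. }
  assert (Hj' : 0 <= INR j * ln y <= ln y).
  { destruct j as [|[|j]]; [simpl; lra|simpl; lra|lia]. }
  assert (KA : Rabs G + 5 + / e <= INR A) by (unfold B in Hlam; lra).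
  pose proof (Rle_abs (ln K0)); pose proof (Rle_abs (- ln K0)) as K2; rewrite Rabs_Ropp in K2.
  pose proof (Rle_abs G).
  exists A; repeat split; try lra.
  - assert (1 <= e * lam).
    { apply Rle_trans with (e * / e); [right; field; lra|]; apply Rmult_le_compat_l; [lra|].
      unfold B in Hlam; lra. }
    lra.
  - apply Rle_trans with (ln (lam / 2)).
    + rewrite ln_div by lra; assert (ln 2 <= 1); [|lra].
      rewrite <- (ln_exp 1); apply ln_le; [lra|]; pose proof (exp_ineq1_le 1); lra.
    + apply ln_le; lra.
  - apply Rle_trans with (ln lam); [apply ln_le; lra|lra].
Qed.

(** The factor 8 is below [exp 3] and is absorbed in the loss from [10 * e] to [12 * e]. *)
Lemma finish_bound (Z V M e : R) : 0 < e -> (1 - 10 * e) * V <= Z -> 3 <= e * V -> exp Z <= 8 * M ->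
  exp ((1 - 12 * e) * V) <= M.
Proof.
  intros He HZ HV HM.
  apply Rle_trans with (exp (Z - 3)); [apply exp_le; lra|].
  unfold Rminus; rewrite exp_plus, exp_Ropp.
  assert (E3 : exp 3 = exp 1 * exp 1 * exp 1) by (rewrite <- !exp_plus; f_equal; ring).
  pose proof (exp_ineq1_le 1) as E1.
  assert (4 <= exp 1 * exp 1) by nra.
  assert (E8 : 8 <= exp 3) by (rewrite E3; nra).
  apply Rmult_le_reg_r with (exp 3); [apply exp_pos|].
  rewrite Rmult_assoc, Rinv_l, Rmult_1_r by (apply Rgt_not_eq, exp_pos).
  assert (0 <= M) by (pose proof (exp_pos Z); lra); nra.
Qed.

(** Shrinking lambda by [1 - 5 * e] pays for the losses in the constraint, and the losses in the
    exponent stay within [10 * e]. The first and last inequalities serve sigma > 1/2, the middle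
    ones sigma = 1/2. *)
Lemma eta_budget (e : R) : 0 < e <= 1/24 ->
  (1 + e) ^ 3 * (1 - 5 * e) <= 1 - e /\ (1 + e) ^ 2 * (1 - 5 * e) <= (1 - e) * (1 - e) /\
  (1 - 10 * e) * (1 + e) ^ 2 <= (1 - e) ^ 3 * (1 - 5 * e) /\ (1 - 10 * e) * (1 + e) <= (1 - e) ^ 3 * (1 - 5 * e).
Proof. intros He; repeat split; nra. Qed.

Lemma eta_V_ge (e V : R) : 0 < e <= 1/24 -> 3 <= e * V -> 1 <= (1 - 10 * e) * V.
Proof. intros He HV; assert (0 < V) by nra; nra. Qed.

(** For m = 0 all [a p] would vanish, against [kappa > 0]. *)
Lemma selberg_m_pos (L : C -> C) (a : nat -> C) (m : nat) (alpha : nat -> nat -> C) (kappa : R) :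
  selberg_class_poly L a m alpha -> 0 < kappa -> selberg_normality a kappa -> 1 <= INR m.
Proof.
  intros HL Hk HS; destruct m as [|m]; [|apply INR_ge_1; lia]; exfalso.
  destruct (psum_asymp a kappa HS (kappa / 2) ltac:(lra)) as (n & Hn & P).
  destruct (P n (Nat.le_refl n)) as [P1 _].
  assert (P3 : 3 <= INR n) by (replace 3 with (INR 3) by (simpl; ring); apply le_INR; auto).
  assert (E : psum a n = 0).
  { unfold psum; generalize n; induction n0 as [|k IH]; cbn [sum_f_R0]; [|rewrite IH];
      destruct (is_prime_dec _) as [Hp|]; try lra;
      pose proof (selberg_coef_le L a 0 alpha _ HL Hp) as Q; simpl in Q;
      (replace (Cmod (a _)) with 0 by (apply Rle_antisym; [apply Cmod_ge_0|exact Q])); ring. }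
  assert (0 < gfun (INR n)).
  { unfold gfun; apply Rdiv_lt_0_compat; [lra|]; pose proof (ln_gt_1 (INR n) P3); lra. }
  rewrite E in P1; nra.
Qed.

Lemma sq_coef_le (a : nat -> C) (mm : R) (p : nat) : Cmod (a p) <= mm -> Cmod (a p) ^ 2 <= mm ^ 2.
Proof. intros H; apply pow_incr; split; [apply Cmod_ge_0|auto]. Qed.

Lemma Rpower_mono_base_ge (t s : R) : 0 < t <= 1 -> 0 <= s <= 1 -> t <= Rpower t s.
Proof.
  intros Ht Hs; rewrite <- (exp_ln t) at 1 by lra; unfold Rpower; apply exp_le.
  assert (ln t <= 0) by (rewrite <- ln_1; apply ln_le; lra); nra.
Qed.

(** Here rho(p) = c (x/p)^sigma on x < p <= b x. Over this range ln p is nearly ln x, so the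
    constraint and the exponent both reduce to the single sum of |a(p)|^2 p^(-2 sigma). *)
Lemma large_values_right (L : C -> C) (a : nat -> C) (m : nat) (alpha : nat -> nat -> C) (kappa sigma e : R) :
  selberg_class_poly L a m alpha -> 0 < kappa -> selberg_normality a kappa ->
  1/2 < sigma < 1 -> 0 < e <= 1/24 ->
  exists y0, 1 <= y0 /\ forall T M, 1 < T -> 0 < ln T -> y0 <= ln (ln T) ->
    (forall t, T <= t <= 2 * T -> Cmod (L (sigma, t)) <= M) ->
    exp ((1 - 12 * e) * (Rpower kappa sigma * Rpower (INR m) (1 - 2 * sigma)
       * (Rpower (3 - 2 * sigma) (3 / 2 - sigma) / (2 * Rpower (2 * sigma - 1) (1 / 2)))
       * (Rpower (ln T) (1 - sigma) / ln (ln T)))) <= M.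
Proof.
  intros HL Hk HS Hs He.
  pose proof (selberg_m_pos L a m alpha kappa HL Hk HS) as Hm.
  set (mm := INR m) in *; set (l1 := ln (2 * sigma - 1)); set (l3 := ln (3 - 2 * sigma)).
  set (lk := ln kappa); set (lm := ln mm).
  (* [K1] is (3 - 2 sigma) m^2 / kappa, so that [kappa * c^2 * K1 = 2 sigma - 1] and x = K1 log T
     saturates the constraint. Everything is written as an exponential so that identities between
     powers become linear in the logarithms. *)
  set (c := exp ((l1 - l3) / 2 - lm)); set (K1 := exp (l3 - lk + 2 * lm)).
  assert (Pc : 0 < c) by apply exp_pos; assert (PK1 : 0 < K1) by apply exp_pos.
  assert (Pm2 : 1 <= mm ^ 2) by nra.
  assert (E1 : exp l1 = 2 * sigma - 1) by (apply exp_ln; lra).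
  assert (E3 : exp l3 = 3 - 2 * sigma) by (apply exp_ln; lra).
  assert (Ek : exp lk = kappa) by (apply exp_ln; lra).
  assert (Em : exp lm = mm) by (apply exp_ln; lra).
  assert (Ec2 : kappa * c ^ 2 * K1 = 2 * sigma - 1).
  { rewrite <- Ek, <- E1; unfold c, K1; simpl; rewrite Rmult_1_r, <- !exp_plus; f_equal; field. }
  assert (EmC : 1 + mm ^ 2 * c ^ 2 = 2 / (3 - 2 * sigma)).
  { assert (Q : mm ^ 2 * c ^ 2 * exp l3 = exp l1).
    { rewrite <- Em; unfold c; simpl; rewrite !Rmult_1_r, <- !exp_plus; f_equal; field. }
    rewrite E1, E3 in Q; apply Rmult_eq_reg_r with (3 - 2 * sigma); [|lra].
    replace (2 / (3 - 2 * sigma) * (3 - 2 * sigma)) with 2 by (field; lra); lra. }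
  set (CL := Rpower kappa sigma * Rpower mm (1 - 2 * sigma)
       * (Rpower (3 - 2 * sigma) (3 / 2 - sigma) / (2 * Rpower (2 * sigma - 1) (1 / 2)))).
  (* The stated constant is what the resonator yields at x = K1 log T: c x^sigma times the prime
     sum, divided by 1 + m^2 c^2. *)
  assert (ECL : CL = kappa * c * Rpower K1 (1 - sigma) / ((1 + mm ^ 2 * c ^ 2) * (2 * sigma - 1))).
  { transitivity (/ 2 * exp (sigma * lk + (1 - 2 * sigma) * lm + (3 / 2 - sigma) * l3 + - (1 / 2 * l1))).
    - unfold CL, Rpower; fold lk lm l1 l3; unfold Rdiv at 1; rewrite Rinv_mult, <- exp_Ropp.
      rewrite !exp_plus; ring.
    - rewrite EmC.
      replace (kappa * c * Rpower K1 (1 - sigma) / (2 / (3 - 2 * sigma) * (2 * sigma - 1)))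
        with (/ 2 * (kappa * c * Rpower K1 (1 - sigma) * (3 - 2 * sigma) * / (2 * sigma - 1))) by (field; lra).
      rewrite <- E1, <- E3, <- Ek, <- exp_Ropp; unfold c, Rpower, K1; rewrite ln_exp, <- !exp_plus.
      f_equal; f_equal; field. }
  (* Taking x slightly below [K1 * ln T] leaves room for the errors in the constraint. *)
  set (th := 1 - 5 * e); set (K0 := th * K1).
  assert (Hth : 0 < th <= 1) by (unfold th; lra).
  assert (PK0 : 0 < K0) by (unfold K0; nra).
  set (d := kappa * e / 3); assert (Pd : 0 < d) by (unfold d; nra).
  (* The part of the sum beyond b x is a proportion of about b^(1 - 2 sigma), here at most e/3. *)
  destruct (INR_unbounded (exp (ln (3 / e) / (2 * sigma - 1)) + 2)) as (b & Hb).
  assert (Pe3 : 0 < 3 / e) by (apply Rdiv_lt_0_compat; lra).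
  assert (Pb0 := exp_pos (ln (3 / e) / (2 * sigma - 1))).
  assert (Pb : 2 <= INR b) by lra.
  assert (Lb : 0 <= ln (INR b)) by (rewrite <- ln_1; apply ln_le; lra).
  assert (Hbeta : Rpower (INR b) (1 - 2 * sigma) <= e / 3).
  { rewrite <- (exp_ln (e / 3)) by lra; unfold Rpower; apply exp_le.
    replace (e / 3) with (/ (3 / e)) by (field; lra); rewrite ln_Rinv by auto.
    assert (ln (3 / e) / (2 * sigma - 1) <= ln (INR b)).
    { rewrite <- (ln_exp (ln (3 / e) / (2 * sigma - 1))); apply ln_le; lra. }
    assert (ln (3 / e) <= (2 * sigma - 1) * ln (INR b)); [|lra].
    apply Rle_trans with ((2 * sigma - 1) * (ln (3 / e) / (2 * sigma - 1))); [right; field; lra|].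
    apply Rmult_le_compat_l; lra. }
  destruct (INR_unbounded (5 + 4 / e)) as (q & Hq).
  assert (Pe4 : 0 < 4 / e) by (apply Rdiv_lt_0_compat; lra).
  assert (Hq5 : (5 <= q)%nat) by (apply INR_le; simpl; lra).
  assert (Hq4 : 4 / INR q <= e).
  { apply Rmult_le_reg_r with (INR q); [lra|]; unfold Rdiv; rewrite Rmult_assoc, Rinv_l by lra.
    apply Rle_trans with (e * (4 / e)); [right; field; lra|apply Rmult_le_compat_l; lra]. }
  destruct (resonance_ev L a m alpha sigma q 3 HL ltac:(lra) Hq5 ltac:(lra)) as (y1 & Hy1 & RE).
  pose proof (good_weight_power (2 * sigma) ltac:(lra)) as GW.
  destruct (prime_sum_asymp _ _ _ GW a kappa Hk HS d Pd) as (n0 & Hn0 & PS).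
  (* In order, the terms ensure the prime asymptotics from [A] on, [resB <= e], [c s <= e (c s)^2]
     so that [resB] is negligible beside [resA] in the constraint, and [ln b <= e ln x]. *)
  set (G := INR n0 + (mm ^ 2 * c / e) ^ 2 + (/ (c * e)) ^ 2 + exp (ln (INR b) / e)).
  destruct (floor_scale K0 e G 0 PK0 ltac:(lra) ltac:(lia)) as (y2 & Hy2 & FS).
  assert (PCL : 0 < CL).
  { unfold CL; apply Rmult_lt_0_compat; [apply Rmult_lt_0_compat; apply exp_pos|].
    apply Rdiv_lt_0_compat; [apply exp_pos|]; apply Rmult_lt_0_compat; [lra|apply exp_pos]. }
  destruct (pow_exp_small 1 (1 - sigma) (e * CL / 3)) as (y3 & Hy3 & VS); [lra|nra|].
  exists (y1 + y2 + y3 + ln (INR b)); split; [lra|]; intros T M HT1 Hl HT HM.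
  set (l := ln T) in *; set (y := ln l) in *.
  assert (El : exp y = l) by (unfold y; apply exp_ln; auto).
  destruct (FS y ltac:(lra)) as (A & F1 & F2 & F3 & F4 & F5); clear FS.
  rewrite El in F1, F2; simpl pow in F1, F2; rewrite Rmult_1_r in F1, F2.
  set (x := INR A) in *.
  assert (PG1 : 0 <= (mm ^ 2 * c / e) ^ 2) by apply pow2_ge_0.
  assert (PG2 : 0 <= (/ (c * e)) ^ 2) by apply pow2_ge_0.
  pose proof (exp_pos (ln (INR b) / e)) as PG3; pose proof (pos_INR n0) as PG4.
  assert (HA : (n0 <= A)%nat) by (apply INR_le; fold x; unfold G in F4; lra).
  set (k := ((b - 1) * A)%nat).
  assert (Hb1 : (2 <= b)%nat) by (apply INR_le; simpl; lra).
  assert (HAk : (A + k = b * A)%nat) by (unfold k; nia).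
  set (ps := primes_in A k).
  set (s := Rpower x sigma); assert (Ps : 0 < s) by apply exp_pos.
  set (rho := fun p => c * (s * Rpower (INR p) (- sigma))).
  assert (Hrho : forall p, 0 <= rho p).
  { intros p; unfold rho; apply Rmult_le_pos; [lra|]; apply Rmult_le_pos; [lra|left; apply exp_pos]. }
  set (f := fun p : nat => Rpower (INR p) (- (2 * sigma))).
  assert (Ef : forall p, f p = Rpower (INR p) (- sigma) * Rpower (INR p) (- sigma)).
  { intros p; unfold f; rewrite <- Rpower_plus; f_equal; ring. }
  assert (EA : forall p, resA a rho p = c ^ 2 * s ^ 2 * (Cmod (a p) ^ 2 * f p)).
  { intros p; unfold resA, rho; rewrite Ef; ring. }
  assert (EB : forall p, resB a sigma rho p = c * s * (Cmod (a p) ^ 2 * f p)).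
  { intros p; unfold resB, rho; rewrite Ef; ring. }
  set (Sg := lsumR (fun p => Cmod (a p) ^ 2 * f p) ps).
  destruct (PS A k HA) as [SL SU]; fold f in SL, SU; fold ps in SL, SU.
  change (lsumR (fun p => Cmod (a p) ^ 2 * Rpower (INR p) (- (2 * sigma))) ps) with Sg in SL, SU.
  rewrite HAk in SL; fold x in SL, SU.
  assert (Lx : 0 < ln x) by (apply ln_pos; lra).
  set (Hx := Rpower x (1 - 2 * sigma) / ((2 * sigma - 1) * ln x)) in *.
  assert (PHx : 0 < Hx) by (apply Rdiv_lt_0_compat; [apply exp_pos|nra]).
  assert (Hbx : Rpower (INR (b * A)) (1 - 2 * sigma) / ((2 * sigma - 1) * ln (INR (b * A))) <= e / 3 * Hx).
  { rewrite mult_INR; fold x; rewrite <- Rpower_mult_distr, ln_mult by lra.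
    unfold Hx, Rdiv; rewrite (Rmult_assoc (Rpower (INR b) _)), <- (Rmult_assoc (e * / 3)), (Rmult_comm (e * / 3)).
    rewrite (Rmult_comm (Rpower (INR b) (1 - 2 * sigma))), !(Rmult_assoc (Rpower x (1 - 2 * sigma))).
    rewrite !Rmult_assoc; apply Rmult_le_compat_l; [left; apply exp_pos|].
    rewrite <- (Rmult_assoc e); rewrite (Rmult_comm (/ _) (Rpower (INR b) _)).
    apply Rmult_le_compat; auto; [left; apply exp_pos|left; apply Rinv_0_lt_compat; nra|].
    apply Rinv_le_contravar; nra. }
  assert (SL' : kappa * (1 - e) * Hx <= Sg).
  { eapply Rle_trans; [|apply SL]; fold Hx.
    assert (Q : (kappa - d) * (Hx - e / 3 * Hx) <= (kappa - d) * (Hx - Rpower (INR (b * A)) (1 - 2 * sigma) / ((2 * sigma - 1) * ln (INR (b * A))))).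
    { apply Rmult_le_compat_l; [unfold d; nra|lra]. }
    assert (kappa * (1 - e) * Hx <= (kappa - d) * (Hx - e / 3 * Hx) - d * Hx); [|lra].
    replace ((kappa - d) * (Hx - e / 3 * Hx) - d * Hx) with (((kappa - d) * (1 - e / 3) - d) * Hx) by ring.
    apply Rmult_le_compat_r; [lra|]; unfold d; nra. }
  assert (SU' : Sg <= kappa * (1 + e) * Hx).
  { eapply Rle_trans; [apply SU|]; apply Rmult_le_compat_r; [lra|]; unfold d; nra. }
  assert (Esx : s * Rpower x (1 - 2 * sigma) = Rpower x (1 - sigma)).
  { unfold s; rewrite <- Rpower_plus; f_equal; ring. }
  assert (Essx : s ^ 2 * Rpower x (1 - 2 * sigma) = x).
  { simpl; rewrite Rmult_1_r, Rmult_assoc, Esx; unfold s; rewrite <- Rpower_plus.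
    replace (sigma + (1 - sigma)) with 1 by ring; apply Rpower_1; lra. }
  assert (Sroot : forall w, 0 < w -> w ^ 2 <= x -> w <= s).
  { intros w Hw Hwx; unfold s; rewrite <- (exp_ln w) by auto; unfold Rpower; apply exp_le.
    assert (2 * ln w <= ln x).
    { replace (2 * ln w) with (ln (w ^ 2)) by (rewrite ln_pow by auto; simpl; ring).
      apply ln_le; auto; apply pow_lt; auto. }
    nra. }
  assert (S1 : / (c * e) <= s).
  { apply Sroot; [apply Rinv_0_lt_compat; nra|unfold G in F4; lra]. }
  assert (S2 : mm ^ 2 * c / e <= s).
  { apply Sroot; [apply Rdiv_lt_0_compat; nra|unfold G in F4; lra]. }
  assert (Lbx : ln (INR b) <= e * ln x).
  { apply Rle_trans with (e * (ln (INR b) / e)); [right; field; lra|]; apply Rmult_le_compat_l; [lra|].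
    rewrite <- (ln_exp (ln (INR b) / e)); apply ln_le; [auto|unfold G in F4; lra]. }
  assert (Hps : forall p, In p ps -> is_prime p /\ x <= INR p /\ ln (INR p) <= (1 + e) * ln x /\ ln (INR p) <= 3 * y
                 /\ Cmod (a p) ^ 2 <= mm ^ 2 /\ s * Rpower (INR p) (- sigma) <= 1 /\ s * Rpower (INR p) (- sigma) * s <= s).
  { intros p Hp; apply primes_in_spec in Hp; destruct Hp as [Pp [B1 B2]].
    assert (X1 : x <= INR p) by (apply le_INR; lia).
    assert (X2 : INR p <= INR b * x) by (unfold x; rewrite <- mult_INR; apply le_INR; lia).
    assert (X3 : ln (INR p) <= ln (INR b) + ln x) by (rewrite <- ln_mult by lra; apply ln_le; lra).
    assert (X4 : s * Rpower (INR p) (- sigma) <= 1).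
    { unfold s, Rpower; rewrite <- exp_plus, <- exp_0; apply exp_le.
      assert (ln x <= ln (INR p)) by (apply ln_le; lra); nra. }
    split; [auto|]; split; [auto|]; split; [lra|]; split; [nra|]; split.
    - apply sq_coef_le; unfold mm; apply (selberg_coef_le L a m alpha); auto.
    - split; [auto|nra]. }
  assert (ZB : lsumR (resB a sigma rho) ps = c * s * Sg).
  { unfold Sg; rewrite <- lsumR_scal; f_equal; apply functional_extensionality; intros p; apply EB. }
  destruct (eta_budget e He) as (Bu1 & _ & _ & Bu2).
  set (V := CL * (Rpower l (1 - sigma) / y)).
  assert (Y1 : 1 <= y) by lra.
  assert (PV : 3 <= e * V).
  { specialize (VS y ltac:(lra)); rewrite pow_1, exp_Ropp in VS.
    assert (EP : Rpower l (1 - sigma) = exp ((1 - sigma) * y)) by reflexivity.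
    unfold V; rewrite EP; pose proof (exp_pos ((1 - sigma) * y)) as PE.
    set (Ex := exp ((1 - sigma) * y)) in *.
    apply Rmult_le_reg_r with (y * / Ex); [apply Rmult_lt_0_compat; [lra|now apply Rinv_0_lt_compat]|].
    replace (e * (CL * (Ex / y)) * (y * / Ex)) with (e * CL) by (field; lra); lra. }
  assert (ZV : (1 - 10 * e) * V <= (1 - e) / (1 + mm ^ 2 * c ^ 2) * lsumR (resB a sigma rho) ps).
  { rewrite ZB.
    assert (Pmc : 0 < 1 + mm ^ 2 * c ^ 2) by nra.
    apply Rle_trans with ((1 - e) / (1 + mm ^ 2 * c ^ 2) * (c * s * (kappa * (1 - e) * Hx))).
    2: { apply Rmult_le_compat_l; [left; apply Rdiv_lt_0_compat; lra|].
         apply Rmult_le_compat_l; auto; nra. }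
    replace ((1 - e) / (1 + mm ^ 2 * c ^ 2) * (c * s * (kappa * (1 - e) * Hx)))
      with ((1 - e) ^ 2 * (kappa * c / ((1 + mm ^ 2 * c ^ 2) * (2 * sigma - 1)))
            * ((s * Rpower x (1 - 2 * sigma)) / ln x)) by (unfold Hx; field; lra).
    rewrite Esx.
    (* Since [1 - sigma] lies in [0, 1], a power of a number in (0, 1] is at least that number; the
       crude loss [(1 - e) * th] is affordable. *)
    assert (XP : (1 - e) * th * (Rpower K1 (1 - sigma) * Rpower l (1 - sigma)) <= Rpower x (1 - sigma)).
    { apply Rle_trans with (Rpower ((1 - e) * th * (K1 * l)) (1 - sigma)).
      - assert (Pet : 0 < (1 - e) * th <= 1) by (split; [apply Rmult_lt_0_compat; lra|rewrite <- (Rmult_1_l 1); apply Rmult_le_compat; lra]).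
        rewrite <- (Rpower_mult_distr ((1 - e) * th) (K1 * l)), <- (Rpower_mult_distr K1 l)
          by (try apply Rmult_lt_0_compat; lra).
        apply Rmult_le_compat_r; [left; apply Rmult_lt_0_compat; apply exp_pos|].
        apply Rpower_mono_base_ge; lra.
      - unfold Rpower; apply exp_le, Rmult_le_compat_l; [lra|]; apply ln_le.
        + repeat apply Rmult_lt_0_compat; lra.
        + unfold K0 in F2; lra. }
    unfold V; rewrite ECL; set (Kc := kappa * c / ((1 + mm ^ 2 * c ^ 2) * (2 * sigma - 1))).
    assert (PKc : 0 < Kc) by (apply Rdiv_lt_0_compat; apply Rmult_lt_0_compat; lra).
    set (P1 := Rpower K1 (1 - sigma)) in *; set (P2 := Rpower l (1 - sigma)) in *.
    assert (PP1 : 0 < P1) by apply exp_pos; assert (PP2 : 0 < P2) by apply exp_pos.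
    replace ((1 - 10 * e) * (kappa * c * P1 / ((1 + mm ^ 2 * c ^ 2) * (2 * sigma - 1)) * (P2 / y)))
      with (Kc * ((1 - 10 * e) * (P1 * P2) / y)) by (unfold Kc; field; lra).
    replace ((1 - e) ^ 2 * Kc * (Rpower x (1 - sigma) / ln x))
      with (Kc * ((1 - e) ^ 2 * Rpower x (1 - sigma) / ln x)) by (field; lra).
    apply Rmult_le_compat_l; [lra|].
    apply Rle_trans with ((1 - e) ^ 2 * ((1 - e) * th * (P1 * P2)) / ((1 + e) * y)).
    - apply Rmult_le_reg_r with ((1 + e) * y); [apply Rmult_lt_0_compat; lra|].
      replace ((1 - 10 * e) * (P1 * P2) / y * ((1 + e) * y)) with ((1 - 10 * e) * (1 + e) * (P1 * P2)) by (field; lra).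
      replace ((1 - e) ^ 2 * ((1 - e) * th * (P1 * P2)) / ((1 + e) * y) * ((1 + e) * y))
        with ((1 - e) ^ 3 * th * (P1 * P2)) by (field; lra).
      apply Rmult_le_compat_r; [left; apply Rmult_lt_0_compat; lra|]; unfold th; auto.
    - unfold Rdiv; apply Rmult_le_compat.
      + apply Rmult_le_pos; [apply pow2_ge_0|]; left; repeat apply Rmult_lt_0_compat; lra.
      + left; apply Rinv_0_lt_compat, Rmult_lt_0_compat; lra.
      + apply Rmult_le_compat_l; [apply pow2_ge_0|auto].
      + apply Rinv_le_contravar; lra. }
  assert (ZV1 : 1 <= (1 - e) / (1 + mm ^ 2 * c ^ 2) * lsumR (resB a sigma rho) ps).
  { eapply Rle_trans; [|apply ZV]; now apply eta_V_ge. }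
  apply finish_bound with (Z := (1 - e) / (1 + mm ^ 2 * c ^ 2) * lsumR (resB a sigma rho) ps); auto; [lra|].
  apply (RE T M ps rho e (mm ^ 2 * c ^ 2)); auto; try lra.
  - fold l y; lra.
  - intros p Hp; apply Hps; auto.
  - apply primes_in_NoDup.
  - intros p Hp; destruct (Hps p Hp) as (Q1 & Q2 & Q3 & Q4 & Q5 & Q6 & Q7).
    pose proof (exp_pos (- sigma * ln (INR p))) as PP; fold (Rpower (INR p) (- sigma)) in PP.
    pose proof (pow2_ge_0 (Cmod (a p))) as PA2.
    set (pi := Rpower (INR p) (- sigma)) in *; set (a2 := Cmod (a p) ^ 2) in *.
    assert (Psp : 0 < s * pi) by (apply Rmult_lt_0_compat; lra).
    assert (Psp2 : 0 <= (s * pi) * (s * pi) <= 1).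
    { split; [apply Rmult_le_pos; lra|]; rewrite <- (Rmult_1_l 1); apply Rmult_le_compat; lra. }
    split.
    + rewrite EA, Ef; fold pi a2.
      replace (c ^ 2 * s ^ 2 * (a2 * (pi * pi))) with (a2 * c ^ 2 * ((s * pi) * (s * pi))) by ring.
      rewrite <- (Rmult_1_r (mm ^ 2 * c ^ 2)); apply Rmult_le_compat; try lra.
      * apply Rmult_le_pos; [lra|apply pow2_ge_0].
      * apply Rmult_le_compat_r; [apply pow2_ge_0|auto].
    + rewrite EB, Ef; fold pi a2.
      replace (c * s * (a2 * (pi * pi))) with (a2 * c * ((s * pi) * pi)) by ring.
      assert (T1 : (s * pi) * pi <= / s).
      { apply Rmult_le_reg_r with s; [lra|]; rewrite Rinv_l by lra.
        replace (s * pi * pi * s) with ((s * pi) * (s * pi)) by ring; lra. }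
      apply Rle_trans with (mm ^ 2 * c * / s).
      * apply Rmult_le_compat; auto; [apply Rmult_le_pos; lra|apply Rmult_le_pos; lra|apply Rmult_le_compat_r; lra].
      * apply Rmult_le_reg_r with s; [lra|]; rewrite Rmult_assoc, Rinv_l by lra.
        apply Rle_trans with (e * (mm ^ 2 * c / e)); [right; field; lra|apply Rmult_le_compat_l; lra].
  - intros p Hp; apply Hps; auto.
  - apply Rle_trans with ((1 - e) * l); [|fold l; apply Rmult_le_compat_r; lra].
    eapply Rle_trans.
    + apply (lsumR_le _ (fun p => (1 + e) * ln x * ((c ^ 2 * s ^ 2 + c * s) * (Cmod (a p) ^ 2 * f p)))).
      intros p Hp; destruct (Hps p Hp) as (Q1 & Q2 & Q3 & Q4 & Q5 & Q6 & Q7).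
      rewrite EA, EB, <- Rmult_plus_distr_r; apply Rmult_le_compat_r; auto.
      assert (0 < c * s) by (apply Rmult_lt_0_compat; lra).
      replace (c ^ 2 * s ^ 2 + c * s) with (c * s * (c * s) + c * s) by ring.
      apply Rmult_le_pos; [|apply Rmult_le_pos; [apply pow2_ge_0|left; apply exp_pos]].
      apply Rplus_le_le_0_compat; [apply Rmult_le_pos|]; lra.
    + rewrite lsumR_scal, lsumR_scal; fold Sg.
      (* Three factors 1 + e accumulate: from ln p against ln x, from [resB] against [resA], and
         from the prime sum. *)
      apply Rle_trans with ((1 + e) * ln x * ((c ^ 2 * s ^ 2 * (1 + e)) * (kappa * (1 + e) * Hx))).
      { assert (Pcs : 0 < c * s) by (apply Rmult_lt_0_compat; lra).
        replace (c ^ 2 * s ^ 2 + c * s) with (c * s * (c * s + 1)) by ring.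
        replace (c ^ 2 * s ^ 2 * (1 + e)) with (c * s * (c * s + e * (c * s))) by ring.
        apply Rmult_le_compat_l; [apply Rmult_le_pos; lra|]; apply Rmult_le_compat; auto.
        - apply Rmult_le_pos; lra.
        - apply Rle_trans with (kappa * (1 - e) * Hx); auto; apply Rmult_le_pos; [apply Rmult_le_pos; lra|lra].
        - apply Rmult_le_compat_l; [lra|]; apply Rplus_le_compat_l.
          apply Rle_trans with (e * (c * / (c * e))); [right; field; lra|].
          apply Rmult_le_compat_l; [lra|]; apply Rmult_le_compat_l; lra. }
      replace ((1 + e) * ln x * (c ^ 2 * s ^ 2 * (1 + e) * (kappa * (1 + e) * Hx)))
        with ((1 + e) ^ 3 * (kappa * c ^ 2 / (2 * sigma - 1)) * (s ^ 2 * Rpower x (1 - 2 * sigma)))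
        by (unfold Hx; field; lra).
      rewrite Essx.
      assert (PPk : 0 < kappa * c ^ 2 / (2 * sigma - 1)) by (apply Rdiv_lt_0_compat; [apply Rmult_lt_0_compat; [|apply pow_lt]|]; lra).
      assert (Pe1 : 0 < (1 + e) ^ 3) by (apply pow_lt; lra).
      apply Rle_trans with ((1 + e) ^ 3 * (kappa * c ^ 2 / (2 * sigma - 1)) * (K0 * l)).
      { apply Rmult_le_compat_l; [apply Rmult_le_pos; lra|auto]. }
      replace ((1 + e) ^ 3 * (kappa * c ^ 2 / (2 * sigma - 1)) * (K0 * l))
        with ((1 + e) ^ 3 * th * l * (kappa * c ^ 2 * K1 / (2 * sigma - 1))) by (unfold K0; field; lra).
      rewrite Ec2; replace ((2 * sigma - 1) / (2 * sigma - 1)) with 1 by (field; lra).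
      rewrite Rmult_1_r; apply Rmult_le_compat_r; [lra|]; unfold th; auto.
Qed.

(** Here rho(p) = sqrt (x/p) / ln p on x < p <= x^b. The factor ln p in the constraint cancels one
    of the logarithms in rho^2, so both conditions involve the sum of |a(p)|^2 / (p ln p), about
    kappa / ln x. *)
Lemma large_values_half (L : C -> C) (a : nat -> C) (m : nat) (alpha : nat -> nat -> C) (kappa e : R) :
  selberg_class_poly L a m alpha -> 0 < kappa -> selberg_normality a kappa -> 0 < e <= 1/24 ->
  exists y0, 1 <= y0 /\ forall T M, 1 < T -> 0 < ln T -> y0 <= ln (ln T) ->
    (forall t, T <= t <= 2 * T -> Cmod (L ((1 / 2)%R, t)) <= M) ->
    exp ((1 - 12 * e) * (sqrt kappa * (sqrt (ln T) / sqrt (ln (ln T))))) <= M.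
Proof.
  intros HL Hk HS He.
  pose proof (selberg_m_pos L a m alpha kappa HL Hk HS) as Hm; set (mm := INR m) in *.
  assert (Pm2 : 1 <= mm ^ 2) by nra.
  (* The constraint reads kappa x / ln x <= log T approximately; as ln x is close to log log T, x is
     about log T log log T / kappa. *)
  set (th := 1 - 5 * e); set (K0 := th / kappa).
  assert (Hth : 0 < th <= 1) by (unfold th; lra).
  assert (PK0 : 0 < K0) by (apply Rdiv_lt_0_compat; lra).
  assert (Psk : 0 < sqrt kappa) by now apply sqrt_lt_R0.
  set (d := kappa * e / 3); assert (Pd : 0 < d) by (unfold d; nra).
  assert (Pe3 : 0 < 3 / e) by (apply Rdiv_lt_0_compat; lra).
  (* The sum from x to x^b is proportional to (1 - 1/b) / ln x, and 1/b is made at most e/3. *)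
  destruct (INR_unbounded (3 / e + 2)) as (b & Hb).
  assert (Pb : 2 <= INR b) by lra.
  assert (Hb1 : (2 <= b)%nat) by (apply INR_le; simpl; lra).
  assert (Hbeta : / INR b <= e / 3).
  { replace (e / 3) with (/ (3 / e)) by (field; lra); apply Rinv_le_contravar; lra. }
  destruct (INR_unbounded (5 + 4 / e)) as (q & Hq).
  assert (Pe4 : 0 < 4 / e) by (apply Rdiv_lt_0_compat; lra).
  assert (Hq5 : (5 <= q)%nat) by (apply INR_le; simpl; lra).
  assert (Hq4 : 4 / INR q <= e).
  { apply Rmult_le_reg_r with (INR q); [lra|]; unfold Rdiv; rewrite Rmult_assoc, Rinv_l by lra.
    apply Rle_trans with (e * (4 / e)); [right; field; lra|apply Rmult_le_compat_l; lra]. }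
  destruct (resonance_ev L a m alpha (1 / 2) q (2 * INR b) HL ltac:(lra) Hq5 ltac:(lra)) as (y1 & Hy1 & RE).
  destruct (prime_sum_asymp _ _ _ good_weight_log a kappa Hk HS d Pd) as (n0 & Hn0 & PS).
  assert (Peb : 0 < e / (2 * INR b)) by (apply Rdiv_lt_0_compat; lra).
  (* This yields [b ln x <= e sqrt x], so ln p is at most [e * s] on the whole range and the [resB]
     part of the constraint is at most a proportion [e] of the [resA] part. *)
  destruct (ln_le_small (e / (2 * INR b)) Peb) as (z0 & Hz0 & LZ).
  set (G := INR n0 + z0 ^ 2 + exp (mm ^ 2 / e)).
  destruct (floor_scale K0 e G 1 PK0 ltac:(lra) ltac:(lia)) as (y2 & Hy2 & FS).
  assert (PeS : 0 < e * sqrt kappa / 3) by (apply Rdiv_lt_0_compat; [apply Rmult_lt_0_compat|]; lra).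
  destruct (pow_exp_small 1 (1 / 2) (e * sqrt kappa / 3)) as (y3 & Hy3 & VS); [lra|auto|].
  exists (y1 + y2 + y3); split; [lra|]; intros T M HT1 Hl HT HM.
  set (l := ln T) in *; set (y := ln l) in *.
  assert (El : exp y = l) by (unfold y; apply exp_ln; auto).
  assert (Y1 : 1 <= y) by lra.
  destruct (FS y ltac:(lra)) as (A & F1 & F2 & F3 & F4 & F5); clear FS.
  rewrite El, pow_1 in F1, F2; set (x := INR A) in *.
  pose proof (pow2_ge_0 z0) as PG1; pose proof (exp_pos (mm ^ 2 / e)) as PG2; pose proof (pos_INR n0) as PG3.
  assert (HA : (n0 <= A)%nat) by (apply INR_le; fold x; unfold G in F4; lra).
  assert (HA3 : (3 <= A)%nat).
  { apply INR_le; fold x; simpl; lra. }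
  set (k := (A ^ b - A)%nat).
  assert (HAb : (A <= A ^ b)%nat).
  { rewrite <- (Nat.pow_1_r A) at 1; apply Nat.pow_le_mono_r; lia. }
  assert (HAk : (A + k = A ^ b)%nat) by (unfold k; lia).
  set (ps := primes_in A k).
  set (s := sqrt x); assert (Ps : 0 < s) by (apply sqrt_lt_R0; lra).
  assert (Ess : s * s = x) by (apply sqrt_sqrt; lra).
  assert (Lx : 1 <= ln x) by (apply ln_gt_1; auto).
  assert (Lme : mm ^ 2 / e <= ln x).
  { rewrite <- (ln_exp (mm ^ 2 / e)); apply ln_le; [auto|unfold G in F4; lra]. }
  assert (Sbig : INR b * ln x <= e * s).
  { assert (Z : z0 <= s).
    { apply Rsqr_incr_0_var; [|lra]; unfold Rsqr; rewrite Ess; unfold G in F4; lra. }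
    specialize (LZ s Z).
    assert (L2 : ln x = 2 * ln s) by (rewrite <- Ess, ln_mult by auto; ring).
    rewrite L2; apply Rle_trans with (INR b * (2 * (e / (2 * INR b) * s))); [|right; field; lra].
    apply Rmult_le_compat_l; lra. }
  (* The absolute value changes nothing on the primes used; it makes [rho] nonnegative at every
     natural number, whatever [ln] and the inverse return at 0 and 1. *)
  set (rho := fun p => s * (Rpower (INR p) (- (1 / 2)) * Rabs (/ ln (INR p)))).
  assert (Hrho : forall p, 0 <= rho p).
  { intros p; unfold rho; apply Rmult_le_pos; [lra|]; apply Rmult_le_pos; [left; apply exp_pos|apply Rabs_pos]. }
  set (f := fun p : nat => / (INR p * ln (INR p))).
  destruct (PS A k HA) as [SL SU]; fold f in SL, SU; fold ps in SL, SU.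
  set (Sg := lsumR (fun p => Cmod (a p) ^ 2 * f p) ps).
  change (lsumR (fun p => Cmod (a p) ^ 2 * / (INR p * ln (INR p))) ps) with Sg in SL, SU.
  rewrite HAk in SL; fold x in SL, SU.
  rewrite pow_INR, ln_pow in SL by (fold x; lra); fold x in SL.
  set (w := / ln x) in *.
  assert (Pw : 0 < w) by (apply Rinv_0_lt_compat; lra).
  assert (SL' : kappa * (1 - e) * w <= Sg).
  { eapply Rle_trans; [|apply SL]; rewrite Rinv_mult; fold w.
    assert (Q : (kappa - d) * (w - e / 3 * w) <= (kappa - d) * (w - / INR b * w)).
    { apply Rmult_le_compat_l; [unfold d; clear - Hk He; nra|]; apply Rplus_le_compat_l, Ropp_le_contravar.
      apply Rmult_le_compat_r; lra. }
    assert (kappa * (1 - e) * w <= (kappa - d) * (w - e / 3 * w) - d * w); [|lra].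
    replace ((kappa - d) * (w - e / 3 * w) - d * w) with (((kappa - d) * (1 - e / 3) - d) * w) by ring.
    apply Rmult_le_compat_r; [lra|]; unfold d; clear - Hk He; nra. }
  assert (SU' : Sg <= kappa * (1 + e) * w).
  { eapply Rle_trans; [apply SU|]; apply Rmult_le_compat_r; [lra|]; unfold d; clear - Hk He; nra. }
  assert (PSg : 0 <= Sg).
  { eapply Rle_trans; [|apply SL']; apply Rmult_le_pos; [apply Rmult_le_pos|]; lra. }
  assert (Hps : forall p, In p ps -> is_prime p /\ x <= INR p /\ ln x <= ln (INR p) <= INR b * ln x
                 /\ Cmod (a p) ^ 2 <= mm ^ 2 /\ s * Rpower (INR p) (- (1 / 2)) <= 1
                 /\ Rpower (INR p) (- (1 / 2)) * Rpower (INR p) (- (1 / 2)) = / INR p).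
  { intros p Hp; apply primes_in_spec in Hp; destruct Hp as [Pp [B1 B2]].
    assert (X1 : x <= INR p) by (apply le_INR; lia).
    assert (X2 : INR p <= x ^ b) by (unfold x; rewrite <- pow_INR; apply le_INR; lia).
    assert (X3 : ln x <= ln (INR p)) by (apply ln_le; lra).
    split; [auto|]; split; [auto|]; split; [split; auto|split; [|split]].
    - rewrite <- ln_pow by lra; apply ln_le; lra.
    - apply sq_coef_le; unfold mm; apply (selberg_coef_le L a m alpha); auto.
    - unfold s; rewrite <- Rpower_sqrt by lra; unfold Rpower; rewrite <- exp_plus.
      apply Rle_trans with (exp 0); [apply exp_le; lra|rewrite exp_0; lra].
    - rewrite <- Rpower_plus; replace (- (1 / 2) + - (1 / 2)) with (- (1)) by field.
      rewrite Rpower_Ropp, Rpower_1; lra. }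
  assert (EAB : forall p, In p ps -> resA a rho p = s ^ 2 * / ln (INR p) * (Cmod (a p) ^ 2 * f p) /\
                 resB a (1 / 2) rho p = s * (Cmod (a p) ^ 2 * f p)).
  { intros p Hp; destruct (Hps p Hp) as (Q1 & Q2 & Q3 & Q4 & Q5 & Q6).
    unfold resA, resB, rho, f; rewrite Rabs_pos_eq by (left; apply Rinv_0_lt_compat; lra).
    rewrite Rinv_mult, <- Q6; split; ring. }
  assert (ZB : lsumR (resB a (1 / 2) rho) ps = s * Sg).
  { unfold Sg; rewrite <- lsumR_scal; apply Rle_antisym; apply lsumR_le; intros p Hp;
      destruct (EAB p Hp) as [_ ->]; lra. }
  destruct (eta_budget e He) as (_ & Bu1 & Bu2 & _).
  set (V := sqrt kappa * (sqrt l / sqrt y)).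
  assert (Psl : 0 < sqrt l) by (apply sqrt_lt_R0; lra).
  assert (Psy : 0 < sqrt y) by (apply sqrt_lt_R0; lra).
  assert (Esl : sqrt l * sqrt l = l) by (apply sqrt_sqrt; lra).
  assert (Esy : sqrt y * sqrt y = y) by (apply sqrt_sqrt; lra).
  assert (Esk : sqrt kappa * sqrt kappa = kappa) by (apply sqrt_sqrt; lra).
  assert (Sy : sqrt y <= y).
  { rewrite <- Esy at 2; assert (1 <= sqrt y) by (rewrite <- sqrt_1; apply sqrt_le_1_alt; auto).
    rewrite <- (Rmult_1_l (sqrt y)) at 1; apply Rmult_le_compat_r; lra. }
  assert (PV : 3 <= e * V).
  { specialize (VS y ltac:(lra)); rewrite pow_1, exp_Ropp in VS.
    replace (exp (1 / 2 * y)) with (sqrt l) in VS.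
    2: { rewrite <- Rpower_sqrt by auto; unfold Rpower; fold y; f_equal; field. }
    apply Rle_trans with (e * (sqrt kappa * (sqrt l / y))).
    - apply Rmult_le_reg_r with (y * / sqrt l); [apply Rmult_lt_0_compat; [lra|now apply Rinv_0_lt_compat]|].
      replace (e * (sqrt kappa * (sqrt l / y)) * (y * / sqrt l)) with (e * sqrt kappa) by (field; lra); lra.
    - unfold V; apply Rmult_le_compat_l; [lra|]; apply Rmult_le_compat_l; [lra|].
      apply Rmult_le_compat_l; [lra|]; apply Rinv_le_contravar; lra. }
  assert (ZV : (1 - 10 * e) * V <= (1 - e) / (1 + e) * lsumR (resB a (1 / 2) rho) ps).
  { rewrite ZB.
    assert (SP : (1 - e) * th * (sqrt l * sqrt y / sqrt kappa) <= s).
    { apply Rsqr_incr_0_var; [|lra]; unfold Rsqr; rewrite Ess.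
      apply Rle_trans with ((1 - e) * th * (l * y / kappa)).
      - replace ((1 - e) * th * (sqrt l * sqrt y / sqrt kappa) * ((1 - e) * th * (sqrt l * sqrt y / sqrt kappa)))
          with ((1 - e) * th * ((1 - e) * th) * ((sqrt l * sqrt l) * (sqrt y * sqrt y) / (sqrt kappa * sqrt kappa)))
          by (field; lra).
        rewrite Esl, Esy, Esk; apply Rmult_le_compat_r.
        + left; apply Rdiv_lt_0_compat; [apply Rmult_lt_0_compat|]; lra.
        + rewrite <- (Rmult_1_r ((1 - e) * th)) at 3; apply Rmult_le_compat_l; [apply Rmult_le_pos; lra|].
          rewrite <- (Rmult_1_l 1); apply Rmult_le_compat; lra.
      - eapply Rle_trans; [|apply F2]; unfold K0; right; field; lra. }
    apply Rle_trans with ((1 - e) / (1 + e) * (((1 - e) * th * (sqrt l * sqrt y / sqrt kappa)) * (kappa * (1 - e) * / ((1 + e) * y)))).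
    - replace ((1 - e) / (1 + e) * (((1 - e) * th * (sqrt l * sqrt y / sqrt kappa)) * (kappa * (1 - e) * / ((1 + e) * y))))
        with ((1 - e) ^ 3 * th / (1 + e) ^ 2 * (kappa / sqrt kappa * (sqrt l * sqrt y / y))) by (field; lra).
      replace (kappa / sqrt kappa * (sqrt l * sqrt y / y)) with V.
      + apply Rmult_le_compat_r; [unfold V; left; apply Rmult_lt_0_compat; [|apply Rdiv_lt_0_compat]; lra|].
        apply Rmult_le_reg_r with ((1 + e) ^ 2); [apply pow_lt; lra|].
        unfold Rdiv; rewrite (Rmult_assoc _ (/ _)), Rinv_l by (apply pow_nonzero; lra); unfold th; lra.
      + unfold V; rewrite <- Esk at 2; rewrite <- Esy at 3; field; lra.
    - apply Rmult_le_compat_l; [left; apply Rdiv_lt_0_compat; lra|].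
      apply Rmult_le_compat; auto.
      + left; repeat apply Rmult_lt_0_compat; try lra; now apply Rinv_0_lt_compat.
      + apply Rmult_le_pos; [apply Rmult_le_pos; lra|]; left; apply Rinv_0_lt_compat, Rmult_lt_0_compat; lra.
      + eapply Rle_trans; [|apply SL']; apply Rmult_le_compat_l; [apply Rmult_le_pos; lra|].
        apply Rinv_le_contravar; lra. }
  assert (ZV1 : 1 <= (1 - e) / (1 + e) * lsumR (resB a (1 / 2) rho) ps).
  { eapply Rle_trans; [|apply ZV]; now apply eta_V_ge. }
  apply finish_bound with (Z := (1 - e) / (1 + e) * lsumR (resB a (1 / 2) rho) ps); auto; [lra|].
  (* The bound [A0] for [resA] is [e] itself, because [resA p <= mm^2 / ln p]; this removes m from
     the constant. *)
  apply (RE T M ps rho e e); auto; try lra.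
  - fold l y; lra.
  - intros p Hp; apply Hps; auto.
  - apply primes_in_NoDup.
  - intros p Hp; destruct (Hps p Hp) as (Q1 & Q2 & Q3 & Q4 & Q5 & Q6).
    pose proof (exp_pos (- (1 / 2) * ln (INR p))) as PP; fold (Rpower (INR p) (- (1 / 2))) in PP.
    set (pi := Rpower (INR p) (- (1 / 2))) in *.
    pose proof (pow2_ge_0 (Cmod (a p))) as PA2; set (a2 := Cmod (a p) ^ 2) in *.
    set (v := / ln (INR p)).
    assert (Pv : 0 < v) by (apply Rinv_0_lt_compat; lra).
    assert (Hv : v <= w) by (apply Rinv_le_contravar; lra).
    assert (w1 : w <= 1) by (unfold w; rewrite <- Rinv_1; apply Rinv_le_contravar; lra).
    assert (mw : mm ^ 2 * w <= e).
    { apply Rmult_le_reg_r with (ln x); [lra|]; unfold w; rewrite Rmult_assoc, Rinv_l by lra.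
      apply Rle_trans with (e * (mm ^ 2 / e)); [right; field; lra|apply Rmult_le_compat_l; lra]. }
    assert (Psp : 0 < s * pi) by (apply Rmult_lt_0_compat; lra).
    assert (a2v : a2 * v <= e).
    { eapply Rle_trans; [|apply mw]; apply Rmult_le_compat; lra. }
    assert (a2v0 : 0 <= a2 * v) by (apply Rmult_le_pos; lra).
    destruct (EAB p Hp) as [-> ->]; unfold f; rewrite Rinv_mult, <- Q6; fold v a2.
    assert (pi1 : pi <= 1).
    { unfold pi, Rpower; apply Rle_trans with (exp 0); [apply exp_le; lra|rewrite exp_0; lra]. }
    split.
    + replace (s ^ 2 * v * (a2 * (pi * pi * v))) with (a2 * v * ((s * pi) * (s * pi) * v)) by ring.
      apply Rle_trans with (a2 * v * 1); [|lra]; apply Rmult_le_compat_l; auto.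
      rewrite <- (Rmult_1_l 1); apply Rmult_le_compat; [apply Rmult_le_pos| | |]; try lra.
      rewrite <- (Rmult_1_l 1); apply Rmult_le_compat; lra.
    + replace (s * (a2 * (pi * pi * v))) with (a2 * v * ((s * pi) * pi)) by ring.
      apply Rle_trans with (a2 * v * 1); [|lra]; apply Rmult_le_compat_l; auto.
      rewrite <- (Rmult_1_l 1); apply Rmult_le_compat; lra.
  - intros p Hp; destruct (Hps p Hp) as (Q1 & Q2 & Q3 & Q4 & Q5 & Q6); fold l y.
    apply Rle_trans with (INR b * ln x); [lra|].
    replace (2 * INR b * y) with (INR b * (2 * y)) by ring; apply Rmult_le_compat_l; [lra|].
    apply Rle_trans with ((1 + e) * y); [lra|apply Rmult_le_compat_r; lra].
  - apply Rle_trans with ((1 - e) * l); [|fold l; apply Rmult_le_compat_r; lra].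
    eapply Rle_trans.
    + apply (lsumR_le _ (fun p => (x * (1 + e)) * (Cmod (a p) ^ 2 * f p))).
      intros p Hp; destruct (Hps p Hp) as (Q1 & Q2 & Q3 & Q4 & Q5 & Q6).
      destruct (EAB p Hp) as [-> ->].
      replace (ln (INR p) * (s ^ 2 * / ln (INR p) * (Cmod (a p) ^ 2 * f p) + s * (Cmod (a p) ^ 2 * f p)))
        with ((s * s + s * ln (INR p)) * (Cmod (a p) ^ 2 * f p)) by (field; lra).
      apply Rmult_le_compat_r.
      * apply Rmult_le_pos; [apply pow2_ge_0|]; left; apply Rinv_0_lt_compat, Rmult_lt_0_compat; lra.
      * rewrite <- Ess; replace (s * s * (1 + e)) with (s * s + s * (e * s)) by ring.
        apply Rplus_le_compat_l, Rmult_le_compat_l; lra.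
    + rewrite lsumR_scal; fold Sg.
      apply Rle_trans with ((K0 * (l * y)) * (1 + e) * (kappa * (1 + e) * / ((1 - e) * y))).
      { apply Rmult_le_compat; auto; [apply Rmult_le_pos; lra|apply Rmult_le_compat_r; lra|].
        eapply Rle_trans; [apply SU'|]; apply Rmult_le_compat_l; [apply Rmult_le_pos; lra|].
        apply Rinv_le_contravar; [apply Rmult_lt_0_compat|]; lra. }
      replace ((K0 * (l * y)) * (1 + e) * (kappa * (1 + e) * / ((1 - e) * y)))
        with ((1 + e) ^ 2 * th / (1 - e) * l) by (unfold K0; field; lra).
      apply Rmult_le_compat_r; [lra|].
      apply Rmult_le_reg_r with (1 - e); [lra|]; unfold Rdiv; rewrite (Rmult_assoc _ (/ _)), Rinv_l by lra.
      unfold th; lra.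
Qed.

(** * From a fixed loss [e] to the o(1) form *)

Lemma large_values (L : C -> C) (a : nat -> C) (m : nat) (alpha : nat -> nat -> C) (kappa sigma e : R) :
  selberg_class_poly L a m alpha -> 0 < kappa -> selberg_normality a kappa ->
  1/2 <= sigma < 1 -> 0 < e <= 1/24 ->
  exists y0, 1 <= y0 /\ forall T M, 1 < T -> 0 < ln T -> y0 <= ln (ln T) ->
    (forall t, T <= t <= 2 * T -> Cmod (L (sigma, t)) <= M) ->
    exp ((1 - 12 * e) * (C_L kappa m sigma
       * (Rpower (ln T) (1 - sigma) / Rpower (ln (ln T)) (vartheta sigma)))) <= M.
Proof.
  intros HL Hk HS Hs He; unfold C_L, vartheta; destruct (Req_EM_T sigma (1 / 2)) as [->|Hn].
  - destruct (large_values_half L a m alpha kappa e HL Hk HS He) as (y0 & Hy0 & H).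
    exists y0; split; auto; intros T M HT1 Hl Hy HM; specialize (H T M HT1 Hl Hy HM).
    replace (1 - 1 / 2) with (/ 2) by lra; replace (1 / 2) with (/ 2) by lra.
    rewrite !Rpower_sqrt by lra; auto.
  - destruct (large_values_right L a m alpha kappa sigma e HL Hk HS ltac:(lra) He) as (y0 & Hy0 & H).
    exists y0; split; auto; intros T M HT1 Hl Hy HM; specialize (H T M HT1 Hl Hy HM).
    rewrite Rpower_1 by lra; auto.
Qed.

Lemma C_L_pos (kappa sigma : R) (m : nat) : 0 < kappa -> 1/2 <= sigma < 1 -> 0 < C_L kappa m sigma.
Proof.
  intros Hk Hs; unfold C_L; destruct (Req_EM_T sigma (1 / 2)); [now apply sqrt_lt_R0|].
  apply Rmult_lt_0_compat; [apply Rmult_lt_0_compat; apply exp_pos|].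
  apply Rdiv_lt_0_compat; [apply exp_pos|]; apply Rmult_lt_0_compat; [lra|apply exp_pos].
Qed.

Lemma vertical_max (L : C -> C) (sigma T : R) : continuation L -> 0 < T ->
  exists M, is_max_on (fun t => Cmod (L (sigma, t))) T (2 * T) M.
Proof.
  intros HC HT.
  destruct (continuity_ab_maj (fun t => Cmod (L (sigma, t))) T (2 * T)) as (t & Ht & Ht'); [lra| |].
  - intros t Ht; apply continuity_pt_filterlim.
    assert (Cc := cdiff_ccont _ _ (L_cdiff L HC sigma t ltac:(lra))).
    apply continuous_eps; intros e He; destruct (Cc e He) as (d & Hd & K).
    exists d; split; auto; intros u Hu.
    assert (Hd' : Cmod ((sigma, u) - (sigma, t)) < d).
    { eapply Rle_lt_trans; [apply Cmod_le_abs|]; simpl.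
      replace (sigma + - sigma) with 0 by ring; rewrite Rabs_R0; unfold Rminus in Hu; lra. }
    specialize (K _ Hd').
    apply Rabs_def1.
    + eapply Rle_lt_trans; [apply Cmod_triangle_inv|auto].
    + pose proof (Cmod_triangle_inv (L (sigma, t)) (L (sigma, u))) as Q.
      rewrite Cmod_minus_sym in Q; lra.
  - exists (Cmod (L (sigma, t))); split; [exists t; split; auto|auto].
Qed.

Theorem theorem1 (L : C -> C) (a : nat -> C) (m : nat) (alpha : nat -> nat -> C)
    (kappa : R)
    (hL : selberg_class_poly L a m alpha)
    (hkappa : 0 < kappa)
    (hnorm : selberg_normality a kappa)
    (sigma : R) (hsigma : 1 / 2 <= sigma < 1) :
  exists eps : R -> R, is_lim eps p_infty 0 /\
    Rbar_locally p_infty (fun T =>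
      exists M : R,
        is_max_on (fun t => Cmod (L (sigma, t))) T (2 * T) M /\
        exp ((C_L kappa m sigma + eps T)
             * (Rpower (ln T) (1 - sigma)
                / Rpower (ln (ln T)) (vartheta sigma))) <= M).
Proof.
  set (C0 := C_L kappa m sigma); assert (PC : 0 < C0) by now apply C_L_pos.
  set (sc := fun T => Rpower (ln T) (1 - sigma) / Rpower (ln (ln T)) (vartheta sigma)).
  assert (Psc : forall T, 0 < sc T) by (intros; apply Rdiv_lt_0_compat; apply exp_pos).
  (* The maximum is named as a least upper bound so that it is a function of [T], from which the
     error term can be defined. *)
  set (mx := fun T => real (Lub_Rbar (fun v => exists t, T <= t <= 2 * T /\ v = Cmod (L (sigma, t))))).
  assert (Hmx : forall T, 0 < T -> is_max_on (fun t => Cmod (L (sigma, t))) T (2 * T) (mx T)).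
  { intros T HT; destruct (vertical_max L sigma T (scp_continuation _ _ _ _ hL) HT) as (M & HM).
    replace (mx T) with M; auto; unfold mx; destruct HM as [(t & Ht & Et) HM].
    rewrite (is_lub_Rbar_unique _ (Finite M)); auto; split.
    - intros v (u & Hu & ->); apply HM; auto.
    - intros B HB; rewrite <- Et; apply HB; exists t; auto. }
  assert (Big : forall e, 0 < e <= 1/24 -> exists T0, forall T, T0 < T ->
     0 < T /\ exp ((1 - 12 * e) * (C0 * sc T)) <= mx T).
  { intros e He; destruct (large_values L a m alpha kappa sigma e hL hkappa hnorm hsigma He) as (y0 & Hy0 & H).
    exists (exp (exp y0)); intros T HT.
    pose proof (exp_ineq1_le (exp y0)); pose proof (exp_ineq1_le y0).
    assert (HlT : exp y0 < ln T) by (rewrite <- (ln_exp (exp y0)); apply ln_increasing; [apply exp_pos|auto]).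
    assert (HllT : y0 < ln (ln T)) by (rewrite <- (ln_exp y0); apply ln_increasing; [apply exp_pos|auto]).
    split; [lra|]; apply H; try lra; apply Hmx; lra. }
  (* The quotient is the constant that the maximum actually attains. It may be far larger than [C0],
     so the error is cut off at 0; its limit then only requires the lower bounds, one for each
     [e]. *)
  exists (fun T => Rmin 0 (ln (mx T) / sc T - C0)); split.
  - apply is_lim_spec; intros e; simpl.
    set (e' := Rmin (1/24) (e / (24 * C0))).
    assert (He : 0 < e / (24 * C0)) by (apply Rdiv_lt_0_compat; [apply cond_pos|lra]).
    assert (He' : 0 < e' <= 1/24) by (split; [apply Rmin_pos; lra|apply Rmin_l]).
    destruct (Big e' He') as (T0 & HT0); exists T0; intros T HT; destruct (HT0 T HT) as [PT HM].
    rewrite Rminus_0_r, Rabs_left1 by apply Rmin_l.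
    assert (Lw : (1 - 12 * e') * C0 <= ln (mx T) / sc T).
    { apply Rmult_le_reg_r with (sc T); auto; unfold Rdiv; rewrite (Rmult_assoc (ln _)), Rinv_l, Rmult_1_r
        by (apply Rgt_not_eq, Psc).
      rewrite <- (ln_exp ((1 - 12 * e') * C0 * sc T)); apply ln_le; [apply exp_pos|].
      rewrite Rmult_assoc; auto. }
    assert (E1 : 12 * e' * C0 <= e / 2).
    { apply Rle_trans with (12 * (e / (24 * C0)) * C0); [|right; field; lra].
      apply Rmult_le_compat_r; [lra|]; apply Rmult_le_compat_l; [lra|apply Rmin_r]. }
    pose proof (cond_pos e); unfold Rmin; destruct (Rle_dec 0 (ln (mx T) / sc T - C0)); lra.
  - destruct (Big (1/24) ltac:(lra)) as (T0 & HT0); exists T0; intros T HT; destruct (HT0 T HT) as [PT HM].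
    exists (mx T); split; [now apply Hmx|]; fold (sc T).
    assert (Pm : 0 < mx T) by (eapply Rlt_le_trans; [apply exp_pos|apply HM]).
    rewrite <- (exp_ln (mx T)) at 2 by auto; apply exp_le.
    apply Rle_trans with (ln (mx T) / sc T * sc T); [|right; field; apply Rgt_not_eq, Psc].
    apply Rmult_le_compat_r; [left; apply Psc|].
    pose proof (Rmin_r 0 (ln (mx T) / sc T - C0)); lra.
Qed.
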